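(* The transfer function of the strictly anticausal operator $\mathcal T=\{\Delta\mathcal K_\circ\}_-$ being $T(z)=\overline C(z^{-1}I-\overline A)^{-1}\overline B$, let $f:(\gamma,\Gamma)\in\mathbb R\times\mathbb R^{d_x\times d_w}\mapsto\mathcal N$ return the positive definite operator with transfer function, for $z\in\mathbb T$, $$N(z)=\frac14\Big(I+\sqrt{I+4\gamma^{-1}\,\Gamma^\ast(z^{-1}I-\overline A)^{-\ast}\,\overline C^\ast\overline C\,(z^{-1}I-\overline A)^{-1}\Gamma}\Big)^2 .$$ Then the optimal solution $\mathcal N_\star=\mathcal L_\star^\ast\mathcal L_\star$ satisfies $\mathcal N_\star=f(\gamma_\star,\Gamma_\star)$, where $$\Gamma_\star:=\frac1{2\pi}\int_0^{2\pi}(I-e^{j\omega}\overline A)^{-1}\,\overline B\,L_\star(e^{j\omega})\,d\omega,$$ and $\gamma_\star>0$ is such that $\mathsf{BW}(\mathcal L_\star\mathcal L_\star^\ast,\mathcal I)=r$.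
   Context: System. $A,B_u,B_w,C$ are known real matrices with $(A,B_u)$ stabilizable, $(A,B_w)$ controllable, $(A,C)$ observable, defining $x_{t+1}=Ax_t+B_uu_t+B_ww_t$, $s_t=Cx_t$ with $x_t\in\mathbb R^{d_x}$, $u_t\in\mathbb R^{d_u}$, $w_t\in\mathbb R^{d_w}$, $t\in\mathbb Z$, i.e. $\mathbf s=\mathcal F\mathbf u+\mathcal G\mathbf w$ with $\mathcal F,\mathcal G$ the strictly causal block Toeplitz operators with transfer functions $F(z)=C(zI-A)^{-1}B_u$, $G(z)=C(zI-A)^{-1}B_w$. Operators. A block Toeplitz operator $\mathcal V=(V_{t-s})_{t,s\in\mathbb Z}$ has transfer function $V(z)=\sum_iV_iz^{-i}$; it is causal if $V_i=0$ for $i<0$, strictly anticausal if $V_i=0$ for $i\ge0$; $\{\cdot\}_+,\{\cdot\}_-$ are the causal and strictly anticausal parts; $\operatorname{tr}(\mathcal V)=\frac1{2\pi}\int_0^{2\pi}\operatorname{Tr}V(e^{j\omega})\,d\omega$; $\mathbb T$ is the complex unit circle; $X^{-\ast}=(X^{-1})^\ast$; $\sqrt{\cdot}$ is the positive semidefinite square root. Notation. $\mathcal K_\circ=-(\mathcal I+\mathcal F^\ast\mathcal F)^{-1}\mathcal F^\ast\mathcal G$; $\mathcal R_{\mathcal K}=(\mathcal K-\mathcal K_\circ)^\ast(\mathcal I+\mathcal F^\ast\mathcal F)(\mathcal K-\mathcal K_\circ)$; $\Delta^\ast\Delta=\mathcal I+\mathcal F^\ast\mathcal F$ is the canonical spectral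 factorization with $\Delta,\Delta^{-1}$ causal; $\mathsf{BW}(\mathcal M_1,\mathcal M_2)^2=\operatorname{tr}[\mathcal M_1+\mathcal M_2-2(\mathcal M_2^{1/2}\mathcal M_1\mathcal M_2^{1/2})^{1/2}]$. State-space parameters. Let $P\succ0$ be the unique stabilizing solution of $P=C^\top C+A^\ast PA-A^\ast PB_u(I+B_u^\ast PB_u)^{-1}B_u^\ast PA$, $K_{\mathrm{lqr}}=(I+B_u^\ast PB_u)^{-1}B_u^\ast PA$, $A_k=A-B_uK_{\mathrm{lqr}}$, and $$\overline A=A_k^\ast,\qquad\overline B=A_k^\ast PB_w,\qquad\overline C=-(I+B_u^\ast PB_u)^{-\ast/2}B_u^\ast .$$ Optimal solution. The nominal disturbances are uncorrelated, $\mathcal M_\circ=\mathcal I$, and $r>0$. $(\mathcal K_\star,\mathcal M_\star)$ is the unique saddle point of $\sup_{\mathcal M\succ0}\inf_{\mathcal K\in\mathscr K}\operatorname{tr}(\mathcal R_{\mathcal K}\mathcal M)$ s.t. $\mathsf{BW}(\mathcal M,\mathcal I)\le r$, where $\mathscr K$ is the set of bounded causal $d_u\times d_w$-block Toeplitz operators and $\mathcal M$ ranges over Toeplitz operators. $\mathcal M_\star=\mathcal L_\star\mathcal L_\star^\ast$ is the canonical spectral factorization, $\mathcal L_\star,\mathcal L_\star^{-1}$ causal (unique after fixing the right constant unitary factor), with transfer function $L_\star(z)$. The scalar $\gamma_\star>0$ is the multiplier in the optimality conditions: $\mathcal M_\star=(\mathcal I-\gamma_\star^{-1}\mathcal R_{\mathcal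 K_\star})^{-2}$, and $\mathcal L_\star$ satisfies $\mathcal L_\star^\ast\mathcal L_\star=\frac14\big(\mathcal I+\sqrt{\mathcal I+4\gamma_\star^{-1}\{\mathcal T\mathcal L_\star\}_-^\ast\{\mathcal T\mathcal L_\star\}_-}\big)^2$.
   Formalization: F and G are required to be strictly causal in the sense of Fourier coefficients on the unit circle, which forces A to be Schur stable (else F*F and the anticausal part are ill-defined or T(z) fails); Δ is normalized by a positive definite constant block. *)

(* Defs.v *)
From HB Require Import structures.
From mathcomp Require Import all_boot all_order all_algebra.
From mathcomp Require Import all_classical all_reals all_analysis.
From mathcomp Require Import complex.

Set Implicit Arguments.
Unset Strict Implicit.
Unset Printing Implicit Defensive.

Import Order.TTheory GRing.Theory Num.Theory.

Local Open Scope classical_set_scope.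
Local Open Scope ring_scope.
Local Open Scope complex_scope.
Local Open Scope sesquilinear_scope.

Definition toC {R : realType} {m n : nat} (A : 'M[R]_(m, n)) : 'M[R[i]]_(m, n) :=
  map_mx (real_complex R) A.

Definition psdmx {R : realType} {n : nat} (X : 'M[R[i]]_n) : Prop :=
  X \is hermsymmx /\ forall u : 'rV[R[i]]_n, 0 <= (u *m X *m u ^t*) 0 0.

Definition posdefmx {R : realType} {n : nat} (X : 'M[R[i]]_n) : Prop :=
  X \is hermsymmx /\
  forall u : 'rV[R[i]]_n, u != 0 -> 0 < (u *m X *m u ^t*) 0 0.

(* Junk value 0 when X is not positive semidefinite; otherwise the set below
   is a singleton. *)
Definition sqrtmx {R : realType} {n : nat} (X : 'M[R[i]]_n) : 'M[R[i]]_n :=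
  xget 0 [set Y | psdmx Y /\ Y *m Y = X].

Definition schur {R : realType} {n : nat} (A : 'M[R]_n) : Prop :=
  forall l : R[i], eigenvalue (toC A) l -> `|l| < 1.

Definition stabilizable {R : realType} {n m : nat}
    (A : 'M[R]_n) (B : 'M[R]_(n, m)) : Prop :=
  exists K : 'M[R]_(m, n), schur (A - B *m K).

Definition controllable {R : realType} {n m : nat}
    (A : 'M[R]_n) (B : 'M[R]_(n, m)) : Prop :=
  \rank (\mxrow_(i < n) (A ^+ i *m B)) = n.

Definition observable {R : realType} {n p : nat}
    (A : 'M[R]_n) (C : 'M[R]_(p, n)) : Prop :=
  \rank (\mxcol_(i < n) (C *m A ^+ i)) = n.

(* A block Toeplitz operator is represented by its transfer function, of which
   only the restriction to the unit circle, up to null sets, is relevant.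
   Sums, products, adjoints, inverses, square roots and positivity of operators
   then are those of the transfer functions, pointwise on the circle. *)
Definition transfer (R : realType) (p q : nat) : Type :=
  R[i] -> 'M[R[i]]_(p, q).

Definition expj {R : realType} (w : R) : R[i] := cos w +i* sin w.

Definition ae_circle {R : realType} (Q : R[i] -> Prop) : Prop :=
  {ae @lebesgue_measure R, forall w, w \in `[0, 2 * pi] -> Q (expj w)}.

Definition teq {R : realType} {p q : nat} (V W : transfer R p q) : Prop :=
  ae_circle (fun z => V z = W z).

Definition circle_mean {R : realType} (f : R[i] -> R[i]) : R[i] :=
  ((2 * pi)^-1 * \int[lebesgue_measure]_(w in `[0, 2 * pi]) complex.Re (f (expj w)))
  +i* ((2 * pi)^-1 * \int[lebesgue_measure]_(w in `[0, 2 * pi]) complex.Im (f (expj w))).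

Definition mx_mean {R : realType} {p q : nat} (V : transfer R p q) :
    'M[R[i]]_(p, q) :=
  \matrix_(i, j) circle_mean (fun z => V z i j).

Definition tr_op {R : realType} {n : nat} (V : transfer R n n) : R[i] :=
  circle_mean (fun z => \tr (V z)).

(* The block V_k of V(z) = \sum_k V_k z^(-k); hence z ^ k and not z ^ (- k). *)
Definition block {R : realType} {p q : nat} (V : transfer R p q) (k : int) :
    'M[R[i]]_(p, q) :=
  mx_mean (fun z => z ^ k *: V z).

(* The blocks are real matrices, the signals being real vector sequences. *)
Definition toeplitz {R : realType} {p q : nat} (V : transfer R p q) : Prop :=
  (forall i j,
    (@lebesgue_measure R).-integrable `[0, 2 * pi]
      (fun w => (complex.Re (V (expj w) i j))%:E) /\
    (@lebesgue_measure R).-integrable `[0, 2 * pi]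
      (fun w => (complex.Im (V (expj w) i j))%:E)) /\
  forall k : int, block V k \is a realmx.

Definition bounded_op {R : realType} {p q : nat} (V : transfer R p q) : Prop :=
  exists c : R, ae_circle (fun z => forall i j, `|V z i j| <= c%:C).

Definition posdef_op {R : realType} {n : nat} (V : transfer R n n) : Prop :=
  ae_circle (fun z => posdefmx (V z)).

Definition causal {R : realType} {p q : nat} (V : transfer R p q) : Prop :=
  toeplitz V /\ forall k : int, k < 0 -> block V k = 0.

(* The blocks are the Fourier coefficients on the unit circle. Hence for
   V(z) = C (zI - A)^(-1) B with (A, B) controllable and (A, C) observable this
   holds only if A is Schur stable: an unstable pole contributes to the
   anticausal blocks. *)
Definition strictly_causal {R : realType} {p q : nat} (V : transfer R p q) : Prop :=
  toeplitz V /\ forall k : int, k <= 0 -> block V k = 0.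

(* W = {V}_- *)
Definition anticausal_part {R : realType} {p q : nat} (V W : transfer R p q) : Prop :=
  toeplitz W /\ forall k : int, block W k = if k < 0 then block V k else 0.

Definition id_op {R : realType} {n : nat} : transfer R n n := fun=> 1%:M.

Definition adj_op {R : realType} {p q : nat} (V : transfer R p q) : transfer R q p :=
  fun z => (V z) ^t*.

Definition mul_op {R : realType} {p q s : nat}
    (V : transfer R p q) (W : transfer R q s) : transfer R p s :=
  fun z => V z *m W z.

Definition inv_op {R : realType} {n : nat} (V : transfer R n n) : transfer R n n :=
  fun z => invmx (V z).

Definition BW {R : realType} {n : nat} (M1 M2 : transfer R n n) : R :=
  Num.sqrt (complex.Re (tr_op (fun z =>
    M1 z + M2 z - 2 *: sqrtmx (sqrtmx (M2 z) *m M1 z *m sqrtmx (M2 z))))).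

Definition ss_transfer {R : realType} {n m p : nat} (C : 'M[R]_(p, n))
    (A : 'M[R]_n) (B : 'M[R]_(n, m)) : transfer R p m :=
  fun z => toC C *m invmx (z%:M - toC A) *m toC B.

Definition IFF {R : realType} {p q : nat} (F : transfer R p q) : transfer R q q :=
  fun z => 1%:M + (F z) ^t* *m F z.

Definition K_nc {R : realType} {p q s : nat}
    (F : transfer R p q) (G : transfer R p s) : transfer R q s :=
  fun z => - (invmx (IFF F z) *m (F z) ^t* *m G z).

Definition regret_op {R : realType} {p q s : nat}
    (F : transfer R p q) (G : transfer R p s) (K : transfer R q s) :
    transfer R s s :=
  fun z => (K z - K_nc F G z) ^t* *m IFF F z *m (K z - K_nc F G z).

(* Delta ^* Delta = V with Delta and its inverse causal determines Delta up to
   a constant orthogonal matrix on the left; this is fixed by asking for a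
   positive definite constant block. *)
Definition canonical_left_factor {R : realType} {n : nat}
    (V Delta : transfer R n n) : Prop :=
  [/\ teq (mul_op (adj_op Delta) Delta) V, causal Delta, causal (inv_op Delta)
    & posdefmx (block Delta 0)].

(* Here the constant orthogonal right factor of L is left free. *)
Definition canonical_right_factor {R : realType} {n : nat}
    (M L : transfer R n n) : Prop :=
  [/\ teq M (mul_op L (adj_op L)), causal L & causal (inv_op L)].

Definition cost {R : realType} {p q s : nat}
    (F : transfer R p q) (G : transfer R p s)
    (K : transfer R q s) (M : transfer R s s) : R :=
  complex.Re (tr_op (mul_op (regret_op F G K) M)).

Definition admissible_K {R : realType} {p q : nat} (K : transfer R p q) : Prop :=
  bounded_op K /\ causal K.

Definition feasible_M {R : realType} {n : nat} (r : R) (M : transfer R n n) : Prop :=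
  [/\ toeplitz M, posdef_op M & BW M id_op <= r].

Definition saddle_point {R : realType} {p q s : nat}
    (F : transfer R p q) (G : transfer R p s) (r : R)
    (K : transfer R q s) (M : transfer R s s) : Prop :=
  [/\ admissible_K K, feasible_M r M,
      forall K', admissible_K K' -> cost F G K M <= cost F G K' M
    & forall M', feasible_M r M' -> cost F G K M' <= cost F G K M].

Definition unique_saddle_point {R : realType} {p q s : nat}
    (F : transfer R p q) (G : transfer R p s) (r : R)
    (K : transfer R q s) (M : transfer R s s) : Prop :=
  saddle_point F G r K M /\
  forall K' M', saddle_point F G r K' M' -> teq K' K /\ teq M' M.

Definition Rlqr {R : realType} {n m : nat} (B : 'M[R]_(n, m)) (P : 'M[R]_n) :
    'M[R]_m :=
  1%:M + B^T *m P *m B.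

Definition Klqr {R : realType} {n m : nat} (A : 'M[R]_n) (B : 'M[R]_(n, m))
    (P : 'M[R]_n) : 'M[R]_(m, n) :=
  invmx (Rlqr B P) *m B^T *m P *m A.

Definition Ak {R : realType} {n m : nat} (A : 'M[R]_n) (B : 'M[R]_(n, m))
    (P : 'M[R]_n) : 'M[R]_n :=
  A - B *m Klqr A B P.

Definition stabilizing_riccati {R : realType} {n m p : nat}
    (A : 'M[R]_n) (B : 'M[R]_(n, m)) (C : 'M[R]_(p, n)) (P : 'M[R]_n) : Prop :=
  [/\ posdefmx (toC P),
      P = C^T *m C + A^T *m P *m A
          - A^T *m P *m B *m invmx (Rlqr B P) *m B^T *m P *m A
    & schur (Ak A B P)].

Definition Abar {R : realType} {n m : nat} (A : 'M[R]_n) (Bu : 'M[R]_(n, m))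
    (P : 'M[R]_n) : 'M[R[i]]_n :=
  (toC (Ak A Bu P)) ^t*.

Definition Bbar {R : realType} {n m s : nat} (A : 'M[R]_n) (Bu : 'M[R]_(n, m))
    (Bw : 'M[R]_(n, s)) (P : 'M[R]_n) : 'M[R[i]]_(n, s) :=
  (toC (Ak A Bu P)) ^t* *m toC P *m toC Bw.

Definition Cbar {R : realType} {n m : nat} (Bu : 'M[R]_(n, m)) (P : 'M[R]_n) :
    'M[R[i]]_(m, n) :=
  - ((invmx (sqrtmx (toC (Rlqr Bu P)))) ^t* *m (toC Bu) ^t*).

Definition T_formula {R : realType} {n m s : nat} (A : 'M[R]_n)
    (Bu : 'M[R]_(n, m)) (Bw : 'M[R]_(n, s)) (P : 'M[R]_n) : transfer R m s :=
  fun z => Cbar Bu P *m invmx ((z^-1)%:M - Abar A Bu P) *m Bbar A Bu Bw P.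

Definition f_map {R : realType} {n m s : nat} (A : 'M[R]_n)
    (Bu : 'M[R]_(n, m)) (P : 'M[R]_n) (gamma : R) (Gamma : 'M[R]_(n, s)) :
    transfer R s s :=
  fun z =>
    let X := invmx ((z^-1)%:M - Abar A Bu P) in
    let Y := 1%:M + sqrtmx (1%:M + (4 * gamma^-1)%:C *:
      ((toC Gamma) ^t* *m X ^t* *m (Cbar Bu P) ^t* *m Cbar Bu P
       *m X *m toC Gamma)) in
    4^-1 *: (Y *m Y).

Definition Gamma_star {R : realType} {n m s : nat} (A : 'M[R]_n)
    (Bu : 'M[R]_(n, m)) (Bw : 'M[R]_(n, s)) (P : 'M[R]_n) (L : transfer R s s) :
    'M[R[i]]_(n, s) :=
  mx_mean (fun z => invmx (1%:M - z *: Abar A Bu P) *m Bbar A Bu Bw P *m L z).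

(* gamma is the multiplier of the constraint BW(M, I) <= r; TLm stands for
   {T L}_-. *)
Definition optimality_conditions {R : realType} {p q s : nat}
    (F : transfer R p q) (G : transfer R p s) (gamma : R) (K : transfer R q s)
    (M L : transfer R s s) (TLm : transfer R q s) : Prop :=
  teq M (fun z => let X := 1%:M - (gamma^-1)%:C *: regret_op F G K z in
                  invmx X *m invmx X) /\
  teq (mul_op (adj_op L) L)
    (fun z => let Y := 1%:M + sqrtmx (1%:M + (4 * gamma^-1)%:C *:
                                        ((TLm z) ^t* *m TLm z)) in
              4^-1 *: (Y *m Y)).

(* Main.v *)
Require Import Defs.
From mathcomp Require Import all_boot all_order all_algebra.
From mathcomp Require Import all_classical all_reals all_analysis.
From mathcomp Require Import complex measurable_realfun perm.
From mathcomp Require Import ring lra.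
Set Implicit Arguments.
Unset Strict Implicit.
Unset Printing Implicit Defensive.
Import Order.TTheory GRing.Theory Num.Theory.
Import numFieldNormedType.Exports.
Local Open Scope classical_set_scope.
Local Open Scope sesquilinear_scope.
Local Open Scope ring_scope.
Local Open Scope complex_scope.

(** A Toeplitz operator is handled through the Fourier coefficients, or blocks,
    of its transfer function on the circle. Two tools carry everything. The
    first is the uniqueness of the blocks of an integrable function
    ([fourier_uniqueness], [block_inj]): an identity between transfer functions
    holds as soon as their blocks agree. The second, [backward_orbit0], says that
    a bounded sequence with [Y k = A *m Y k.+1] vanishes if [A] is Schur stable.
    Block sequences are bounded, and an identity [(z - A) E = V] is a recursion
    between the blocks of [E] and those of [V]; so multiplication by a stable
    resolvent preserves causality.

    The strictly causal [G] has a minimal realization, whence [A] is Schur stable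
    ([minimal_strictly_causal_schur]). The Riccati equation provides a spectral
    factor [D0] of [I + F^* F] that is causal with causal inverse. For another
    canonical factor [Delta] the quotient [Delta D0^-1] is unitary and causal, and
    so is its adjoint; hence it is constant, and equal to the identity by the
    normalization ([canonical_factor_unique]). Then [Delta K_nc] is
    [- D0^-* F^* G], which the closed loop form of the Riccati equation splits
    into the stated formula and a causal rest ([anticausal_splitting]).

    With [X_k = (z - A_k)^-1], so that [T = Cbar X_k^* Bbar], the blocks of
    [X_k^* Bbar L] of negative index satisfy a homogeneous recursion, because [L]
    is causal. They are therefore those of [X_k^* Gamma], where [Gamma] is the
    block of index -1 and is the stated integral. So the anticausal part of [T L]
    is [Cbar X_k^* Gamma] ([anticausal_part_TL]), and the optimality condition
    becomes the formula for [L^* L].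

    The constraint is active because the cost is homogeneous in [M]: if it were
    slack, some dilation of [M] by a factor greater than 1 would be feasible, the
    optimal cost would have to vanish, and the dilation would give a second saddle
    point ([saddle_point_active]). The distance along this ray is continuous only
    because the trace of the square root of [M] is integrable, hence in particular
    measurable: it is a limit of polynomials in [M]. *)

(** * Integrals and null sets *)

Section AeIntegral.
Context {d : measure_display} {X : measurableType d} {R : realType}.
Context (mu : {measure set X -> \bar R}).
Import HBNNSimple.

(** A simple function below [f] stays below [g] once it is set to zero on a
    measurable null set that contains the exceptional points. *)
Lemma ge0_ae_eq_integral_le (D : set X) (f g : X -> \bar R) :
  measurable D -> (forall x, D x -> 0 <= f x)%E -> (forall x, D x -> 0 <= g x)%E ->
  {ae mu, forall x, D x -> f x = g x} ->
  (\int[mu]_(x in D) f x <= \int[mu]_(x in D) g x)%E.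
Proof.
move=> mD f0 g0 [N [mN N0 fgN]].
rewrite ge0_integralE// [leRHS]ge0_integralE//.
apply: ge_ereal_sup => _ /= [h hf <-].
have mNC : measurable (~` N) by exact: measurableC.
pose k : {nnsfun X >-> R} := proj_nnsfun h mNC.
apply: ereal_sup_ubound; exists k => [x|].
  rewrite /= mindicE; have [xN|xN] := boolP (x \in ~` N).
    rewrite mulr1; apply: (le_trans (hf x)); rewrite !patchE.
    case: ifPn => // /set_mem Dx; rewrite (_ : f x = g x)//.
    by apply: contrapT => fg; move/set_mem: xN; apply; apply: fgN => /= /(_ Dx).
  by rewrite mulr0 patchE; case: ifPn => // /set_mem; exact: g0.
rewrite -!integralT_nnsfun; apply: ge0_ae_eq_integral => //.
- by apply/measurable_EFinP; exact: measurable_funPT.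
- by apply/measurable_EFinP; exact: measurable_funPT.
- by move=> x _; rewrite lee_fin fun_ge0.
- by move=> x _; rewrite lee_fin fun_ge0.
exists N; split => // x /= kh; apply: contrapT => xN; apply: kh => _.
by rewrite /= mindicE mem_set//= mulr1.
Qed.

(** A change on a null set is invisible to the integral even of a function that
    is not measurable, because the integral of a nonnegative function is a
    supremum over the simple functions below it, and these may be set to zero
    on a measurable null set. This matters since matrix square roots take junk
    values off the positive semidefinite matrices. *)
Lemma ae_eq_integral_nonmeasurable (D : set X) (f g : X -> \bar R) :
  measurable D -> {ae mu, forall x, D x -> f x = g x} ->
  (\int[mu]_(x in D) f x = \int[mu]_(x in D) g x)%E.
Proof.
move=> mD fg; rewrite integralE [RHS]integralE.
have gf : {ae mu, forall x, D x -> g x = f x}.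
  by apply: filterS fg => x fgx Dx; rewrite fgx.
congr (_ - _)%E; apply/eqP; rewrite eq_le; apply/andP; split;
  apply: ge0_ae_eq_integral_le => //; try by move=> x _; exact: funepos_ge0.
all: try by move=> x _; exact: funeneg_ge0.
all: by [apply: filterS fg => x fgx Dx; rewrite ?funeposE ?funenegE fgx
       |apply: filterS gf => x fgx Dx; rewrite ?funeposE ?funenegE fgx].
Qed.

End AeIntegral.

(** * Functions on the unit circle *)

Section CircleFunctions.
Context {R : realType}.
Notation mu := (@lebesgue_measure R).
Notation C := R[i].
Notation Re := complex.Re.
Notation Im := complex.Im.
Notation D := (`[0, 2 * pi]%classic : set R).
Implicit Types (f g : C -> C) (u v : R -> R).

Lemma ReD (x y : C) : Re (x + y) = Re x + Re y. Proof. by case: x y => [? ?] []. Qed.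
Lemma ImD (x y : C) : Im (x + y) = Im x + Im y. Proof. by case: x y => [? ?] []. Qed.
Lemma ReN (x : C) : Re (- x) = - Re x. Proof. by case: x. Qed.
Lemma ImN (x : C) : Im (- x) = - Im x. Proof. by case: x. Qed.
Lemma ReM (x y : C) : Re (x * y) = Re x * Re y - Im x * Im y.
Proof. by case: x y => [? ?] []. Qed.
Lemma ImM (x y : C) : Im (x * y) = Re x * Im y + Im x * Re y.
Proof. by case: x y => [a b] [c d] /=. Qed.
Lemma conjCE (x : C) : x^* = (Re x -i* Im x)%C.
Proof. by case: x. Qed.
Lemma ReV (x : C) : Re x^-1 = Re x / (Re x ^+ 2 + Im x ^+ 2).
Proof. by case: x. Qed.
Lemma ImV (x : C) : Im x^-1 = - (Im x / (Re x ^+ 2 + Im x ^+ 2)).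
Proof. by case: x. Qed.
Lemma eqC (x y : C) : Re x = Re y -> Im x = Im y -> x = y.
Proof. by case: x y => [a b] [c d] /= -> ->. Qed.

Lemma normcE (x : C) : `|x| = (Num.sqrt (Re x ^+ 2 + Im x ^+ 2))%:C.
Proof. by case: x. Qed.

Lemma normr_Re_le (x : C) (c : R) : `|x| <= c%:C -> `|Re x| <= c.
Proof.
rewrite normcE lecR; apply: le_trans.
by rewrite -sqrtr_sqr ler_wsqrtr// lerDl sqr_ge0.
Qed.

Lemma normr_Im_le (x : C) (c : R) : `|x| <= c%:C -> `|Im x| <= c.
Proof.
rewrite normcE lecR; apply: le_trans.
by rewrite -sqrtr_sqr ler_wsqrtr// lerDr sqr_ge0.
Qed.

Lemma normc_le_ReIm (x : C) : `|x| <= (`|Re x| + `|Im x|)%:C.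
Proof.
rewrite normcE lecR -[leRHS]ger0_norm ?addr_ge0// -sqrtr_sqr ler_wsqrtr//.
rewrite sqrrD !real_normK ?num_real// addrAC lerDl mulrn_wge0// mulr_ge0//.
Qed.

Lemma normC_bound (x : C) : exists c : R, 0 <= c /\ `|x| = c%:C.
Proof. by rewrite normcE; eexists; split; last reflexivity; exact: sqrtr_ge0. Qed.

Lemma expjD (a b : R) : expj (a + b) = expj a * expj b.
Proof.
rewrite /expj cosD sinD; apply: eqC; rewrite ?ReM ?ImM//=.
by rewrite addrC [cos a * _]mulrC [sin a * _]mulrC; congr (_ + _); rewrite mulrC.
Qed.

Lemma expj0 : expj (0 : R) = 1.
Proof. by rewrite /expj cos0 sin0. Qed.

Lemma expjN (a : R) : expj (- a) = (expj a)^*.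
Proof. by rewrite /expj cosN sinN. Qed.

Lemma norm_expj (a : R) : `|expj a| = 1.
Proof. by rewrite normcE /= cos2Dsin2 sqrtr1. Qed.

Lemma expj_neq0 (a : R) : expj a != 0.
Proof. by rewrite -normr_eq0 norm_expj oner_eq0. Qed.

Lemma expjV (a : R) : (expj a)^-1 = (expj a)^*.
Proof.
by apply: (mulfI (expj_neq0 a)); rewrite divff ?expj_neq0// -expjN -expjD subrr expj0.
Qed.

Lemma expjX (a : R) (n : nat) : expj a ^+ n = expj (n%:R * a).
Proof.
elim: n => [|n IHn]; first by rewrite mul0r expj0.
by rewrite exprSr IHn -[n.+1]addn1 natrD mulrDl expjD mul1r.
Qed.

Lemma expjz (a : R) (k : int) : expj a ^ k = expj (k%:~R * a).
Proof.
case: k => n; first by rewrite -exprnP expjX.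
by rewrite -[LHS]/((expj a ^+ n.+1)^-1) expjX expjV -expjN NegzE mulrNz mulNr.
Qed.

Lemma conj_expjz (a : R) (k : int) : ((expj a ^ k)%R)^* = expj a ^ (- k).
Proof. by rewrite !expjz -expjN mulrNz mulNr. Qed.

Lemma norm_expjz (a : R) (k : int) : `|expj a ^ k| = 1.
Proof. by rewrite expjz norm_expj. Qed.

Lemma expjzD (a : R) (k l : int) : expj a ^ (k + l) = expj a ^ k * expj a ^ l.
Proof. by rewrite expfzDr ?expj_neq0. Qed.

Lemma measurable_circle : measurable D. Proof. by []. Qed.

Lemma measure_circle : mu D = (2 * pi)%:E.
Proof.
rewrite lebesgue_measure_itv/= lte_fin mulr_gt0 ?pi_gt0//.
by rewrite sube0.
Qed.

#[local] Instance lebesgue_ae_filter : Filter (nbhs (almost_everywhere mu)).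
Proof. exact: (ae_filter_ringOfSetsType mu). Qed.

Lemma ae_circleS (P Q : C -> Prop) :
  (forall w, P (expj w) -> Q (expj w)) -> ae_circle P -> ae_circle Q.
Proof. by move=> PQ; rewrite /ae_circle; apply: filterS => w Pw wD; exact/PQ/Pw. Qed.

Lemma ae_circleS2 (P Q S : C -> Prop) :
  (forall w, P (expj w) -> Q (expj w) -> S (expj w)) ->
  ae_circle P -> ae_circle Q -> ae_circle S.
Proof.
move=> PQS; rewrite /ae_circle.
by apply: filterS2 => w Pw Qw wD; apply: PQS; [exact: Pw|exact: Qw].
Qed.

Lemma ae_circle_ae (P : C -> Prop) (S : R -> Prop) :
  (forall w, P (expj w) -> S w) -> ae_circle P -> {ae mu, forall w, D w -> S w}.
Proof.
move=> PS; rewrite /ae_circle; apply: filterS => w Pw Dw.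
by apply: PS; apply: Pw; rewrite inE.
Qed.

Lemma ae_circle_and (P Q : C -> Prop) :
  ae_circle P -> ae_circle Q -> ae_circle (fun z => P z /\ Q z).
Proof. by apply: ae_circleS2. Qed.

Lemma ae_circleW (P : C -> Prop) : (forall w, P (expj w)) -> ae_circle P.
Proof. by move=> Pw; exact/aeW. Qed.

Lemma ae_circle_all (I : finType) (P : I -> C -> Prop) :
  (forall i, ae_circle (P i)) -> ae_circle (fun z => forall i, P i z).
Proof.
move=> aP; have : ae_circle (fun z => forall i, i \in enum I -> P i z).
  elim: (enum I) => [|i s IHs]; first exact: ae_circleW.
  apply: ae_circleS2 (aP i) IHs => w Pi Ps j.
  by rewrite inE => /predU1P[->|/Ps].
by apply: ae_circleS => w H i; apply: H; rewrite mem_enum.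
Qed.

Lemma ae_circle_ex (P : C -> Prop) : ae_circle P -> exists w, P (expj w).
Proof.
move=> [N [mN N0 PN]]; apply: contrapT => /forallNP nP.
suff : (mu D <= mu N)%E.
  by rewrite measure_circle [mu N]N0 lee_fin leNgt mulr_gt0 ?pi_gt0.
apply: le_measure; rewrite ?inE// => w wD; apply: PN => /= h.
by apply: (nP w); apply: h; rewrite inE in wD *.
Qed.

Definition circ_measurable f :=
  measurable_fun D (fun w => Re (f (expj w))) /\
  measurable_fun D (fun w => Im (f (expj w))).

Definition circ_integrable f :=
  mu.-integrable D (fun w => (Re (f (expj w)))%:E) /\
  mu.-integrable D (fun w => (Im (f (expj w)))%:E).

Definition circ_bounded f :=
  circ_measurable f /\ exists c : R, ae_circle (fun z => `|f z| <= c%:C).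

Lemma circ_integrable_measurable f : circ_integrable f -> circ_measurable f.
Proof. by case=> /measurable_int/measurable_EFinP ? /measurable_int/measurable_EFinP. Qed.

Lemma eq_circ_measurable f g : (forall w, f (expj w) = g (expj w)) ->
  circ_measurable f -> circ_measurable g.
Proof.
by move=> fg [fR fI]; split; [move: fR|move: fI]; apply: eq_measurable_fun => w _; rewrite fg.
Qed.

Lemma eq_circ_integrable f g : (forall w, f (expj w) = g (expj w)) ->
  circ_integrable f -> circ_integrable g.
Proof.
by move=> fg [fR fI]; split; [move: fR|move: fI]; apply: eq_integrable => // w _; rewrite fg.
Qed.

Lemma measurable_eq u v : (forall w, u w = v w) ->
  measurable_fun D v -> measurable_fun D u.
Proof. by move=> /funext ->. Qed.

Lemma integrable_eq u v : (forall w, u w = v w) ->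
  mu.-integrable D (EFin \o v) -> mu.-integrable D (fun w => (u w)%:E).
Proof. by move=> /funext ->. Qed.

Lemma circ_measurable_cst (a : C) : circ_measurable (fun=> a).
Proof. by split; exact: measurable_cst. Qed.

Lemma circ_measurableD f g : circ_measurable f -> circ_measurable g ->
  circ_measurable (fun z => f z + g z).
Proof.
move=> [fR fI] [gR gI]; split.
  by apply: measurable_eq => [w|]; [exact: ReD|]; exact: measurable_funD.
by apply: measurable_eq => [w|]; [exact: ImD|]; exact: measurable_funD.
Qed.

Lemma circ_measurableM f g : circ_measurable f -> circ_measurable g ->
  circ_measurable (fun z => f z * g z).
Proof.
move=> [fR fI] [gR gI]; split.
  by apply: measurable_eq => [w|]; [exact: ReM|]; apply: measurable_funB; exact: measurable_funM.
by apply: measurable_eq => [w|]; [exact: ImM|]; apply: measurable_funD; exact: measurable_funM.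
Qed.

Lemma circ_measurable_conj f : circ_measurable f -> circ_measurable (fun z => (f z)^*).
Proof.
move=> [fR fI]; split; first by apply: measurable_eq fR => w; rewrite conjCE.
by apply: measurable_eq (measurable_funN fI) => w; rewrite conjCE.
Qed.

Lemma circ_measurableV f : circ_measurable f -> circ_measurable (fun z => (f z)^-1).
Proof.
move=> [fR fI].
have mn : measurable_fun D
    (fun w => (Re (f (expj w)) ^+ 2 + Im (f (expj w)) ^+ 2)^-1).
  pose n w := Re (f (expj w)) ^+ 2 + Im (f (expj w)) ^+ 2.
  apply: (@measurable_eq _ (@powR R ^~ (-1) \o n)) => [w|].
    by rewrite /= powR_inv1 ?addr_ge0 ?sqr_ge0.
  apply: measurableT_comp; first exact: measurable_powR.
  by apply: measurable_funD; exact: measurable_funX.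
split.
  by apply: measurable_eq => [w|]; [exact: ReV|]; exact: measurable_funM.
by apply: measurable_eq => [w|]; [exact: ImV|]; apply: measurable_funN; exact: measurable_funM.
Qed.

Lemma circ_measurable_expz (k : int) : circ_measurable (fun z => z ^ k).
Proof.
have mk : measurable_fun D (fun w => k%:~R * w : R).
  apply: measurable_funTS; apply: continuous_measurable_fun.
  exact: mulrl_continuous.
split.
  apply: (@measurable_eq _ (@cos R \o (fun w => k%:~R * w))) => [w|].
    by rewrite expjz.
  apply: measurableT_comp => //; apply: continuous_measurable_fun.
  exact: continuous_cos.
apply: (@measurable_eq _ (@sin R \o (fun w => k%:~R * w))) => [w|].
  by rewrite expjz.
apply: measurableT_comp => //; apply: continuous_measurable_fun.
exact: continuous_sin.
Qed.

Lemma integrableZ (r : R) u : mu.-integrable D (EFin \o u) ->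
  mu.-integrable D (EFin \o (fun w => r * u w)).
Proof.
move=> iu.
suff : mu.-integrable D (fun w => r%:E * (EFin \o u) w)%E by [].
exact: integrableZl.
Qed.

Lemma integrable_add u v : mu.-integrable D (EFin \o u) ->
  mu.-integrable D (EFin \o v) -> mu.-integrable D (EFin \o (fun w => u w + v w)).
Proof.
move=> iu iv.
suff : mu.-integrable D ((EFin \o u) \+ (EFin \o v))%E by [].
exact: integrableD.
Qed.

Lemma integrable_opp u : mu.-integrable D (EFin \o u) ->
  mu.-integrable D (EFin \o (fun w => - u w)).
Proof.
move=> iu; apply: integrable_eq (integrableZ (-1) iu) => w.
by rewrite mulN1r.
Qed.

Lemma integrable_sub u v : mu.-integrable D (EFin \o u) ->
  mu.-integrable D (EFin \o v) -> mu.-integrable D (EFin \o (fun w => u w - v w)).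
Proof. by move=> iu iv; exact: integrable_add iu (integrable_opp iv). Qed.

(** An almost everywhere bound on [v] is all that the bounded operators of a
    saddle point provide. *)
Lemma integrable_mul_bounded u v (c : R) :
  mu.-integrable D (EFin \o u) -> measurable_fun D v ->
  {ae mu, forall w, D w -> `|v w| <= c} ->
  mu.-integrable D (EFin \o (fun w => u w * v w)).
Proof.
move=> iu mv vc; have mD := measurable_circle.
have mu' : measurable_fun D u by apply/measurable_EFinP; exact: measurable_int iu.
apply/integrableP; split; first exact/measurable_EFinP/measurable_funM.
have ici : mu.-integrable D (EFin \o (fun w => `|c| * `|u w|)).
  by apply: integrableZ; exact: integrable_norm iu.
have /integrableP[_] := ici; apply: le_lt_trans.
apply: ae_ge0_le_integral => //.
- apply: measurableT_comp => //; apply/measurable_EFinP.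
  exact: measurable_funM.
- by apply: measurableT_comp => //; exact: measurable_int ici.
apply: filterS vc => w vw Dw /=; rewrite lee_fin !normrM !normr_id mulrC.
by rewrite ler_wpM2r// (le_trans (vw Dw))// ler_norm.
Qed.

Lemma circ_integrable_cst (a : C) : circ_integrable (fun=> a).
Proof.
have muD : (mu D < +oo)%E by rewrite measure_circle ltry.
have bc (r : R) : [bounded r | w in D].
  by exists `|r|; split; [exact: num_real|move=> M rM w _; exact: ltW].
by split; apply: measurable_bounded_integrable.
Qed.

Lemma circ_integrableD f g : circ_integrable f -> circ_integrable g ->
  circ_integrable (fun z => f z + g z).
Proof.
move=> [fR fI] [gR gI]; split.
  by apply: (integrable_eq _ (integrable_add fR gR)) => w; exact: ReD.
by apply: (integrable_eq _ (integrable_add fI gI)) => w; exact: ImD.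
Qed.

Lemma circ_integrable_mul_bounded f g : circ_integrable f -> circ_bounded g ->
  circ_integrable (fun z => f z * g z).
Proof.
move=> [fR fI] [[mgR mgI] [c gc]]; have mD := measurable_circle.
have gRc : {ae mu, forall w, D w -> `|Re (g (expj w))| <= c}.
  by apply: ae_circle_ae gc => w; exact: normr_Re_le.
have gIc : {ae mu, forall w, D w -> `|Im (g (expj w))| <= c}.
  by apply: ae_circle_ae gc => w; exact: normr_Im_le.
split.
  apply: (integrable_eq _ (integrable_sub (integrable_mul_bounded fR mgR gRc)
    (integrable_mul_bounded fI mgI gIc))) => w.
  exact: ReM.
apply: (integrable_eq _ (integrable_add (integrable_mul_bounded fR mgI gIc)
  (integrable_mul_bounded fI mgR gRc))) => w.
exact: ImM.
Qed.

Lemma circ_bounded_cst (a : C) : circ_bounded (fun=> a).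
Proof.
split; first exact: circ_measurable_cst.
by have [c [_ ac]] := normC_bound a; exists c; apply: ae_circleW => _; rewrite ac.
Qed.

Lemma circ_bounded_expz (k : int) : circ_bounded (fun z => z ^ k).
Proof.
split; first exact: circ_measurable_expz.
by exists 1; apply: ae_circleW => w; rewrite norm_expjz.
Qed.

Lemma circ_boundedD f g : circ_bounded f -> circ_bounded g ->
  circ_bounded (fun z => f z + g z).
Proof.
move=> [mf [c fc]] [mg [e ge]]; split; first exact: circ_measurableD.
exists (c + e); apply: ae_circleS2 fc ge => w fw gw.
by rewrite rmorphD/= (le_trans (ler_normD _ _))// lerD.
Qed.

Lemma circ_boundedM f g : circ_bounded f -> circ_bounded g ->
  circ_bounded (fun z => f z * g z).
Proof.
move=> [mf [c fc]] [mg [e ge]]; split; first exact: circ_measurableM.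
exists (c * e); apply: ae_circleS2 fc ge => w fw gw.
by rewrite rmorphM/= normrM ler_pM.
Qed.

Lemma circ_bounded_conj f : circ_bounded f -> circ_bounded (fun z => (f z)^*).
Proof.
move=> [mf [c fc]]; split; first exact: circ_measurable_conj.
exists c; apply: ae_circleS fc => w; rewrite !normcE.
by case: (f _) => a b /=; rewrite sqrrN.
Qed.

Lemma circ_bounded_integrable f : circ_bounded f -> circ_integrable f.
Proof.
move=> fb; have := circ_integrable_mul_bounded (circ_integrable_cst 1) fb.
by apply: eq_circ_integrable => w; rewrite mul1r.
Qed.

Lemma circ_integrableM (a : C) f : circ_integrable f -> circ_integrable (fun z => a * f z).
Proof.
move=> /circ_integrable_mul_bounded/(_ (circ_bounded_cst a)).
by apply: eq_circ_integrable => w; rewrite mulrC.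
Qed.

Lemma ae_eq_integral_circle (u v : R -> \bar R) :
  {ae mu, forall w, D w -> u w = v w} ->
  (\int[mu]_(w in D) u w = \int[mu]_(w in D) v w)%E.
Proof. by move=> uv; apply: ae_eq_integral_nonmeasurable. Qed.

Definition arc_mean u : R := (2 * pi)^-1 * \int[mu]_(w in D) u w.

Lemma circle_meanE f : circle_mean f =
  (arc_mean (fun w => Re (f (expj w))) +i* arc_mean (fun w => Im (f (expj w))))%C.
Proof. by []. Qed.

Lemma eq_arc_mean u v : (forall w, u w = v w) -> arc_mean u = arc_mean v.
Proof. by move=> /funext ->. Qed.

Lemma arc_mean_ae u v : {ae mu, forall w, D w -> u w = v w} ->
  arc_mean u = arc_mean v.
Proof.
move=> uv; rewrite /arc_mean /Rintegral; congr (_ * fine _).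
apply: ae_eq_integral_circle; move: uv; apply: filterS => w uv Dw.
by rewrite uv.
Qed.

Lemma arc_meanD u v : mu.-integrable D (EFin \o u) ->
  mu.-integrable D (EFin \o v) ->
  arc_mean (fun w => u w + v w) = arc_mean u + arc_mean v.
Proof. by move=> iu iv; rewrite /arc_mean RintegralD// mulrDr. Qed.

Lemma arc_meanZ (r : R) u : mu.-integrable D (EFin \o u) ->
  arc_mean (fun w => r * u w) = r * arc_mean u.
Proof. by move=> iu; rewrite /arc_mean RintegralZl// mulrCA. Qed.

Lemma arc_meanN u : mu.-integrable D (EFin \o u) ->
  arc_mean (fun w => - u w) = - arc_mean u.
Proof.
move=> iu; rewrite -mulN1r -arc_meanZ//; apply: eq_arc_mean => w.
by rewrite mulN1r.
Qed.

Lemma arc_meanB u v : mu.-integrable D (EFin \o u) ->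
  mu.-integrable D (EFin \o v) ->
  arc_mean (fun w => u w - v w) = arc_mean u - arc_mean v.
Proof.
by move=> iu iv; rewrite arc_meanD ?arc_meanN//; exact: integrable_opp.
Qed.

Lemma arc_mean_cst (r : R) : arc_mean (fun=> r) = r.
Proof.
have pi2 : (2 * pi : R) != 0 by rewrite mulf_neq0 ?gt_eqF ?pi_gt0.
have mD : fine (mu D) = 2 * pi by rewrite measure_circle.
rewrite /arc_mean Rintegral_cst//; rewrite [fine _]mD.
by rewrite mulrCA mulVf ?mulr1.
Qed.

Lemma arc_mean_ge0 u : {ae mu, forall w, D w -> 0 <= u w} -> 0 <= arc_mean u.
Proof.
move=> u0; rewrite (@arc_mean_ae _ (fun w => `|u w|)); last first.
  by move: u0; apply: filterS => w u0 Dw; rewrite ger0_norm ?u0.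
rewrite /arc_mean mulr_ge0 ?invr_ge0 ?mulr_ge0 ?pi_ge0//.
exact: Rintegral_ge0.
Qed.

Lemma le_norm_arc_mean u v : mu.-integrable D (EFin \o u) ->
  mu.-integrable D (EFin \o v) -> (forall w, `|u w| <= v w) ->
  `|arc_mean u| <= arc_mean v.
Proof.
move=> iu iv uv; rewrite /arc_mean normrM ger0_norm ?invr_ge0 ?mulr_ge0 ?pi_ge0//.
rewrite ler_wpM2l ?invr_ge0 ?mulr_ge0 ?pi_ge0//.
by rewrite (le_trans (le_normr_Rintegral _ iu))// le_Rintegral//; exact: integrable_norm.
Qed.

Lemma circle_mean_ae f g : ae_circle (fun z => f z = g z) ->
  circle_mean f = circle_mean g.
Proof.
move=> fg; rewrite !circle_meanE.
by congr Complex; apply: arc_mean_ae; apply: ae_circle_ae fg => w ->.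
Qed.

Lemma eq_circle_mean f g : (forall w, f (expj w) = g (expj w)) ->
  circle_mean f = circle_mean g.
Proof. by move=> fg; apply: circle_mean_ae; exact: ae_circleW. Qed.

Lemma circle_meanD f g : circ_integrable f -> circ_integrable g ->
  circle_mean (fun z => f z + g z) = circle_mean f + circle_mean g.
Proof.
move=> [fR fI] [gR gI]; rewrite !circle_meanE -[RHS]/(Complex _ _).
congr Complex; rewrite -arc_meanD//; apply: eq_arc_mean => w; [exact: ReD|exact: ImD].
Qed.

Lemma circle_meanZ (a : C) f : circ_integrable f ->
  circle_mean (fun z => a * f z) = a * circle_mean f.
Proof.
move=> [fR fI]; rewrite !circle_meanE; case: a => a b; rewrite -[RHS]/(Complex _ _).
congr Complex; rewrite -?arc_meanZ// -1?arc_meanB -1?arc_meanD; try exact: integrableZ.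
  by apply: eq_arc_mean => w; rewrite ReM.
by apply: eq_arc_mean => w; rewrite ImM.
Qed.

Lemma circle_mean_conj f : circ_integrable f ->
  circle_mean (fun z => (f z)^*) = (circle_mean f)^*.
Proof.
move=> [fR fI]; rewrite !circle_meanE; congr Complex.
  by apply: eq_arc_mean => w; rewrite conjCE.
by rewrite -arc_meanN//; apply: eq_arc_mean => w; rewrite conjCE.
Qed.

Lemma circle_mean_cst (a : C) : circle_mean (fun=> a) = a.
Proof. by rewrite circle_meanE !arc_mean_cst; case: a. Qed.

Lemma circle_mean_sum (I : finType) (P : pred I) (F : I -> C -> C) :
  (forall i, circ_integrable (F i)) ->
  circ_integrable (fun z => \sum_(i | P i) F i z) /\
  circle_mean (fun z => \sum_(i | P i) F i z) = \sum_(i | P i) circle_mean (F i).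
Proof.
move=> iF; elim: (index_enum I) => [|i s [IHi IHm]].
  split; first by apply: eq_circ_integrable (circ_integrable_cst 0) => w; rewrite big_nil.
  by rewrite big_nil -[RHS]circle_mean_cst; apply: eq_circle_mean => w; rewrite big_nil.
rewrite big_cons -IHm; case: ifP => Pi.
  rewrite -circle_meanD//; split; last by apply: eq_circle_mean => w; rewrite big_cons Pi.
  by apply: eq_circ_integrable (circ_integrableD (iF i) IHi) => w; rewrite big_cons Pi.
split; last by apply: eq_circle_mean => w; rewrite big_cons Pi.
by apply: eq_circ_integrable IHi => w; rewrite big_cons Pi.
Qed.

(** The bound is the L1 norm, which does not see the unimodular factor [z ^ k]. *)
Lemma circle_coef_bounded f : circ_integrable f ->
  exists c : R, forall k : int, `|circle_mean (fun z => z ^ k * f z)| <= c%:C.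
Proof.
move=> fi; have [fR fI] := fi; have mD := measurable_circle.
have sfi : mu.-integrable D (EFin \o (fun w => `|Re (f (expj w))| + `|Im (f (expj w))|)).
  by apply: integrable_add; exact: integrable_norm.
pose c := arc_mean (fun w => `|Re (f (expj w))| + `|Im (f (expj w))|).
exists (c + c) => k.
have [kR kI] := circ_integrable_mul_bounded fi (circ_bounded_expz k).
have kf w : `|f (expj w) * expj w ^ k| <= (`|Re (f (expj w))| + `|Im (f (expj w))|)%:C.
  by rewrite normrM norm_expjz mulr1 normc_le_ReIm.
rewrite (eq_circle_mean (g := fun z => f z * z ^ k)); last by move=> w; rewrite mulrC.
rewrite (le_trans (normc_le_ReIm _))// lecR circle_meanE lerD//;
  apply: le_norm_arc_mean => // w; [exact: normr_Re_le|exact: normr_Im_le].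
Qed.

Lemma circle_mean_Re_ge0 f : ae_circle (fun z => 0 <= Re (f z)) ->
  0 <= Re (circle_mean f).
Proof. by move=> f0; apply: arc_mean_ge0; exact: ae_circle_ae f0. Qed.

End CircleFunctions.

(** * Orthogonality of the powers of [z], and step polynomials *)

Section FourierUniqueness.
Context {R : realType}.
Notation mu := (@lebesgue_measure R).
Notation C := R[i].
Notation Re := complex.Re.
Notation Im := complex.Im.
Notation D := (`[0, 2 * pi]%classic : set R).
Implicit Types (f g : C -> C) (u v : R -> R).

#[local] Existing Instance lebesgue_ae_filter.

Lemma integral_derivative u (F : R -> R) : continuous u ->
  (forall w : R, is_derive w 1 F (u w)) ->
  \int[mu]_(w in D) u w = F (2 * pi) - F 0.
Proof.
move=> cu dF.
have cF : continuous F.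
  by move=> w; apply/differentiable_continuous/derivable1_diffP; exact: ex_derive.
have pi2 : 0 < 2 * pi :> R by rewrite mulr_gt0 ?pi_gt0.
rewrite /Rintegral (@continuous_FTC2 _ _ F)//.
- exact: continuous_subspaceT.
- split; first by move=> w _; exact: ex_derive.
    by apply: cvg_at_right_filter; exact: cF.
  by apply: cvg_at_left_filter; exact: cF.
- by move=> w _; rewrite derive1E derive_val.
Qed.

Lemma sin_int_2pi (n : int) : sin (n%:~R * (2 * pi)) = 0 :> R.
Proof.
have sn (m : nat) : sin (m%:R * (2 * pi)) = 0 :> R.
  have -> : m%:R * (2 * pi) = 0 + (pi *+ 2) *+ m :> R.
    by rewrite add0r mulr_natl [2 * pi]mulr_natl.
  by rewrite (periodicn (@sinD2pi R)) sin0.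
case: n => m; first exact: sn.
by rewrite NegzE mulrNz mulNr sinN; have := sn m.+1; rewrite -pmulrn => ->; rewrite oppr0.
Qed.

Lemma cos_int_2pi (n : int) : cos (n%:~R * (2 * pi)) = 1 :> R.
Proof.
have cn (m : nat) : cos (m%:R * (2 * pi)) = 1 :> R.
  have -> : m%:R * (2 * pi) = 0 + (pi *+ 2) *+ m :> R.
    by rewrite add0r mulr_natl [2 * pi]mulr_natl.
  by rewrite (periodicn (@cosD2pi R)) cos0.
case: n => m; first exact: cn.
by rewrite NegzE mulrNz mulNr cosN; have := cn m.+1; rewrite -pmulrn => ->.
Qed.

Lemma circle_mean_expz (k : int) : circle_mean (fun z : C => z ^ k) = (k == 0)%:R.
Proof.
have [->|k0] := eqVneq k 0.
  by rewrite -[RHS](@circle_mean_cst R); apply: eq_circle_mean => w; rewrite expr0z.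
have kR : k%:~R != 0 :> R by rewrite intr_eq0.
have ck : continuous (fun w : R => k%:~R * w) by exact: mulrl_continuous.
have dk (w : R) : is_derive w 1 (fun w : R => k%:~R * w) k%:~R.
  have := @is_deriveZ R R^o R^o id k%:~R w 1 1 _.
  by move=> /(_ (is_derive_id _ _)); rewrite /GRing.scale /= mulr1.
have cC : continuous (fun w : R => cos (k%:~R * w)).
  by move=> w; apply: continuous_comp; [exact: ck|exact: continuous_cos].
have cS : continuous (fun w : R => sin (k%:~R * w)).
  by move=> w; apply: continuous_comp; [exact: ck|exact: continuous_sin].
have dS (w : R) : is_derive w 1 (fun w : R => k%:~R^-1 * sin (k%:~R * w)) (cos (k%:~R * w)).
  have ds := @is_derive1_comp R (@sin R) _ w _ _ (is_derive_sin _) (dk w).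
  have := @is_deriveZ R R^o R^o _ k%:~R^-1 w 1 _ ds.
  by rewrite /GRing.scale/= mulrCA mulVf ?mulr1.
have dC (w : R) : is_derive w 1 (fun w : R => - k%:~R^-1 * cos (k%:~R * w)) (sin (k%:~R * w)).
  have ds := @is_derive1_comp R (@cos R) _ w _ _ (is_derive_cos _) (dk w).
  have := @is_deriveZ R R^o R^o _ (- k%:~R^-1) w 1 _ ds.
  by rewrite /GRing.scale/= !mulNr mulrN opprK mulrCA mulVf ?mulr1.
have IC := integral_derivative cC dS; have IS := integral_derivative cS dC.
rewrite circle_meanE /arc_mean.
rewrite (_ : (fun w => Re _) = fun w => cos (k%:~R * w)); last first.
  by apply/funext => w; rewrite expjz.
rewrite (_ : (fun w => Im _) = fun w => sin (k%:~R * w)); last first.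
  by apply/funext => w; rewrite expjz.
rewrite IC IS.
by rewrite sin_int_2pi cos_int_2pi !mulr0 sin0 cos0 subrr !mulr0 subrr mulr0.
Qed.

Lemma bernoulli_le (x : R) (m : nat) : 0 <= x <= 1 -> 1 - m%:R * x <= (1 - x) ^+ m.
Proof.
move=> /andP[x0 x1]; elim: m => [|m IHm]; first by rewrite mul0r subr0.
rewrite exprS; have : (1 - x) * (1 - m%:R * x) <= (1 - x) * (1 - x) ^+ m.
  by rewrite ler_wpM2l ?subr_ge0.
apply: le_trans; rewrite -natr1.
have : 0 <= m%:R * x * x by rewrite !mulr_ge0.
by lra.
Qed.

Lemma bernoulli_ge (x : R) (m : nat) : 0 <= x -> 1 + m%:R * x <= (1 + x) ^+ m.
Proof.
move=> x0; elim: m => [|m IHm]; first by rewrite mul0r addr0.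
rewrite exprS; have : (1 + x) * (1 + m%:R * x) <= (1 + x) * (1 + x) ^+ m.
  by rewrite ler_wpM2l ?addr_ge0.
apply: le_trans; rewrite -natr1.
have : 0 <= m%:R * x * x by rewrite !mulr_ge0.
by lra.
Qed.

(** The polynomials [(1 - s ^ n) ^ (2 ^ n)] stay between 0 and 1 on the unit
    interval and tend there to the step function that jumps at 1/2. *)
Definition step_poly (s : R) (n : nat) : R := (1 - s ^+ n) ^+ (2 ^ n).

Lemma step_poly01 (s : R) (n : nat) : 0 <= s <= 1 -> 0 <= step_poly s n <= 1.
Proof.
move=> /andP[s0 s1]; have sn1 : s ^+ n <= 1 by rewrite exprn_ile1.
have sn0 : 0 <= s ^+ n by rewrite exprn_ge0.
by rewrite exprn_ge0 ?subr_ge0//= exprn_ile1 ?subr_ge0// gerBl.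
Qed.

(** Bernoulli's inequality gives the lower bound [1 - (2 * s) ^ n]. *)
Lemma step_poly_lt (s : R) : 0 <= s -> s < 2^-1 -> step_poly s @ \oo --> (1 : R).
Proof.
move=> s0 s2; have s1 : s <= 1 by lra.
have lim : (fun n => 1 - (2 * s) ^+ n) @ \oo --> (1 - 0 : R).
  apply: cvgB; first exact: cvg_cst.
  by apply: cvg_expr; rewrite ger0_norm ?mulr_ge0//; lra.
rewrite subr0 in lim.
apply: (@squeeze_cvgr _ _ _ R (fun n => 1 - (2 * s) ^+ n) (cst 1) _ _ 1 lim (cvg_cst _)).
apply: nearW => n.
have /andP[_ ->] := @step_poly01 s n (introT andP (conj s0 s1)).
rewrite andbT exprMn -natrX; apply: bernoulli_le.
by rewrite exprn_ge0// exprn_ile1.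
Qed.

(** Since [(1 - s ^ n) * (1 + s ^ n) <= 1], Bernoulli's inequality for the second
    factor gives the upper bound [(2 * s) ^ - n]. *)
Lemma step_poly_gt (s : R) : 2^-1 < s -> s <= 1 -> step_poly s @ \oo --> (0 : R).
Proof.
move=> s2 s1; have s0 : 0 <= s by lra.
have s20 : 0 < 2 * s by lra.
have lim : (fun n => ((2 * s)^-1) ^+ n) @ \oo --> (0 : R).
  apply: cvg_expr; rewrite ger0_norm ?invr_ge0 ?(ltW s20)//.
  by rewrite invf_lt1//; lra.
apply: (@squeeze_cvgr _ _ _ R (cst 0) (fun n => ((2 * s)^-1) ^+ n) _ _ 0 (cvg_cst _) lim).
apply: nearW => n.
have /andP[-> _] /= := @step_poly01 s n (introT andP (conj s0 s1)).
have sn0 : 0 <= s ^+ n by rewrite exprn_ge0.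
have sn1 : s ^+ n <= 1 by rewrite exprn_ile1.
rewrite exprVn -[leRHS]mul1r ler_pdivlMr ?exprn_gt0//.
have h : step_poly s n * (1 + s ^+ n) ^+ (2 ^ n) <= 1.
  by rewrite -exprMn -subr_sqr expr1n exprn_ile1 ?subr_ge0 ?gerBl ?exprn_ge0 ?exprn_ile1.
apply: le_trans h; rewrite ler_wpM2l//.
  by have /andP[] := @step_poly01 s n (introT andP (conj s0 s1)).
by apply: le_trans (bernoulli_ge _ sn0); rewrite exprMn -natrX lerDr.
Qed.

(** By the Lebesgue differentiation theorem [u] is almost everywhere the
    derivative of its integral over the interval from 0 to [b]. *)
Lemma ae0_initial_integrals u : mu.-integrable D (EFin \o u) ->
  (forall b, 0 < b < 2 * pi -> \int[mu]_(w in `[0, b]) u w = 0) ->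
  {ae mu, forall w, D w -> u w = 0}.
Proof.
move=> iu u0.
have pi2 : 0 < 2 * pi :> R by rewrite mulr_gt0 ?pi_gt0.
have loc : locally_integrable setT (u \_ D) by exact: integrable_locally.
have n0 (a : R) : {ae mu, forall w, w <> a}.
  exists [set a]; split => //; first exact: lebesgue_measure_set1.
  by move=> w /= /contrapT.
move: (lebesgue_differentiation loc) (n0 0) (n0 (2 * pi)).
apply: filterS3 => w wpt w0 w2; rewrite /= in_itv/= => /andP[w0' w2'].
have {w0 w0'} w0 : 0 < w by rewrite lt_neqAle w0' andbT eq_sym; apply/eqP.
have {w2 w2'} w2 : w < 2 * pi by rewrite lt_neqAle w2' andbT; apply/eqP.
have iu' : mu.-integrable [set` Interval (BLeft 0) (BRight (2 * pi))] (EFin \o (u \_ D)).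
  by apply: eq_integrable iu => // x xD; rewrite /= patchE xD.
have [_ ] := FTC1_lebesgue_pt w2 iu' (a := BLeft 0) w0 wpt.
rewrite patchE mem_set; last by rewrite /= in_itv/= !ltW.
move=> <-; rewrite derive1E (@near_eq_derive _ _ _ _ (cst 0)); first exact: derive_cst.
near=> y.
have y0 : 0 < y by near: y; exact: lt_nbhsr.
have y2 : y < 2 * pi by near: y; exact: lt_nbhsl.
rewrite /= -[RHS](u0 y); last by rewrite y0.
apply: eq_Rintegral => x; rewrite inE /= in_itv/= => /andP[x0 xy].
by rewrite patchE mem_set//= in_itv/= x0 (le_trans xy (ltW y2)).
Unshelve. all: by end_near. Qed.

End FourierUniqueness.

(** * Uniqueness of Fourier coefficients *)

Section FourierUniqueness2.
Context {R : realType}.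
Notation mu := (@lebesgue_measure R).
Notation C := R[i].
Notation Re := complex.Re.
Notation Im := complex.Im.
Notation D := (`[0, 2 * pi]%classic : set R).
Implicit Types (f g : C -> C) (u v : R -> R).

#[local] Existing Instance lebesgue_ae_filter.

(** A trigonometric polynomial with values in the unit interval that exceeds
    1/2 exactly on the arc from 0 to [b]; the half angles come from
    [cos (w - b / 2) - cos (b / 2)]. *)
Definition arc_selector (b w : R) : R := 2^-1 + 2^-1 * (sin (w / 2) * sin ((b - w) / 2)).

Lemma arc_selector01 (b w : R) : 0 <= arc_selector b w <= 1.
Proof.
rewrite /arc_selector; have : `|sin (w / 2) * sin ((b - w) / 2)| <= 1.
  by rewrite normrM mulr_ile1// sin_max.
by rewrite ler_norml => /andP[]; lra.
Qed.

Lemma arc_selector_lt (b w : R) : 0 < b -> w < 2 * pi -> b < w -> arc_selector b w < 2^-1.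
Proof.
move=> b0 w2 bw; rewrite /arc_selector gtrDl pmulr_rlt0 ?invr_gt0//.
have s1 : 0 < sin (w / 2) by apply: sin_gt0_pi; apply/andP; split; lra.
have s2 : 0 < sin ((w - b) / 2) by apply: sin_gt0_pi; apply/andP; split; lra.
by rewrite pmulr_rlt0// -opprB mulNr sinN oppr_lt0.
Qed.

Lemma arc_selector_gt (b w : R) : b < 2 * pi -> 0 < w -> w < b -> 2^-1 < arc_selector b w.
Proof.
move=> b2 w0 wb; rewrite /arc_selector ltrDl pmulr_rgt0 ?invr_gt0//.
have s1 : 0 < sin (w / 2) by apply: sin_gt0_pi; apply/andP; split; lra.
have s2 : 0 < sin ((b - w) / 2) by apply: sin_gt0_pi; apply/andP; split; lra.
by rewrite mulr_gt0.
Qed.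

Lemma measurable_arc_selector (b : R) : measurable_fun D (arc_selector b).
Proof.
have ms (g : R -> R) : measurable_fun D g -> measurable_fun D (fun w => sin (g w)).
  move=> mg; apply: (@measurableT_comp _ _ _ _ _ _ (@sin R)) => //.
  by apply: continuous_measurable_fun; exact: continuous_sin.
apply: measurable_funD; first exact: measurable_cst.
apply: measurable_funM; first exact: measurable_cst.
apply: measurable_funM; apply: ms; apply: measurable_funM => //.
by apply: measurable_funB.
Qed.

Definition arc_selectorC (b : R) (z : C) : C :=
  (2^-1 - 4^-1 * cos (b / 2))%:C +
  (8^-1)%:C * expj (- (b / 2)) * z ^ 1 + (8^-1)%:C * expj (b / 2) * z ^ (-1).

Lemma arc_selectorCE (b w : R) : arc_selectorC b (expj w) = (arc_selector b w)%:C.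
Proof.
rewrite /arc_selectorC /arc_selector !expjz mulrN1z [1%:~R]mulr1z mulN1r mul1r -!mulrA -!expjD.
have -> : 2^-1 * (sin (w / 2) * sin ((b - w) / 2)) =
    4^-1 * (cos (w - b / 2) - cos (b / 2)).
  have := cosB (w / 2) ((b - w) / 2); have := cosD (w / 2) ((b - w) / 2).
  have -> : w / 2 + (b - w) / 2 = b / 2 by field.
  have -> : w / 2 - (b - w) / 2 = w - b / 2 by field.
  by move=> -> ->; field.
rewrite [- _ + _]addrC -[b / 2 - w]opprB expjN.
by apply: eqC; rewrite ?ReD ?ImD ?ReM ?ImM conjCE /=; field.
Qed.

(** Unlike the vanishing of a single coefficient, this is stable under
    multiplication by [z ^ j], hence by trigonometric polynomials. *)
Definition fourier_null f :=
  circ_integrable f /\ forall k : int, circle_mean (fun z => z ^ k * f z) = 0.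

Lemma fourier_nullM (a : C) f : fourier_null f -> fourier_null (fun z => a * f z).
Proof.
move=> [fi f0]; split=> [|k]; first exact: circ_integrableM.
rewrite (eq_circle_mean (g := fun z => a * (z ^ k * f z))).
  rewrite circle_meanZ ?f0 ?mulr0//.
  apply: eq_circ_integrable (circ_integrable_mul_bounded fi (circ_bounded_expz k)) => w.
  by rewrite mulrC.
by move=> w; rewrite mulrCA.
Qed.

Lemma fourier_nullD f g : fourier_null f -> fourier_null g ->
  fourier_null (fun z => f z + g z).
Proof.
have zi h k : circ_integrable h -> circ_integrable (fun z => z ^ k * h z).
  move=> hi; apply: eq_circ_integrable (circ_integrable_mul_bounded hi (circ_bounded_expz k)) => w.
  by rewrite mulrC.
move=> [fi f0] [gi g0]; split=> [|k]; first exact: circ_integrableD.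
rewrite (eq_circle_mean (g := fun z => z ^ k * f z + z ^ k * g z)).
  by rewrite circle_meanD ?f0 ?g0 ?addr0//; exact: zi.
by move=> w; rewrite mulrDr.
Qed.

Lemma fourier_null_expz (j : int) f : fourier_null f -> fourier_null (fun z => z ^ j * f z).
Proof.
move=> [fi f0]; split=> [|k].
  apply: eq_circ_integrable (circ_integrable_mul_bounded fi (circ_bounded_expz j)) => w.
  by rewrite mulrC.
by rewrite -[RHS](f0 (k + j)); apply: eq_circle_mean => w; rewrite expjzD mulrA.
Qed.

Lemma eq_fourier_null f g : (forall w, f (expj w) = g (expj w)) ->
  fourier_null f -> fourier_null g.
Proof.
move=> fg [fi f0]; split=> [|k]; first exact: eq_circ_integrable fi.
by rewrite -[RHS](f0 k); apply: eq_circle_mean => w; rewrite fg.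
Qed.

Lemma fourier_null_selector (b : R) f : fourier_null f ->
  fourier_null (fun z => arc_selectorC b z * f z).
Proof.
move=> f0; apply: eq_fourier_null (fourier_nullD (fourier_nullD
  (fourier_nullM (2^-1 - 4^-1 * cos (b / 2))%:C f0)
  (fourier_nullM ((8^-1)%:C * expj (- (b / 2))) (fourier_null_expz 1 f0)))
  (fourier_nullM ((8^-1)%:C * expj (b / 2)) (fourier_null_expz (-1) f0))) => w.
by rewrite /arc_selectorC !mulrDl !mulrA.
Qed.

Lemma fourier_null_step (b : R) (n : nat) f : fourier_null f ->
  fourier_null (fun z => (1 - (1 - arc_selectorC b z ^+ n) ^+ (2 ^ n)) * f z).
Proof.
have pow m h : fourier_null h -> fourier_null (fun z => arc_selectorC b z ^+ m * h z).
  elim: m => [|m IHm] h0; first by apply: eq_fourier_null h0 => w; rewrite mul1r.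
  apply: eq_fourier_null (fourier_null_selector b (IHm h0)) => w.
  by rewrite exprS mulrA.
have sub h : fourier_null h -> fourier_null (fun z => (1 - arc_selectorC b z ^+ n) * h z).
  move=> h0; apply: eq_fourier_null (fourier_nullD h0 (fourier_nullM (-1) (pow n _ h0))) => w.
  by rewrite mulrBl mul1r mulN1r.
have pow2 m h : fourier_null h -> fourier_null (fun z => (1 - arc_selectorC b z ^+ n) ^+ m * h z).
  elim: m => [|m IHm] h0; first by apply: eq_fourier_null h0 => w; rewrite mul1r.
  apply: eq_fourier_null (sub _ (IHm h0)) => w.
  by rewrite exprS mulrA.
move=> f0; apply: eq_fourier_null (fourier_nullD f0 (fourier_nullM (-1) (pow2 _ _ f0))) => w.
by rewrite mulrBl mul1r mulN1r.
Qed.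

(** By dominated convergence the means with weight [1 - step_poly] tend to the
    integral over the interval from 0 to [b]. *)
Lemma ae0_selected_means u : mu.-integrable D (EFin \o u) ->
  (forall b n, arc_mean (fun w => (1 - step_poly (arc_selector b w) n) * u w) = 0) ->
  {ae mu, forall w, D w -> u w = 0}.
Proof.
move=> iu u0; apply: ae0_initial_integrals => // b /andP[b0 b2].
have pi2 : 0 < 2 * pi :> R by rewrite mulr_gt0 ?pi_gt0.
pose h n w := ((1 - step_poly (arc_selector b w) n) * u w).
have mu' : measurable_fun D u by apply/measurable_EFinP; exact: measurable_int iu.
have n0 (a : R) : {ae mu, forall w, w <> a}.
  exists [set a]; split => //; first exact: lebesgue_measure_set1.
  by move=> w /= /contrapT.
have sub : `[0, b] `<=` (D : set R).
  by move=> w; rewrite /= !in_itv/= => /andP[-> /le_trans ->]//; exact: ltW.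
have mh n : measurable_fun D (EFin \o h n).
  apply/measurable_EFinP; apply: measurable_funM => //.
  apply: measurable_funB => //; apply: measurable_funX; apply: measurable_funB => //.
  by apply: measurable_funX; exact: measurable_arc_selector.
have mr : measurable_fun D (EFin \o (u \_ `[0, b])).
  apply/measurable_EFinP; apply/measurable_restrict => //.
  by apply: measurable_funS mu' => //; exact: subIsetl.
have hu : {ae mu, forall w, D w -> (EFin \o h n) w @[n --> \oo] --> (EFin \o (u \_ `[0, b])) w}.
  move: (n0 0) (n0 b) (n0 (2 * pi)); apply: filterS3 => w w0 wb w2.
  rewrite /= in_itv/= => /andP[w0' w2'].
  have {w0'} w0 : 0 < w by rewrite lt_neqAle w0' andbT eq_sym; apply/eqP.
  have {w2'} w2 : w < 2 * pi by rewrite lt_neqAle w2' andbT; apply/eqP.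
  have /andP[s0 s1] := arc_selector01 b w.
  apply/cvg_EFin; first exact: nearW.
  rewrite patchE; case: ifPn.
    rewrite inE/= in_itv/= => /andP[_ wb'].
    have {wb' wb} wb : w < b by rewrite lt_neqAle wb' andbT; apply/eqP.
    suff : (fun n => (1 - step_poly (arc_selector b w) n) * u w) @ \oo --> (1 - 0) * u w.
      by rewrite subr0 mul1r.
    apply: cvgM; last exact: cvg_cst.
    apply: cvgB; first exact: cvg_cst.
    exact/step_poly_gt/s1/arc_selector_gt.
  rewrite notin_setE/= in_itv/= (ltW w0)/= => /negP; rewrite -ltNge => bw.
  suff : (fun n => (1 - step_poly (arc_selector b w) n) * u w) @ \oo --> (1 - 1) * u w.
    by rewrite subrr mul0r.
  apply: cvgM; last exact: cvg_cst.
  apply: cvgB; first exact: cvg_cst.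
  exact/step_poly_lt/arc_selector_lt.
have iu' : mu.-integrable D (EFin \o (fun w => `|u w|)) by exact: integrable_norm.
have hb : {ae mu, forall w n, D w -> (`|(EFin \o h n) w| <= (EFin \o (fun w => `|u w|%R)) w)%E}.
  apply: aeW => w n _ /=; rewrite lee_fin normrM ler_piMl//.
  have /andP[s0 s1] := step_poly01 n (arc_selector01 b w).
  by rewrite ger0_norm ?subr_ge0// gerBl.
have [_ _ lim] : [/\ _, _ & _] := @dominated_convergence _ _ R mu D (measurable_itv _)
  (fun n => EFin \o h n) _ _ mh mr hu iu' hb.
have h0 n : (\int[mu]_(w in D) (EFin \o h n) w)%E = 0%E.
  have := u0 b n; rewrite /arc_mean => /eqP; rewrite mulf_eq0 invr_eq0 (gt_eqF pi2)/=.
  move=> /eqP; rewrite /Rintegral => fi.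
  rewrite -[LHS]fineK; first by congr EFin.
  apply: integrable_fin_num => //.
  apply: (@integrable_eq _ (h n) (fun w => u w * (1 - step_poly (arc_selector b w) n))).
    by move=> w; rewrite /h mulrC.
  apply: (integrable_mul_bounded (c := 1)) => //.
    apply: measurable_funB => //; apply: measurable_funX; apply: measurable_funB => //.
    by apply: measurable_funX; exact: measurable_arc_selector.
  apply: aeW => w _; have /andP[s0 s1] := step_poly01 n (arc_selector01 b w).
  by rewrite ger0_norm ?subr_ge0// gerBl.
have e0 : (\int[mu]_(w in D) (EFin \o (u \_ `[0, b])%R) w)%E = 0%E.
  move: lim; rewrite (_ : (fun n => _) = fun=> 0%E); last exact/funext.
  move=> lim; rewrite -(cvg_lim (@ereal_hausdorff R) lim).
  by apply: lim_cst; exact: ereal_hausdorff.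
have : \int[mu]_(w in D) (u \_ `[0, b]) w = 0 by rewrite /Rintegral e0.
by rewrite -Rintegral_mkcondr setIidr.
Qed.

(** The functions with vanishing coefficients are stable under multiplication by
    trigonometric polynomials. Step polynomials of the arc selector are such
    polynomials, and they tend boundedly to the indicator of an arc. *)
Theorem fourier_uniqueness f : fourier_null f -> ae_circle (fun z => f z = 0).
Proof.
move=> f0.
have sE b n w : (1 - (1 - arc_selectorC b (expj w) ^+ n) ^+ (2 ^ n)) * f (expj w) =
    (1 - step_poly (arc_selector b w) n)%:C * f (expj w).
  by rewrite arc_selectorCE -rmorphXn -[1 in LHS]/(1%:C) -!rmorphB -rmorphXn -rmorphB.
have Z b n : circle_mean (fun z => (1 - (1 - arc_selectorC b z ^+ n) ^+ (2 ^ n)) * f z) = 0.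
  have [_ /(_ 0) <-] := fourier_null_step b n f0.
  by apply: eq_circle_mean => w; rewrite mul1r.
have [fi _] := f0; have [fR fI] := fi.
have R0 : {ae mu, forall w, D w -> Re (f (expj w)) = 0}.
  apply: ae0_selected_means => // b n.
  have := Z b n; rewrite circle_meanE => -[+ _]; rewrite -[X in _ = X -> _]/0 => <-.
  by apply: eq_arc_mean => w; rewrite sE ReM/= mul0r subr0.
have I0 : {ae mu, forall w, D w -> Im (f (expj w)) = 0}.
  apply: ae0_selected_means => // b n.
  have := Z b n; rewrite circle_meanE => -[_]; rewrite -[X in _ = X -> _]/0 => <-.
  by apply: eq_arc_mean => w; rewrite sE ImM/= mul0r addr0.
rewrite /ae_circle; move: R0 I0; apply: filterS2 => w Rw Iw.
by rewrite inE => Dw; apply: eqC; rewrite ?Rw ?Iw.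
Qed.

End FourierUniqueness2.

(** * Transfer functions and their blocks *)

Section Transfers.
Context {R : realType}.
Notation C := R[i].

Lemma trCE {m n : nat} (A : 'M[C]_(m, n)) i j : (A ^t*) i j = ((A j i)^*)%C.
Proof. by rewrite !mxE. Qed.

Definition mx_integrable {p q : nat} (V : transfer R p q) :=
  forall i j, circ_integrable (fun z => V z i j).

Definition mx_bounded {p q : nat} (V : transfer R p q) :=
  forall i j, circ_bounded (fun z => V z i j).

Lemma toeplitz_integrable {p q : nat} (V : transfer R p q) : toeplitz V -> mx_integrable V.
Proof. by case. Qed.

Lemma mx_bounded_integrable {p q : nat} (V : transfer R p q) : mx_bounded V -> mx_integrable V.
Proof. by move=> bV i j; exact: circ_bounded_integrable. Qed.

Lemma eq_mx_integrable {p q : nat} (V W : transfer R p q) :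
  (forall w, V (expj w) = W (expj w)) -> mx_integrable V -> mx_integrable W.
Proof. by move=> VW iV i j; apply: eq_circ_integrable (iV i j) => w; rewrite VW. Qed.

Lemma eq_circ_bounded (f g : C -> C) : (forall w, f (expj w) = g (expj w)) ->
  circ_bounded f -> circ_bounded g.
Proof.
move=> fg [mf [c fc]]; split; first exact: eq_circ_measurable mf.
by exists c; apply: ae_circleS fc => w; rewrite fg.
Qed.

Lemma eq_mx_bounded {p q : nat} (V W : transfer R p q) :
  (forall w, V (expj w) = W (expj w)) -> mx_bounded V -> mx_bounded W.
Proof.
move=> VW bV i j; have [mV [c cV]] := bV i j; split.
  by apply: eq_circ_measurable mV => w; rewrite VW.
by exists c; apply: ae_circleS cV => w; rewrite VW.
Qed.

Lemma mx_integrable_cst {p q : nat} (A : 'M[C]_(p, q)) : mx_integrable (fun=> A).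
Proof. by move=> i j; exact: circ_integrable_cst. Qed.

Lemma mx_bounded_cst {p q : nat} (A : 'M[C]_(p, q)) : mx_bounded (fun=> A).
Proof. by move=> i j; exact: circ_bounded_cst. Qed.

Lemma mx_integrableD {p q : nat} (V W : transfer R p q) :
  mx_integrable V -> mx_integrable W -> mx_integrable (fun z => V z + W z).
Proof.
move=> iV iW i j; apply: eq_circ_integrable (circ_integrableD (iV i j) (iW i j)) => w.
by rewrite mxE.
Qed.

Lemma mx_boundedD {p q : nat} (V W : transfer R p q) :
  mx_bounded V -> mx_bounded W -> mx_bounded (fun z => V z + W z).
Proof.
move=> bV bW i j; have := circ_boundedD (bV i j) (bW i j).
by apply: eq_circ_bounded => w; rewrite mxE.
Qed.

Lemma circ_bounded_sum (I : finType) (F : I -> C -> C) :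
  (forall i, circ_bounded (F i)) -> circ_bounded (fun z => \sum_i F i z).
Proof.
move=> bF; elim: (index_enum I) => [|i s IHs].
  by apply: eq_circ_bounded (circ_bounded_cst 0) => w; rewrite big_nil.
by apply: eq_circ_bounded (circ_boundedD (bF i) IHs) => w; rewrite big_cons.
Qed.

Lemma circ_bounded_prod (I : finType) (F : I -> C -> C) :
  (forall i, circ_bounded (F i)) -> circ_bounded (fun z => \prod_i F i z).
Proof.
move=> bF; elim: (index_enum I) => [|i s IHs].
  by apply: eq_circ_bounded (circ_bounded_cst 1) => w; rewrite big_nil.
by apply: eq_circ_bounded (circ_boundedM (bF i) IHs) => w; rewrite big_cons.
Qed.

Lemma mx_boundedM {p q s : nat} (V : transfer R p q) (W : transfer R q s) :
  mx_bounded V -> mx_bounded W -> mx_bounded (fun z => V z *m W z).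
Proof.
move=> bV bW i j.
have := circ_bounded_sum (fun k => circ_boundedM (bV i k) (bW k j)).
by apply: eq_circ_bounded => w; rewrite mxE.
Qed.

Lemma mx_integrable_mulr {p q s : nat} (V : transfer R p q) (W : transfer R q s) :
  mx_integrable V -> mx_bounded W -> mx_integrable (fun z => V z *m W z).
Proof.
move=> iV bW i j.
have [+ _] := @circle_mean_sum _ _ predT _ (fun k => circ_integrable_mul_bounded (iV i k) (bW k j)).
by apply: eq_circ_integrable => w; rewrite mxE.
Qed.

Lemma mx_integrable_tr {p q : nat} (V : transfer R p q) :
  mx_integrable V -> mx_integrable (fun z => (V z)^T).
Proof. by move=> iV i j; apply: eq_circ_integrable (iV j i) => w; rewrite mxE. Qed.

Lemma mx_bounded_adj {p q : nat} (V : transfer R p q) :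
  mx_bounded V -> mx_bounded (adj_op V).
Proof.
move=> bV i j; have := circ_bounded_conj (bV j i).
by apply: eq_circ_bounded => w; rewrite trCE.
Qed.

Lemma mx_bounded_tr {p q : nat} (V : transfer R p q) :
  mx_bounded V -> mx_bounded (fun z => (V z)^T).
Proof.
move=> bV i j; have := bV j i.
by apply: eq_circ_bounded => w; rewrite mxE.
Qed.

Lemma mx_integrable_mull {p q s : nat} (V : transfer R p q) (W : transfer R q s) :
  mx_bounded V -> mx_integrable W -> mx_integrable (fun z => V z *m W z).
Proof.
move=> bV iW; apply: eq_mx_integrable (mx_integrable_tr
  (mx_integrable_mulr (mx_integrable_tr iW) (mx_bounded_tr bV))) => w.
by rewrite trmx_mul !trmxK.
Qed.

Lemma mx_integrable_expz {p q : nat} (k : int) (V : transfer R p q) :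
  mx_integrable V -> mx_integrable (fun z => z ^ k *: V z).
Proof.
move=> iV i j; apply: eq_circ_integrable
  (circ_integrable_mul_bounded (iV i j) (circ_bounded_expz k)) => w.
by rewrite mxE mulrC.
Qed.

Lemma mx_bounded_expz {p q : nat} (k : int) (V : transfer R p q) :
  mx_bounded V -> mx_bounded (fun z => z ^ k *: V z).
Proof.
move=> bV i j; have := circ_boundedM (circ_bounded_expz k) (bV i j).
by apply: eq_circ_bounded => w; rewrite mxE.
Qed.

Lemma mx_integrableN {p q : nat} (V : transfer R p q) :
  mx_integrable V -> mx_integrable (fun z => - V z).
Proof.
move=> iV i j; apply: eq_circ_integrable (circ_integrableM (-1) (iV i j)) => w.
by rewrite mxE mulN1r.
Qed.

Lemma blockE {p q : nat} (V : transfer R p q) k i j :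
  block V k i j = circle_mean (fun z => z ^ k * V z i j).
Proof. by rewrite mxE; apply: eq_circle_mean => w; rewrite mxE. Qed.

Lemma circ_integrable_expz (f : C -> C) (k : int) :
  circ_integrable f -> circ_integrable (fun z => z ^ k * f z).
Proof.
move=> fi; apply: eq_circ_integrable (circ_integrable_mul_bounded fi (circ_bounded_expz k)) => w.
by rewrite mulrC.
Qed.

(** Inverses and square roots are controlled only almost everywhere, so transfer
    functions have to be compared in this sense. *)
Lemma block_ae {p q : nat} (V W : transfer R p q) k : teq V W -> block V k = block W k.
Proof.
move=> VW; apply/matrixP => i j; rewrite !blockE; apply: circle_mean_ae.
by apply: ae_circleS VW => w ->.
Qed.

Lemma eq_block {p q : nat} (V W : transfer R p q) k :
  (forall w, V (expj w) = W (expj w)) -> block V k = block W k.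
Proof. by move=> VW; apply: block_ae; exact: ae_circleW. Qed.

Lemma blockD {p q : nat} (V W : transfer R p q) k :
  mx_integrable V -> mx_integrable W ->
  block (fun z => V z + W z) k = block V k + block W k.
Proof.
move=> iV iW; apply/matrixP => i j; rewrite [RHS]mxE !blockE.
rewrite -circle_meanD; [|exact: circ_integrable_expz|exact: circ_integrable_expz].
by apply: eq_circle_mean => w; rewrite mxE mulrDr.
Qed.

Lemma block_mull {p q s : nat} (A : 'M[C]_(p, q)) (V : transfer R q s) k :
  mx_integrable V -> block (fun z => A *m V z) k = A *m block V k.
Proof.
move=> iV; apply/matrixP => i j; rewrite blockE [RHS]mxE.
have [_ E] := @circle_mean_sum _ _ predT _
  (fun l => circ_integrableM (A i l) (circ_integrable_expz k (iV l j))).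
transitivity (\sum_l circle_mean (fun z => A i l * (z ^ k * V z l j))).
  rewrite -E; apply: eq_circle_mean => w; rewrite mxE mulr_sumr.
  by apply: eq_bigr => l _; rewrite mulrCA.
apply: eq_bigr => l _; rewrite blockE circle_meanZ//; exact: circ_integrable_expz.
Qed.

Lemma block_tr {p q : nat} (V : transfer R p q) k :
  block (fun z => (V z)^T) k = (block V k)^T.
Proof.
by apply/matrixP => i j; rewrite [RHS]mxE !blockE; apply: eq_circle_mean => w; rewrite mxE.
Qed.

Lemma block_mulr {p q s : nat} (A : 'M[C]_(q, s)) (V : transfer R p q) k :
  mx_integrable V -> block (fun z => V z *m A) k = block V k *m A.
Proof.
move=> iV; apply: trmx_inj; rewrite trmx_mul -!block_tr -block_mull; last exact: mx_integrable_tr.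
by apply: eq_block => w; rewrite trmx_mul.
Qed.

Lemma block_expz {p q : nat} (j : int) (V : transfer R p q) k :
  block (fun z => z ^ j *: V z) k = block V (k + j).
Proof.
apply/matrixP => a b; rewrite !blockE; apply: eq_circle_mean => w.
by rewrite mxE expjzD mulrA.
Qed.

Lemma blockN {p q : nat} (V : transfer R p q) k : mx_integrable V ->
  block (fun z => - V z) k = - block V k.
Proof.
move=> iV; have := block_mull (- 1%:M) k iV; rewrite mulNmx mul1mx => <-.
by apply: eq_block => w; rewrite mulNmx mul1mx.
Qed.

Lemma blockB {p q : nat} (V W : transfer R p q) k :
  mx_integrable V -> mx_integrable W ->
  block (fun z => V z - W z) k = block V k - block W k.
Proof. by move=> iV iW; rewrite blockD ?blockN//; exact: mx_integrableN. Qed.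

Lemma block_adj {p q : nat} (V : transfer R p q) k : mx_integrable V ->
  block (adj_op V) k = (block V (- k)) ^t*.
Proof.
move=> iV; apply/matrixP => i j; rewrite trCE !blockE -circle_mean_conj.
  by apply: eq_circle_mean => w; rewrite rmorphM/= conj_expjz opprK trCE.
exact: circ_integrable_expz.
Qed.

Lemma block_cst {p q : nat} (A : 'M[C]_(p, q)) k :
  block (fun=> A : 'M[C]_(p, q)) k = if k == 0 then A else 0.
Proof.
apply/matrixP => i j; rewrite blockE.
transitivity (A i j * circle_mean (fun z : C => z ^ k)).
  rewrite -circle_meanZ; last exact/circ_bounded_integrable/circ_bounded_expz.
  by apply: eq_circle_mean => w; rewrite mulrC.
by rewrite circle_mean_expz; case: eqP; rewrite ?mulr1 ?mulr0 ?mxE.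
Qed.

Lemma block_inj {p q : nat} (V W : transfer R p q) :
  mx_integrable V -> mx_integrable W ->
  (forall k, block V k = block W k) -> teq V W.
Proof.
move=> iV iW VW.
have VW0 : ae_circle (fun z => forall i, forall j, V z i j - W z i j = 0).
  apply: ae_circle_all => i; apply: ae_circle_all => j; apply: fourier_uniqueness.
  have iVW : circ_integrable (fun z => V z i j - W z i j).
    apply: eq_circ_integrable (circ_integrableD (iV i j) (mx_integrableN iW i j)) => w.
    by rewrite [in LHS]mxE.
  split=> // k.
  have := congr1 (fun M : 'M[C]_(p, q) => M i j) (blockB k iV iW).
  rewrite /= VW subrr [RHS]mxE blockE => <-.
  by apply: eq_circle_mean => w; rewrite !mxE.
by apply: ae_circleS VW0 => w H; apply/matrixP => i j; exact/subr0_eq.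
Qed.

Lemma block_bounded {p q : nat} (V : transfer R p q) : mx_integrable V ->
  exists c : R, forall k i j, `|block V k i j| <= c%:C.
Proof.
move=> iV.
have /choice [c cP] : forall ij : 'I_p * 'I_q, exists c : R,
    forall k, `|block V k ij.1 ij.2| <= c%:C.
  move=> [i j] /=; have [c cP] := circle_coef_bounded (iV i j).
  by exists c => k; rewrite blockE.
exists (\sum_ij `|c ij|) => k i j; apply: (le_trans (cP (i, j) k)); rewrite lecR.
by rewrite (bigD1 (i, j))//= (le_trans (ler_norm _))// lerDl sumr_ge0.
Qed.

End Transfers.

(** * Bounded orbits of Schur stable matrices *)

Section SchurStability.
Context {R : realType}.
Notation C := R[i].

Definition cschur {n : nat} (A : 'M[C]_n) : Prop :=
  forall l, eigenvalue A l -> `|l| < 1.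

Lemma unitmx_resolvent {n : nat} (A : 'M[C]_n) (z : C) :
  (z%:M - A \in unitmx) = ~~ eigenvalue A z.
Proof.
rewrite /eigenvalue /eigenspace kermx_eq0 negbK row_free_unit -opprB.
by rewrite -scaleN1r unitmxZ// unitrN unitr1.
Qed.

Lemma cschur_tr {n : nat} (A : 'M[C]_n) : cschur A -> cschur A^T.
Proof.
move=> sA l; rewrite -[eigenvalue _ _]negbK -unitmx_resolvent => nl.
apply: sA; rewrite -[eigenvalue _ _]negbK -unitmx_resolvent; apply: contra nl.
by rewrite -unitmx_tr linearB/= tr_scalar_mx.
Qed.

Lemma cschur_unitmx {n : nat} (A : 'M[C]_n) (z : C) :
  cschur A -> `|z| = 1 -> z%:M - A \in unitmx.
Proof.
by move=> sA z1; rewrite unitmx_resolvent; apply/negP => /sA; rewrite z1 ltxx.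
Qed.

Lemma le0_geometric (y rho c : R) : 0 <= rho < 1 ->
  (forall m : nat, y <= rho ^+ m * c) -> y <= 0.
Proof.
move=> /andP[r0 r1] yc.
have lim : (fun m => rho ^+ m * c) @ \oo --> (0 * c : R).
  by apply: cvgM; [apply: cvg_expr; rewrite ger0_norm|exact: cvg_cst].
rewrite mul0r in lim.
by apply: (ler_cvg_to (cvg_cst y) lim); exact: nearW.
Qed.

Lemma norm_lt1_real (l : C) : `|l| < 1 -> exists2 rho : R, 0 <= rho < 1 & `|l| = rho%:C.
Proof.
have [rho [r0 lr]] := normC_bound l.
rewrite lr -[1 in X in X -> _]/(1%:C) ltcR => r1.
by exists rho; rewrite ?r0.
Qed.

Definition bounded_seq {n m : nat} (Y : nat -> 'M[C]_(n, m)) :=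
  exists c : R, forall k i j, `|Y k i j| <= c%:C.

Lemma bounded_seq_mul {p n m : nat} (A : 'M[C]_(p, n)) (Y : nat -> 'M[C]_(n, m)) :
  bounded_seq Y -> bounded_seq (fun k => A *m Y k).
Proof.
move=> [c cY].
have /choice [a aP] : forall il : 'I_p * 'I_n, exists a : R, `|A il.1 il.2| = a%:C.
  by move=> il; have [a [_ aE]] := normC_bound (A il.1 il.2); exists a.
exists (\sum_i \sum_l `|a (i, l)| * `|c|) => k i j; rewrite mxE.
rewrite (le_trans (ler_norm_sum _ _ _))//.
apply: (@le_trans _ _ ((\sum_l `|a (i, l)| * `|c|)%:C)).
  rewrite rmorph_sum/=; apply: ler_sum => l _.
  rewrite normrM rmorphM/= ler_pM//.
    by rewrite (aP (i, l)) lecR ler_norm.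
  by rewrite (le_trans (cY _ _ _))// lecR ler_norm.
rewrite lecR (bigD1 i)//= lerDl; apply: sumr_ge0 => i' _.
by apply: sumr_ge0 => l _; rewrite mulr_ge0.
Qed.

(** A bounded backward orbit of a Schur stable matrix vanishes. By
    Cayley-Hamilton it is enough to treat one linear factor of the
    characteristic polynomial at a time, and there the orbit is geometric. *)
Lemma backward_orbit0 {n m : nat} (A : 'M[C]_n) (Y : nat -> 'M[C]_(n, m)) :
  cschur A -> bounded_seq Y -> (forall k, Y k = A *m Y k.+1) ->
  forall k, Y k = 0.
Proof.
case: n A Y => [|n] A Y sA bY YA; first by move=> k; apply/matrixP => -[].
have factors (s : seq C) (Z : nat -> 'M[C]_(n.+1, m)) :
    all (fun l => `|l| < 1) s -> bounded_seq Z -> (forall k, Z k = A *m Z k.+1) ->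
    (forall k, (\prod_(l <- s) (A - l%:M)) *m Z k = 0) -> forall k, Z k = 0.
  elim: s Z => [|l s IHs] Z /=.
    by move=> _ _ _ + k => /(_ k); rewrite big_nil mul1mx.
  move=> /andP[l1 s1] bZ ZA Z0.
  pose Q := \prod_(l <- s) (A - l%:M); pose W k := Q *m Z k.
  have QA : Q *m A = A *m Q.
    rewrite /Q; elim: (s) => [|x r IHr]; first by rewrite big_nil mul1mx mulmx1.
    rewrite big_cons -mulmxE -mulmxA IHr !mulmxA; congr (_ *m _).
    by rewrite mulmxBl mulmxBr scalar_mxC.
  have WA k : W k = A *m W k.+1 by rewrite /W [in LHS]ZA !mulmxA QA.
  have W1 k : W k = l *: W k.+1.
    have := Z0 k.+1; rewrite big_cons -mulmxE -mulmxA -/Q -/(W _) mulmxBl -WA.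
    by move/subr0_eq ->; rewrite mul_scalar_mx.
  have Wm p k : W k = l ^+ p *: W (k + p)%N.
    elim: p => [|p IHp]; first by rewrite scale1r addn0.
    by rewrite IHp W1 scalerA -exprSr addnS.
  apply: (IHs _ s1 bZ ZA) => k; rewrite -/Q -/(W k).
  have [rho r01 lr] := norm_lt1_real l1.
  have [c cW] := bounded_seq_mul Q bZ.
  apply/matrixP => i j; rewrite [RHS]mxE; apply/eqP; rewrite -normr_le0.
  have [y [_ yE]] := normC_bound (W k i j); rewrite yE -[0]/(0%:C) lecR.
  apply: (le0_geometric (rho := rho) (c := c)) => // p.
  rewrite -lecR -yE (Wm p k) [X in `|X|]mxE normrM normrX lr rmorphM rmorphXn/=.
  by rewrite ler_wpM2l ?cW// exprn_ge0// ler0c; case/andP: r01.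
have [s sE] := closed_field_poly_normal (char_poly A).
have cE : char_poly A = \prod_(z <- s) ('X - z%:P).
  by rewrite sE (monicP (char_poly_monic A)) scale1r.
apply: (factors s) => //.
  apply/allP => l ls; apply: sA; rewrite eigenvalue_root_char cE.
  by rewrite root_prod_XsubC.
move=> k; suff -> : \prod_(l <- s) (A - l%:M) = 0 by rewrite mul0mx.
rewrite -(Cayley_Hamilton A) cE rmorph_prod; apply: eq_bigr => l _.
by rewrite rmorphB/= horner_mx_X horner_mx_C.
Qed.

End SchurStability.

(** * Resolvents on the circle *)

Section Resolvent.
Context {R : realType}.
Notation C := R[i].

Lemma ltr0C (k : R) : (0 < k%:C :> C) = (0 < k).
Proof. by rewrite -ltcR. Qed.

Definition resolvent {n : nat} (A : 'M[C]_n) : transfer R n n :=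
  fun z => invmx (z%:M - A).

Lemma resolvent_unit {n : nat} (A : 'M[C]_n) (w : R) :
  cschur A -> (expj w)%:M - A \in unitmx.
Proof. by move=> sA; apply: cschur_unitmx => //; exact: norm_expj. Qed.

Lemma det_resolvent {n : nat} (A : 'M[C]_n) (z : C) :
  \det (z%:M - A) = (char_poly A).[z].
Proof.
apply/esym; rewrite horner_sum; apply: eq_bigr => s _.
rewrite hornerM horner_exp !hornerE; congr (_ * _).
rewrite (big_morph _ (fun p q => hornerM p q z) (hornerC 1 z)).
by apply: eq_bigr => i _; rewrite !mxE !(hornerE, hornerMn).
Qed.

Lemma circ_bounded_det {n : nat} (V : transfer R n n) :
  mx_bounded V -> circ_bounded (fun z => \det (V z)).
Proof.
move=> bV; apply: (@circ_bounded_sum R {perm 'I_n}) => s.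
by apply: circ_boundedM; [exact: circ_bounded_cst|exact: circ_bounded_prod].
Qed.

Lemma mx_bounded_pencil {n : nat} (A : 'M[C]_n) : mx_bounded (fun z => z%:M - A).
Proof.
apply: (@eq_mx_bounded _ _ _ (fun z => z ^ 1 *: 1%:M + - A)).
  by move=> w; rewrite scalemx1.
apply: mx_boundedD; last exact: mx_bounded_cst.
by apply: mx_bounded_expz; exact: mx_bounded_cst.
Qed.

(** On the circle the characteristic polynomial is bounded away from 0 by the
    product of the distances of the eigenvalues to the circle. *)
Lemma mx_bounded_resolvent {n : nat} (A : 'M[C]_n) : cschur A -> mx_bounded (resolvent A).
Proof.
move=> sA.
have [s sE] := closed_field_poly_normal (char_poly A).
rewrite (monicP (char_poly_monic A)) scale1r in sE.
have sl l : l \in s -> `|l| < 1.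
  by move=> ls; apply: sA; rewrite eigenvalue_root_char sE root_prod_XsubC.
have [d d0 dP] : exists2 d : R, 0 < d & forall w, d%:C <= `|\det ((expj w)%:M - A)|.
  suff [d d0 dP] : exists2 d : R, 0 < d &
      forall w, d%:C <= `|(\prod_(z <- s) ('X - z%:P)).[expj w]|.
    by exists d => // w; rewrite det_resolvent sE.
  elim: s sl {sE} => [|l s IHs] sl.
    by exists 1 => // w; rewrite big_nil hornerC normr1.
  have [d d0 dP] := IHs (fun l' ls => sl l' (mem_behead (s := l :: s) ls)).
  have [rho /andP[r0 r1] lr] := norm_lt1_real (sl l (mem_head _ _)).
  exists ((1 - rho) * d) => [|w]; first by rewrite mulr_gt0 ?subr_gt0.
  rewrite big_cons hornerM normrM rmorphM/= ler_pM ?ler0c ?subr_ge0 ?(ltW r1) ?(ltW d0)//.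
  rewrite !hornerE; apply: le_trans (lerB_dist _ _).
  by rewrite norm_expj lr rmorphB.
have bdV : circ_bounded (fun z => (\det (z%:M - A))^-1).
  split.
    by apply: circ_measurableV; have [] := circ_bounded_det (mx_bounded_pencil A).
  exists d^-1; apply: ae_circleW => w; rewrite normfV fmorphV/=.
  have dC : 0 < d%:C :> C by rewrite ltr0C.
  by rewrite lef_pV2 ?posrE ?dP// (lt_le_trans dC).
move=> i j; apply: (@eq_circ_bounded _ (fun z => (\det (z%:M - A))^-1 *
    ((-1) ^+ (j + i) * \det (row' j (col' i (z%:M - A)))))).
  by move=> w; rewrite /resolvent /invmx resolvent_unit// !mxE.
apply: circ_boundedM => //; apply: circ_boundedM; first exact: circ_bounded_cst.
apply: circ_bounded_det => a b.
apply: eq_circ_bounded (mx_bounded_pencil A (lift j a) (lift i b)) => w.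
by rewrite !mxE.
Qed.

(** Comparing blocks in [(z - A) E = V]. *)
Lemma block_pencil {n m : nat} (A : 'M[C]_n) (E V : transfer R n m) (k : int) :
  mx_integrable E -> teq (fun z => (z%:M - A) *m E z) V ->
  block E (k + 1) = A *m block E k + block V k.
Proof.
move=> iE EV; rewrite -(block_ae k EV) -block_mull// -blockD.
- rewrite -block_expz; apply: eq_block => w.
  by rewrite mulmxBl mul_scalar_mx addrC subrK.
- exact: mx_integrable_mull (mx_bounded_cst A) iE.
- apply: mx_integrable_mull iE; exact: mx_bounded_pencil.
Qed.

Lemma bounded_seq_block {n m : nat} (V : transfer R n m) (k : nat -> int) :
  mx_integrable V -> bounded_seq (fun p => block V (k p)).
Proof. by move=> /block_bounded[c cV]; exists c => p i j. Qed.

(** In negative degrees the blocks of [(z - A)^-1 V] form a bounded backward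
    orbit of [A], because those of [V] vanish there. *)
Lemma resolvent_mull_causal {n m : nat} (A : 'M[C]_n) (V : transfer R n m) :
  cschur A -> mx_integrable V -> (forall k : int, k < 0 -> block V k = 0) ->
  forall k : int, k <= 0 -> block (fun z => resolvent A z *m V z) k = 0.
Proof.
move=> sA iV V0.
have iE := mx_integrable_mull (mx_bounded_resolvent sA) iV.
set E := fun z => _ in iE *; rewrite -/E.
have EV : teq (fun z => (z%:M - A) *m E z) V.
  by apply: ae_circleW => w; rewrite mulmxA mulmxV ?mul1mx ?resolvent_unit.
have bt := @backward_orbit0 _ _ _ A (fun p : nat => block E (- p%:Z)) sA
  (bounded_seq_block (fun p : nat => - p%:Z) iE).
move=> k k0; have -> : k = - `|k|%N%:Z by rewrite abszE ler0_norm ?opprK.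
apply: bt => p; have -> : - p%:Z = - p.+1%:Z + 1 by rewrite -addn1 PoszD opprD subrK.
by rewrite (block_pencil _ iE EV) V0 ?addr0.
Qed.

Lemma block_resolvent {n : nat} (A : 'M[C]_n) (k : int) : cschur A -> k <= 0 ->
  block (resolvent A) k = 0.
Proof.
move=> sA k0; rewrite -(resolvent_mull_causal sA (mx_integrable_cst 1%:M) _ k0).
  by apply: eq_block => w; rewrite mulmx1.
by move=> j; rewrite block_cst; case: eqP => // ->; rewrite ltxx.
Qed.

Lemma resolvent_tr {n : nat} (A : 'M[C]_n) (z : C) :
  resolvent A^T z = (resolvent A z)^T.
Proof. by rewrite /resolvent trmx_inv linearB/= tr_scalar_mx. Qed.

Lemma resolvent_mulr_causal {n m : nat} (A : 'M[C]_n) (V : transfer R m n) :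
  cschur A -> mx_integrable V -> (forall k : int, k < 0 -> block V k = 0) ->
  forall k : int, k <= 0 -> block (fun z => V z *m resolvent A z) k = 0.
Proof.
move=> sA iV V0 k k0; apply: trmx_inj; rewrite -block_tr linear0.
rewrite -(resolvent_mull_causal (cschur_tr sA) (mx_integrable_tr iV) _ k0).
  by apply: eq_block => w; rewrite trmx_mul resolvent_tr.
by move=> j j0; rewrite block_tr V0 ?linear0.
Qed.

Lemma conjmx_inv {n : nat} (M : 'M[C]_n) : (invmx M) ^t* = invmx (M ^t*).
Proof. by rewrite trmx_inv map_invmx. Qed.

Lemma adj_mul {m n p : nat} (M : 'M[C]_(m, n)) (N : 'M[C]_(n, p)) :
  (M *m N) ^t* = N ^t* *m M ^t*.
Proof. by rewrite trmx_mul map_mxM. Qed.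

Lemma adjD {m n : nat} (M N : 'M[C]_(m, n)) : (M + N) ^t* = M ^t* + N ^t*.
Proof. by apply/matrixP => i j; rewrite !(trCE, mxE) rmorphD. Qed.

Lemma adjN {m n : nat} (M : 'M[C]_(m, n)) : (- M) ^t* = - M ^t*.
Proof. by apply/matrixP => i j; rewrite !(trCE, mxE) rmorphN. Qed.

Lemma adjB {m n : nat} (M N : 'M[C]_(m, n)) : (M - N) ^t* = M ^t* - N ^t*.
Proof. by rewrite adjD adjN. Qed.

Lemma adj_scalar {n : nat} (a : C) : (a%:M : 'M[C]_n) ^t* = ((a^*)%C)%:M.
Proof. by apply/matrixP => i j; rewrite trCE !mxE rmorphMn/= eq_sym. Qed.

Lemma adj1 {n : nat} : (1%:M : 'M[C]_n) ^t* = 1%:M.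
Proof. by rewrite adj_scalar rmorph1. Qed.

Lemma adj0 {m n : nat} : (0 : 'M[C]_(m, n)) ^t* = 0.
Proof. by apply/matrixP => i j; rewrite trCE !mxE rmorph0. Qed.

Lemma adj_toC {m n : nat} (A : 'M[R]_(m, n)) : (toC A) ^t* = toC A^T.
Proof. by apply/matrixP => i j; rewrite trCE !mxE /= oppr0. Qed.

Lemma adj_resolvent {n : nat} (A : 'M[C]_n) (w : R) :
  (resolvent A (expj w)) ^t* = invmx ((expj w)^-1%:M - A ^t*).
Proof. by rewrite conjmx_inv adjB adj_scalar expjV. Qed.

End Resolvent.

(** * Minimal realizations of causal transfer functions *)

Section MinimalRealization.
Context {R : realType}.
Notation C := R[i].
Notation mu := (@lebesgue_measure R).

#[local] Existing Instance lebesgue_ae_filter.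

(** The angle of [l] is [acos] of its real part or the opposite angle. *)
Lemma ae_circle_neq (l : C) : ae_circle (fun z => z != l).
Proof.
pose a := acos (complex.Re l).
have n0 (b : R) : {ae mu, forall w, w <> b}.
  exists [set b]; split => //; first exact: lebesgue_measure_set1.
  by move=> w /= /contrapT.
rewrite /ae_circle; move: (n0 a) (n0 (2 * pi - a)); apply: filterS2 => w wa wb.
rewrite in_itv/= => /andP[w0 w2]; apply/eqP => wl.
have cw : cos w = complex.Re l by rewrite -wl.
have [wpi|wpi] := leP w pi.
  by apply: wa; rewrite /a -cw cosK// in_itv/= w0.
apply: wb; rewrite /a -cw.
have -> : cos w = cos (2 * pi - w).
  by rewrite cosB mulr_natl cos2pi sin2pi mul1r mul0r addr0.
by rewrite cosK ?in_itv/= ?subr_ge0 ?w2//=; lra.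
Qed.

Lemma ae_circle_regular {n : nat} (A : 'M[C]_n) :
  ae_circle (fun z => z%:M - A \in unitmx).
Proof.
have [s sE] := closed_field_poly_normal (char_poly A).
rewrite (monicP (char_poly_monic A)) scale1r in sE.
suff : ae_circle (fun z => z \notin s).
  apply: ae_circleS => w ws.
  by rewrite unitmx_resolvent eigenvalue_root_char sE root_prod_XsubC.
elim: s {sE} => [|l s IHs]; first exact: ae_circleW.
by apply: ae_circleS2 (ae_circle_neq l) IHs => w wl ws; rewrite inE negb_or wl.
Qed.

(** Multiplying [H] by [z] and subtracting [L *m M] moves a factor [A] into [L] or
    into [M], at the price of one more anticausal block. So this property passes
    from the transfer function of a minimal realization to the resolvent. Only
    regular points of the circle are considered, as [A] may have eigenvalues there
    until its stability is known. *)
Definition laurent_transfer {n p m : nat} (A : 'M[C]_n) (L : 'M[C]_(p, n))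
    (M : 'M[C]_(n, m)) :=
  exists H : transfer R p m, [/\ mx_integrable H,
    forall w, (expj w)%:M - A \in unitmx -> H (expj w) = L *m resolvent A (expj w) *m M &
    exists N : nat, forall k : int, k < - N%:Z -> block H k = 0].

Lemma resolvent_shiftl {n : nat} (A : 'M[C]_n) (z : C) : z%:M - A \in unitmx ->
  z *: resolvent A z = 1%:M + A *m resolvent A z.
Proof.
move=> u; apply/eqP; rewrite -subr_eq -mul_scalar_mx -mulmxBl.
by rewrite mulmxV.
Qed.

Lemma resolvent_shiftr {n : nat} (A : 'M[C]_n) (z : C) : z%:M - A \in unitmx ->
  z *: resolvent A z = 1%:M + resolvent A z *m A.
Proof.
move=> u; apply/eqP; rewrite -subr_eq -mul_mx_scalar -mulmxBr.
by rewrite mulVmx.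
Qed.

Lemma block_shift_cst {p m : nat} (H : transfer R p m) (M : 'M[C]_(p, m)) (N : nat) :
  mx_integrable H -> (forall k : int, k < - N%:Z -> block H k = 0) ->
  forall k : int, k < - N.+1%:Z -> block (fun z => z ^ 1 *: H z - M) k = 0.
Proof.
move=> iH H0 k kN; rewrite blockB; last exact: mx_integrable_cst; last exact: mx_integrable_expz.
rewrite block_expz block_cst H0; last by rewrite -ltrBrDr -opprD -PoszD addn1.
case: eqP => [k0|_]; last by rewrite subr0.
by move: kN; rewrite k0 oppr_gt0.
Qed.

Lemma laurent_transfer_shiftr {n p m : nat} (A : 'M[C]_n) (L : 'M[C]_(p, n)) (M : 'M[C]_(n, m)) :
  laurent_transfer A L M -> laurent_transfer A L (A *m M).
Proof.
move=> [H [iH HE [N HN]]]; exists (fun z => z ^ 1 *: H z - L *m M); split.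
- apply: mx_integrableD; first exact: mx_integrable_expz.
  exact: mx_integrable_cst.
- move=> w u; rewrite HE// -[expj w ^ 1]/(expj w) scalemxAl scalemxAr.
  rewrite resolvent_shiftr// mulmxDr mulmx1 mulmxDl !mulmxA.
  by rewrite addrC addKr.
- by exists N.+1; exact: block_shift_cst.
Qed.

Lemma laurent_transfer_shiftl {n p m : nat} (A : 'M[C]_n) (L : 'M[C]_(p, n)) (M : 'M[C]_(n, m)) :
  laurent_transfer A L M -> laurent_transfer A (L *m A) M.
Proof.
move=> [H [iH HE [N HN]]]; exists (fun z => z ^ 1 *: H z - L *m M); split.
- apply: mx_integrableD; first exact: mx_integrable_expz.
  exact: mx_integrable_cst.
- move=> w u; rewrite HE// -[expj w ^ 1]/(expj w) scalemxAl scalemxAr.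
  rewrite resolvent_shiftl// mulmxDr mulmx1 mulmxDl !mulmxA.
  by rewrite addrC addKr.
- by exists N.+1; exact: block_shift_cst.
Qed.

Lemma laurent_transfer_mulr {n p m s : nat} (A : 'M[C]_n) (L : 'M[C]_(p, n)) (M : 'M[C]_(n, m))
    (W : 'M[C]_(m, s)) :
  laurent_transfer A L M -> laurent_transfer A L (M *m W).
Proof.
move=> [H [iH HE [N HN]]]; exists (fun z => H z *m W); split.
- by apply: mx_integrable_mulr => //; exact: mx_bounded_cst.
- by move=> w u; rewrite HE// !mulmxA.
- by exists N => k kN; rewrite block_mulr// HN// mul0mx.
Qed.

Lemma laurent_transfer_mull {n p m s : nat} (A : 'M[C]_n) (L : 'M[C]_(p, n)) (M : 'M[C]_(n, m))
    (W : 'M[C]_(s, p)) :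
  laurent_transfer A L M -> laurent_transfer A (W *m L) M.
Proof.
move=> [H [iH HE [N HN]]]; exists (fun z => W *m H z); split.
- by apply: mx_integrable_mull => //; exact: mx_bounded_cst.
- by move=> w u; rewrite HE// !mulmxA.
- by exists N => k kN; rewrite block_mull// HN// mulmx0.
Qed.

Lemma laurent_transfer_sumr {n p m : nat} (A : 'M[C]_n) (L : 'M[C]_(p, n))
    (I : finType) (M : I -> 'M[C]_(n, m)) :
  (forall i, laurent_transfer A L (M i)) -> laurent_transfer A L (\sum_i M i).
Proof.
move=> good; elim: (index_enum I) => [|i s [H [iH HE [N HN]]]].
  rewrite big_nil; exists (fun=> 0); split; first exact: mx_integrable_cst.
    by move=> w u; rewrite mulmx0.
  by exists 0%N => k k0; rewrite block_cst; case: eqP.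
have [H' [iH' HE' [N' HN']]] := good i.
rewrite big_cons; exists (fun z => H' z + H z); split; first exact: mx_integrableD.
  by move=> w u; rewrite HE'// HE// mulmxDr.
exists (N + N')%N => k kN; rewrite blockD// HN ?HN' ?addr0//.
  by apply: lt_le_trans kN _; rewrite lerN2 lez_nat leq_addl.
by apply: lt_le_trans kN _; rewrite lerN2 lez_nat leq_addr.
Qed.

Lemma laurent_transfer_suml {n p m : nat} (A : 'M[C]_n) (M : 'M[C]_(n, m))
    (I : finType) (L : I -> 'M[C]_(p, n)) :
  (forall i, laurent_transfer A (L i) M) -> laurent_transfer A (\sum_i L i) M.
Proof.
move=> good; elim: (index_enum I) => [|i s [H [iH HE [N HN]]]].
  rewrite big_nil; exists (fun=> 0); split; first exact: mx_integrable_cst.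
    by move=> w u; rewrite !mul0mx.
  by exists 0%N => k k0; rewrite block_cst; case: eqP.
have [H' [iH' HE' [N' HN']]] := good i.
rewrite big_cons; exists (fun z => H' z + H z); split; first exact: mx_integrableD.
  by move=> w u; rewrite HE'// HE// !mulmxDl.
exists (N + N')%N => k kN; rewrite blockD// HN ?HN' ?addr0//.
  by apply: lt_le_trans kN _; rewrite lerN2 lez_nat leq_addl.
by apply: lt_le_trans kN _; rewrite lerN2 lez_nat leq_addr.
Qed.

Lemma toCM {m n p : nat} (M : 'M[R]_(m, n)) (N : 'M[R]_(n, p)) :
  toC (M *m N) = toC M *m toC N.
Proof. exact: map_mxM. Qed.

Lemma toC1 {n : nat} : toC (1%:M : 'M[R]_n) = 1%:M.
Proof. exact: map_mx1. Qed.

Lemma toC_sum {m n : nat} (I : finType) (F : I -> 'M[R]_(m, n)) :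
  toC (\sum_i F i) = \sum_i toC (F i).
Proof. exact: map_mx_sum. Qed.

(** A vector [v] with [v A = l v] and [1 <= |l|] turns the resolvent into a
    multiple of [h = (z - l)^-1]; then [1 + 2 l h = (z + l) / (z - l)] has
    nonpositive real part on the circle, while its mean is 1 if [h] has mean 0. *)
Lemma laurent_resolvent_schur {n : nat} (A : 'M[C]_n) :
  laurent_transfer A 1%:M 1%:M -> cschur A.
Proof.
move=> [E [iE EE [N EN]]] l /eigenvalueP[v vA v0].
have EV : teq (fun z => (z%:M - A) *m E z) (fun=> 1%:M).
  by apply: ae_circleS (ae_circle_regular A) => w u; rewrite EE// mul1mx mulmx1 mulmxV.
have E0 : block E 0 = 0.
  have E0 p : block E (- (N.+1)%:Z + p%:Z) = 0 \/ (N.+1 < p)%N.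
    elim: p => [|p [IHp|Np]]; last by right; exact: ltnW.
      by left; apply: EN; rewrite addr0 ltrN2 ltz_nat.
    have [Np|pN] := ltnP N.+1 p.+1; first by right.
    left; rewrite -[p.+1]addn1 PoszD addrA (block_pencil _ iE EV) IHp mulmx0 add0r block_cst.
    case: eqP => // /eqP; rewrite addrC subr_eq0 eqz_nat => /eqP pE.
    by rewrite pE ltnn in pN.
  have [] := E0 N.+1; first by rewrite addNr.
  by rewrite ltnn.
have [j vj] : exists j, v 0 j != 0.
  apply/existsP; apply: contraNT v0 => /existsPn H; apply/eqP/rowP => j.
  by rewrite mxE; apply/eqP; have := H j; rewrite negbK.
pose h z := (v 0 j)^-1 * (v *m E z) 0 j.
have ivE : mx_integrable (fun z => v *m E z).
  by apply: mx_integrable_mull => //; exact: mx_bounded_cst.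
have ih : circ_integrable h by exact/circ_integrableM/ivE.
have h0 : circle_mean h = 0.
  rewrite circle_meanZ; last exact: ivE.
  have := congr1 (fun M : 'M[C]_(_, _) => M 0 j) (block_mull v 0 iE).
  rewrite /= E0 mulmx0 blockE mxE => m0.
  by rewrite (eq_circle_mean (g := fun z => z ^ 0 * (v *m E z) 0 j)) ?m0 ?mulr0// => w;
    rewrite mul1r.
have hE : ae_circle (fun z => (z - l) * h z = 1).
  apply: ae_circleS EV => w EVw.
  have : v *m (((expj w)%:M - A) *m E (expj w)) = v by rewrite EVw mulmx1.
  rewrite mulmxA mulmxBr vA mul_mx_scalar -scalerBl -scalemxAl => /rowP/(_ j).
  by rewrite mxE /h mulrCA => ->; rewrite mulVf.
have [rho [rho0 lr]] := normC_bound l.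
rewrite lr -[X in _ < X]/(1%:C) ltcR ltNge; apply/negP => l1.
have m1 : circle_mean (fun z => - 1 + - (2 * l) * h z) = - 1.
  rewrite circle_meanD; [|exact: circ_integrable_cst|exact: circ_integrableM].
  by rewrite circle_meanZ// h0 mulr0 addr0 circle_mean_cst.
suff : 0 <= complex.Re (circle_mean (fun z => - 1 + - (2 * l) * h z)).
  by rewrite m1 ReN /= oppr_ge0 leNgt ltr01.
apply: circle_mean_Re_ge0; apply: ae_circleS hE => w hw.
have zl : expj w - l != 0 by apply: contra_eqN hw => /eqP ->; rewrite mul0r eq_sym oner_eq0.
have -> : - 1 + - (2 * l) * h (expj w) = - ((expj w + l) / (expj w - l)).
  have -> : h (expj w) = (expj w - l)^-1 by apply: (mulfI zl); rewrite hw divff.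
  by field.
have n1 : 1 <= complex.Re l ^+ 2 + complex.Im l ^+ 2.
  suff -> : complex.Re l ^+ 2 + complex.Im l ^+ 2 = rho ^+ 2 by rewrite exprn_ege1.
  by apply: complexI; rewrite add_Re2_Im2 lr rmorphXn.
have w1 : cos w ^+ 2 + sin w ^+ 2 = 1 := cos2Dsin2 w.
rewrite ReN ReM ReV ImV !ReD !ImD !ReN !ImN /=.
set a := complex.Re l in n1 *; set b := complex.Im l in n1 *.
set d := (_ ^+ 2 + _ ^+ 2)^-1.
have d0 : 0 <= d by rewrite invr_ge0 addr_ge0 ?sqr_ge0.
have -> : - ((cos w + a) * ((cos w - a) * d) - (sin w + b) * - ((sin w - b) * d)) =
   (a ^+ 2 + b ^+ 2 - (cos w ^+ 2 + sin w ^+ 2)) * d by ring.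
by rewrite mulr_ge0// w1 subr_ge0.
Qed.

(** Controllability writes 1 as a combination of the [A ^ i B], observability as
    one of the [C A ^ j]. *)
Lemma minimal_strictly_causal_schur {n m p : nat} (A : 'M[R]_n) (B : 'M[R]_(n, m))
    (K : 'M[R]_(p, n)) :
  controllable A B -> observable A K -> strictly_causal (ss_transfer K A B) -> schur A.
Proof.
move=> cAB oAK [tG G0].
apply: laurent_resolvent_schur.
have good0 : laurent_transfer (toC A) (toC K) (toC B).
  exists (ss_transfer K A B); split => //; first exact: toeplitz_integrable.
  by exists 0%N => k /ltW; exact: G0.
have good1 i : laurent_transfer (toC A) (toC K) (toC (A ^+ i *m B)).
  elim: i => [|i IHi]; first by rewrite expr0 -[1]/(1%:M) mul1mx.
  by rewrite exprS -[A * _]/(A *m _) -mulmxA toCM; exact: laurent_transfer_shiftr.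
have good2 : laurent_transfer (toC A) (toC K) 1%:M.
  have /row_freeP[W] : row_free (\mxrow_(i < n) (A ^+ i *m B)) by rewrite /row_free cAB.
  rewrite -[W]submxcolK mul_mxrow_mxcol -toC1 => <-.
  rewrite toC_sum; apply: laurent_transfer_sumr => i; rewrite toCM.
  exact: laurent_transfer_mulr.
have good3 i : laurent_transfer (toC A) (toC (K *m A ^+ i)) 1%:M.
  elim: i => [|i IHi]; first by rewrite expr0 -[1]/(1%:M) mulmx1.
  by rewrite exprSr -[_ * A]/(_ *m A) mulmxA toCM; exact: laurent_transfer_shiftl.
have /row_fullP[W] : row_full (\mxcol_(i < n) (K *m A ^+ i)) by rewrite /row_full oAK.
rewrite -[W]submxrowK mul_mxrow_mxcol => WE; rewrite -[X in laurent_transfer _ X _]toC1 -WE.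
rewrite toC_sum; apply: laurent_transfer_suml => i; rewrite toCM.
exact: laurent_transfer_mull.
Qed.

End MinimalRealization.

(** * Square roots of positive semidefinite matrices *)

Section PositiveSquareRoot.
Context {R : realType}.
Notation C := R[i].

Lemma hermsym_adj {n : nat} (X : 'M[C]_n) : X \is hermsymmx <-> X ^t* = X.
Proof.
split; first by move/is_hermitianmxP; rewrite expr0 scale1r => <-.
by move=> XX; apply/is_hermitianmxP; rewrite expr0 scale1r XX.
Qed.

Lemma adjK {m n : nat} (X : 'M[C]_(m, n)) : (X ^t*) ^t* = X.
Proof. exact: trmxCK. Qed.

Lemma mul_conj_ge0 (x : C) : 0 <= x * (x^*)%C.
Proof. exact: mulcJ_ge0. Qed.

Lemma row_sqnorm_ge0 {n : nat} (u : 'rV[C]_n) : 0 <= (u *m u ^t*) 0 0.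
Proof. by rewrite mxE sumr_ge0// => i _; rewrite trCE mul_conj_ge0. Qed.

Lemma trace_mul_adj {m n : nat} (Q : 'M[C]_(m, n)) :
  \tr (Q *m Q ^t*) = \sum_i \sum_j Q i j * (Q i j)^*%C.
Proof.
by apply: eq_bigr => i _; rewrite mxE; apply: eq_bigr => j _; rewrite trCE.
Qed.

Lemma trace_mul_adj_ge0 {m n : nat} (Q : 'M[C]_(m, n)) : 0 <= \tr (Q *m Q ^t*).
Proof.
rewrite trace_mul_adj; apply: sumr_ge0 => i _; apply: sumr_ge0 => j _.
exact: mul_conj_ge0.
Qed.

Lemma trace_mul_adj_eq0 {m n : nat} (Q : 'M[C]_(m, n)) :
  \tr (Q *m Q ^t*) = 0 -> Q = 0.
Proof.
rewrite trace_mul_adj => /eqP.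
rewrite psumr_eq0; last by move=> i _; apply: sumr_ge0 => j _; exact: mul_conj_ge0.
move=> /allP Q0; apply/matrixP => i j; rewrite mxE.
have := Q0 i (mem_index_enum _); rewrite implyTb psumr_eq0; last first.
  by move=> l _; exact: mul_conj_ge0.
move=> /allP/(_ j (mem_index_enum _)); rewrite implyTb mulf_eq0.
by rewrite conjc_eq0 orbb => /eqP.
Qed.

Definition cdiag {n : nat} (d : 'I_n -> R) : 'M[C]_n := diag_mx (\row_i (d i)%:C).

Lemma cdiagM {n : nat} (d e : 'I_n -> R) :
  cdiag d *m cdiag e = cdiag (fun i => d i * e i).
Proof. by rewrite mulmx_diag; congr diag_mx; apply/rowP => i; rewrite !mxE rmorphM. Qed.

Lemma adj_cdiag {n : nat} (d : 'I_n -> R) : (cdiag d) ^t* = cdiag d.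
Proof.
apply/matrixP => i j; rewrite trCE !mxE eq_sym; case: eqP => [->|_].
  by rewrite !mulr1n conjc_real.
by rewrite !mulr0n conjc0.
Qed.

Definition conj_diag {n : nat} (P : 'M[C]_n) (d : 'I_n -> R) : 'M[C]_n :=
  P ^t* *m cdiag d *m P.

Lemma eq_conj_diag {n : nat} (P : 'M[C]_n) d e : (forall i, d i = e i) ->
  conj_diag P d = conj_diag P e.
Proof. by move=> /funext ->. Qed.

Lemma adj_conj_diag {n : nat} (P : 'M[C]_n) d : (conj_diag P d) ^t* = conj_diag P d.
Proof. by rewrite /conj_diag !adj_mul adjK adj_cdiag mulmxA. Qed.

Lemma conj_diagM {n : nat} (P : 'M[C]_n) d e : P *m P ^t* = 1%:M ->
  conj_diag P d *m conj_diag P e = conj_diag P (fun i => d i * e i).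
Proof.
rewrite /conj_diag -cdiagM; move: (P ^t*) (cdiag d) (cdiag e) => Q D E PQ.
by rewrite -!mulmxA; congr (_ *m (_ *m _)); rewrite !mulmxA PQ mul1mx.
Qed.

Lemma conj_diagD {n : nat} (P : 'M[C]_n) d e :
  conj_diag P d + conj_diag P e = conj_diag P (fun i => d i + e i).
Proof.
rewrite /conj_diag; have <- : cdiag d + cdiag e = cdiag (fun i => d i + e i).
  by rewrite /cdiag -linearD/=; congr diag_mx; apply/rowP => i; rewrite !mxE rmorphD.
by move: (P ^t*) (cdiag d) (cdiag e) => Q D E; rewrite mulmxDr mulmxDl.
Qed.

Lemma conj_diagZ {n : nat} (P : 'M[C]_n) d (a : R) :
  a%:C *: conj_diag P d = conj_diag P (fun i => a * d i).
Proof.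
rewrite /conj_diag; have <- : a%:C *: cdiag d = cdiag (fun i => a * d i).
  by rewrite /cdiag -linearZ/=; congr diag_mx; apply/rowP => i; rewrite !mxE rmorphM.
move: (P ^t*) (cdiag d) => Q D.
by rewrite -scalemxAr -scalemxAl.
Qed.

Lemma trace_conj_diag {n : nat} (P : 'M[C]_n) d : P *m P ^t* = 1%:M ->
  \tr (conj_diag P d) = (\sum_i d i)%:C.
Proof.
move=> PP; rewrite /conj_diag mxtrace_mulC mulmxA PP mul1mx mxtrace_diag rmorph_sum/=.
by apply: eq_bigr => i _; rewrite mxE.
Qed.

Lemma psd_conj_diag {n : nat} (P : 'M[C]_n) d : (forall i, 0 <= d i) ->
  psdmx (conj_diag P d).
Proof.
move=> d0; split; first by apply/hermsym_adj; exact: adj_conj_diag.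
move=> u; pose v := u *m P ^t*.
have -> : u *m conj_diag P d *m u ^t* = v *m cdiag d *m v ^t*.
  by rewrite /v adj_mul adjK /conj_diag !mulmxA.
rewrite mul_mx_diag mxE sumr_ge0// => i _; rewrite !mxE -mulrA mulrCA.
by rewrite mulr_ge0 ?ler0c// mul_conj_ge0.
Qed.

Lemma psd_spectral {n : nat} (X : 'M[C]_n) : psdmx X ->
  exists P d, [/\ P *m P ^t* = 1%:M, P ^t* *m P = 1%:M,
    (forall i, 0 <= d i) & X = conj_diag P d].
Proof.
move=> [hX pX]; set P := spectralmx X.
have uP : P \is unitarymx by exact: spectral_unitarymx.
have PP : P *m P ^t* = 1%:M by exact/unitarymxP.
have PP' : P ^t* *m P = 1%:M by rewrite -(invmx_unitary uP) mulVmx ?unitarymx_unit.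
have XE : X = P ^t* *m diag_mx (spectral_diag X) *m P.
  by rewrite -(invmx_unitary uP); exact/orthomx_spectralP/hermitian_normalmx.
have D0 i : 0 <= spectral_diag X 0 i.
  have DE : P *m X *m P ^t* = diag_mx (spectral_diag X).
    by rewrite [in LHS]XE !mulmxA PP mul1mx -mulmxA PP mulmx1.
  have := pX (row i P); rewrite -row_mul.
  have -> : (row i (P *m X) *m (row i P) ^t*) 0 0 = (P *m X *m P ^t*) i i.
    by rewrite !mxE; apply: eq_bigr => j _; rewrite trCE !mxE.
  by rewrite DE mxE eqxx mulr1n.
have sE : diag_mx (spectral_diag X) = cdiag (fun i => complex.Re (spectral_diag X 0 i)).
  by congr diag_mx; apply/rowP => i; rewrite mxE RRe_real// ger0_real.
rewrite sE in XE; exists P; exists (fun i => complex.Re (spectral_diag X 0 i)).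
split; [exact: PP|exact: PP'| |exact: XE].
by move=> i; rewrite -ler0c RRe_real ?ger0_real.
Qed.

Lemma psd_sqrt_exists {n : nat} (X : 'M[C]_n) : psdmx X ->
  exists Y, psdmx Y /\ Y *m Y = X.
Proof.
move=> /psd_spectral[P [d [PP PP' d0 ->]]].
exists (conj_diag P (fun i => Num.sqrt (d i))); split.
  by apply: psd_conj_diag => i; exact: sqrtr_ge0.
by rewrite conj_diagM//; apply: eq_conj_diag => i; rewrite -expr2 sqr_sqrtr.
Qed.

Lemma psd_adj {n : nat} (X : 'M[C]_n) : psdmx X -> X ^t* = X.
Proof. by case=> /hermsym_adj. Qed.

(** With [D = Y - Z] the traces of [D Y D] and [D Z D] are nonnegative and add
    up to that of [D (Y^2 - Z^2) = 0]; so both vanish, hence [Y D = Z D = 0]. *)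
Lemma psd_sqrt_unique {n : nat} (Y Z : 'M[C]_n) :
  psdmx Y -> psdmx Z -> Y *m Y = Z *m Z -> Y = Z.
Proof.
move=> pY pZ YZ; pose D := Y - Z.
have DD : D ^t* = D by rewrite /D adjB !psd_adj.
have [G [pG GY]] := psd_sqrt_exists pY; have [H [pH HZ]] := psd_sqrt_exists pZ.
have trG (A B : 'M[C]_n) : psdmx A -> A *m A = B ->
    \tr (D *m B *m D) = \tr ((D *m A) *m (D *m A) ^t*).
  by move=> pA <-; rewrite adj_mul (psd_adj pA) DD !mulmxA.
have s0 : \tr (D *m Y *m D) + \tr (D *m Z *m D) = 0.
  rewrite [X in _ + X = _]mxtrace_mulC -raddfD/= -mulmxA -mulmxDr.
  have -> : Y *m D + D *m Z = 0.
    by rewrite /D mulmxBr mulmxBl YZ addrA subrK subrr.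
  by rewrite mulmx0 raddf0.
rewrite (trG _ _ pG GY) (trG _ _ pH HZ) in s0.
have /eqP := s0; rewrite paddr_eq0 ?trace_mul_adj_ge0// => /andP[/eqP DG /eqP DH].
have DY : D *m Y = 0 by rewrite -GY mulmxA (trace_mul_adj_eq0 DG) mul0mx.
have DZ : D *m Z = 0 by rewrite -HZ mulmxA (trace_mul_adj_eq0 DH) mul0mx.
apply/subr0_eq; rewrite -/D; apply: trace_mul_adj_eq0.
by rewrite DD {2}/D mulmxBr DY DZ subrr raddf0.
Qed.

Lemma sqrtmx_unique {n : nat} (X Y : 'M[C]_n) : psdmx Y -> Y *m Y = X -> sqrtmx X = Y.
Proof.
move=> pY YX; apply: xget_unique => [//|Z [pZ ZX]].
by apply: psd_sqrt_unique; rewrite // ZX YX.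
Qed.

Lemma sqrtmxP {n : nat} (X : 'M[C]_n) : psdmx X ->
  psdmx (sqrtmx X) /\ sqrtmx X *m sqrtmx X = X.
Proof. by move=> /psd_sqrt_exists[Y [pY YX]]; rewrite (sqrtmx_unique pY YX). Qed.

Lemma psd1 {n : nat} : psdmx (1%:M : 'M[C]_n).
Proof.
split; first by apply/hermsym_adj; exact: adj1.
by move=> u; rewrite mulmx1 row_sqnorm_ge0.
Qed.

Lemma sqrtmx1 {n : nat} : sqrtmx (1%:M : 'M[C]_n) = 1%:M.
Proof. by apply: sqrtmx_unique; [exact: psd1|rewrite mulmx1]. Qed.

Lemma psdZ {n : nat} (c : R) (X : 'M[C]_n) : 0 <= c -> psdmx X -> psdmx (c%:C *: X).
Proof.
move=> c0 [/hermsym_adj hX pX]; split.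
  by apply/hermsym_adj/matrixP => i j; rewrite trCE !mxE rmorphM/= oppr0 -[in RHS]hX trCE.
by move=> u; rewrite -scalemxAr -scalemxAl mxE mulr_ge0// ler0c.
Qed.

(** A square root of [X] in the class of positive semidefinite matrices would
    make [X] itself positive semidefinite; so there is none. *)
Lemma sqrtmx_notpsd {n : nat} (X : 'M[C]_n) : ~ psdmx X -> sqrtmx X = 0.
Proof.
move=> nX; apply: xgetPN => Y [pY YX]; apply: nX.
rewrite -YX; split; first by apply/hermsym_adj; rewrite adj_mul !psd_adj.
move=> u; rewrite mulmxA -mulmxA -[Y *m u ^t*](_ : (u *m Y) ^t* = _).
  exact: row_sqnorm_ge0.
by rewrite adj_mul psd_adj.
Qed.

(** The junk value 0 is compatible with positive scaling. *)
Lemma sqrtmxZ {n : nat} (c : R) (X : 'M[C]_n) : 0 < c ->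
  sqrtmx ((c ^+ 2)%:C *: X) = c%:C *: sqrtmx X.
Proof.
move=> c0; have [pX|nX] := pselect (psdmx X).
  have [pS SX] := sqrtmxP pX; apply: sqrtmx_unique; first by apply: psdZ => //; exact: ltW.
  by rewrite -scalemxAl -scalemxAr scalerA SX rmorphXn.
rewrite (sqrtmx_notpsd nX) scaler0; apply: sqrtmx_notpsd => pcX; apply: nX.
rewrite -[X]scale1r; have -> : (1 : C) = ((c ^+ 2)^-1)%:C * (c ^+ 2)%:C.
  by rewrite -rmorphM mulVf ?rmorph1// sqrf_eq0 gt_eqF.
by rewrite -scalerA; apply: psdZ => //; rewrite invr_ge0 sqr_ge0.
Qed.

Lemma posdef_psd {n : nat} (X : 'M[C]_n) : posdefmx X -> psdmx X.
Proof.
move=> [hX pX]; split=> // u; have [->|u0] := eqVneq u 0; last exact/ltW/pX.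
by rewrite !mul0mx mxE.
Qed.

Lemma posdef_unit {n : nat} (X : 'M[C]_n) : posdefmx X -> X \in unitmx.
Proof.
move=> [_ pX]; rewrite -row_free_unit -kermx_eq0; apply/rowV0P => v /sub_kermxP vX.
apply/eqP; apply: contraT => /pX; by rewrite vX mul0mx mxE ltxx.
Qed.

Lemma posdef1D {n : nat} (X : 'M[C]_n) : psdmx X -> posdefmx (1%:M + X).
Proof.
move=> [/hermsym_adj hX pX]; split; first by apply/hermsym_adj; rewrite adjD adj1 hX.
move=> u u0; rewrite mulmxDr mulmx1 mulmxDl mxE ltr_wpDr ?pX//.
rewrite lt_def row_sqnorm_ge0 andbT; apply: contra u0 => /eqP uu.
apply/eqP/trace_mul_adj_eq0; rewrite -[RHS]uu.
by rewrite /mxtrace big_ord1.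
Qed.

Lemma posdefZ {n : nat} (c : R) (X : 'M[C]_n) : 0 < c -> posdefmx X -> posdefmx (c%:C *: X).
Proof.
move=> c0 [hX pX]; split.
  apply/hermsym_adj/matrixP => i j; rewrite trCE !mxE rmorphM/= oppr0.
  by move/hermsym_adj: hX => {2}<-; rewrite trCE.
by move=> u u0; rewrite -scalemxAr -scalemxAl mxE mulr_gt0 ?pX// ltr0C.
Qed.

Lemma sqrtmx_unit {n : nat} (X : 'M[C]_n) : posdefmx X -> sqrtmx X \in unitmx.
Proof.
move=> pX; have [_ SX] := sqrtmxP (posdef_psd pX).
have : sqrtmx X *m sqrtmx X \in unitmx by rewrite SX posdef_unit.
by rewrite unitmx_mul => /andP[].
Qed.

End PositiveSquareRoot.

(** * Noncommutative identities for resolvents *)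

Section PencilAlgebra.
Context {F : fieldType} {n m : nat}.
Implicit Types (A As P X Y Q : 'M[F]_n) (B : 'M[F]_(n, m)) (K : 'M[F]_(m, n)).

(** Up to the factors [Y] and [X] this is the identity
    [Q - A1 Q A2 = U Q V + A1 Q V + U Q A2] for [U = zb - A1] and [V = z - A2]. *)
Lemma pencil_product A1 A2 Q X Y (z zb : F) : zb * z = 1 ->
  Y *m (zb%:M - A1) = 1%:M -> (z%:M - A2) *m X = 1%:M ->
  Y *m (Q - A1 *m Q *m A2) *m X = Q + Y *m A1 *m Q + Q *m A2 *m X.
Proof.
move=> zz YU VX.
have -> : Q - A1 *m Q *m A2 = (zb%:M - A1) *m Q *m (z%:M - A2) +
    A1 *m Q *m (z%:M - A2) + (zb%:M - A1) *m Q *m A2.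
  rewrite -mulmxDl -mulmxDl subrK mul_scalar_mx mulmxBr mul_mx_scalar scalerA.
  rewrite [z * zb]mulrC zz scale1r mulmxBl mulmxBl mul_scalar_mx.
  by rewrite addrA subrK.
move: (zb%:M - A1) (z%:M - A2) YU VX => U V YU VX.
rewrite !(mulmxDl, mulmxDr) !mulmxA YU !mul1mx.
by rewrite -!mulmxA VX !mulmx1.
Qed.

(** The pencil identity for [P] and the open loop Riccati equation express
    [Bs Y CC X B] through the other terms of the expanded product. *)
Lemma riccati_factorization A As P CC X Y B (Bs : 'M[F]_(m, n)) K (Ks : 'M[F]_(n, m))
    (Q : 'M[F]_m) (z zb : F) : zb * z = 1 ->
  Y *m (zb%:M - As) = 1%:M -> (z%:M - A) *m X = 1%:M ->
  P - As *m P *m A = CC - Ks *m Q *m K ->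
  Q *m K = Bs *m P *m A -> Ks *m Q = As *m P *m B -> Q = 1%:M + Bs *m P *m B ->
  (1%:M + Bs *m Y *m Ks) *m Q *m (1%:M + K *m X *m B) =
  1%:M + Bs *m Y *m CC *m X *m B.
Proof.
move=> zz YU VX ric QK KQ QE; have := pencil_product P zz YU VX.
rewrite ric => PE.
have E : Bs *m Y *m CC *m X *m B - Bs *m Y *m Ks *m Q *m K *m X *m B =
    Bs *m P *m B + Bs *m Y *m As *m P *m B + Bs *m P *m A *m X *m B.
  have := congr1 (fun M => Bs *m M *m B) PE.
  by rewrite /= !(mulmxDl, mulmxDr, mulmxN, mulNmx) !mulmxA.
rewrite [_ *m Q]mulmxDl mul1mx [LHS]mulmxDr mulmx1 mulmxDl.
have -> : Q *m (K *m X *m B) = Bs *m P *m A *m X *m B by rewrite !mulmxA QK.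
have -> : Bs *m Y *m Ks *m Q *m (K *m X *m B) = Bs *m Y *m Ks *m Q *m K *m X *m B.
  by rewrite !mulmxA.
move: (Bs *m Y *m Ks *m Q *m K *m X *m B) E => T E.
have -> : Bs *m Y *m Ks *m Q = Bs *m Y *m As *m P *m B.
  by rewrite -[LHS]mulmxA KQ !mulmxA.
move/eqP: E; rewrite subr_eq => /eqP ->; rewrite QE.
by rewrite !addrA.
Qed.

(** If [X - X_k = X B K X_k], as for the resolvents of [A] and [A - B K], then
    [1 - K X_k B] inverts [1 + K X B]. *)
Lemma feedback_resolvent A Ak X Xk B K (z : F) :
  Ak = A - B *m K -> X *m (z%:M - A) = 1%:M -> (z%:M - Ak) *m Xk = 1%:M ->
  X *m B *m K *m Xk = X - Xk.
Proof.
move=> AkE XU UXk.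
have -> : X *m B *m K = X *m (z%:M - Ak) - 1%:M.
  rewrite -XU -mulmxBr -mulmxA; congr (_ *m _).
  by rewrite AkE !opprB addrC addrA subrK addrC subrK.
by rewrite mulmxBl mul1mx -mulmxA UXk mulmx1.
Qed.

Lemma feedback_inverse X Xk B K : X *m B *m K *m Xk = X - Xk ->
  (1%:M + K *m X *m B) *m (1%:M - K *m Xk *m B) = 1%:M.
Proof.
move=> E; rewrite mulmxBr mulmx1 mulmxDl mul1mx.
have -> : K *m X *m B *m (K *m Xk *m B) = K *m X *m B - K *m Xk *m B.
  by rewrite -mulmxBl -mulmxBr -E !mulmxA.
by rewrite [X in _ - X]addrC subrK addrK.
Qed.

Lemma feedback_output X Xk B K : X *m B *m K *m Xk = X - Xk ->
  X *m B *m (1%:M - K *m Xk *m B) = Xk *m B.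
Proof.
move=> E; rewrite mulmxBr mulmx1 !mulmxA.
have -> : X *m B *m K *m Xk *m B = X *m B - Xk *m B by rewrite E mulmxBl.
by rewrite opprB addrC subrK.
Qed.

End PencilAlgebra.

(** * The Riccati equation *)

Section RiccatiAlgebra.
Context {R : realType} {n m p s : nat}.
Notation C := R[i].
Context (A : 'M[R]_n) (Bu : 'M[R]_(n, m)) (Bw : 'M[R]_(n, s)) (Cs : 'M[R]_(p, n)) (P : 'M[R]_n).
Context (ric : stabilizing_riccati A Bu Cs P).
Context (sA : cschur (toC A)).

Notation Ac := (toC A).
Notation Bc := (toC Bu).
Notation Pc := (toC P).
Notation Cc := (toC Cs).
Notation Rc := (toC (Rlqr Bu P)).
Notation Kc := (toC (Klqr A Bu P)).
Notation Akc := (toC (Ak A Bu P)).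
Notation S := (sqrtmx Rc).

Lemma riccati_solution_adj : Pc ^t* = Pc.
Proof. by case: ric => /posdef_psd/psd_adj. Qed.

Lemma toC_RlqrE : Rc = 1%:M + Bc ^t* *m Pc *m Bc.
Proof. by rewrite adj_toC -!toCM -toC1; exact: map_mxD. Qed.

Lemma Rlqr_posdef : posdefmx Rc.
Proof.
rewrite toC_RlqrE; apply: posdef1D.
have [/posdef_psd [_ pP] _ _] := ric; split.
  by apply/hermsym_adj; rewrite !adj_mul adjK riccati_solution_adj mulmxA.
move=> u; have := pP (u *m Bc ^t*).
by rewrite adj_mul adjK !mulmxA.
Qed.

Lemma Rlqr_unit : Rc \in unitmx. Proof. exact/posdef_unit/Rlqr_posdef. Qed.

Lemma Rlqr_adj : Rc ^t* = Rc. Proof. exact/psd_adj/posdef_psd/Rlqr_posdef. Qed.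

Lemma sqrt_Rlqr_unit : S \in unitmx. Proof. exact/sqrtmx_unit/Rlqr_posdef. Qed.

Lemma sqrt_Rlqr_adj : S ^t* = S.
Proof. by have [/psd_adj] := sqrtmxP (posdef_psd Rlqr_posdef). Qed.

Lemma sqrt_Rlqr_sqr : S *m S = Rc.
Proof. by have [_] := sqrtmxP (posdef_psd Rlqr_posdef). Qed.

Lemma mulmx_sqrt_RlqrK {q : nat} (U : 'M[C]_(q, m)) : U *m S *m S = U *m Rc.
Proof. by rewrite -mulmxA sqrt_Rlqr_sqr. Qed.

Lemma ss_transferE {q : nat} (B : 'M[R]_(n, q)) (z : C) :
  ss_transfer Cs A B z = Cc *m resolvent Ac z *m toC B.
Proof. by []. Qed.

Lemma toC_KlqrE : Kc = invmx Rc *m Bc ^t* *m Pc *m Ac.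
Proof.
have invE : toC (invmx (Rlqr Bu P)) = invmx Rc by exact: map_invmx.
by rewrite -invE adj_toC -!toCM.
Qed.

Lemma Rlqr_Klqr : Rc *m Kc = Bc ^t* *m Pc *m Ac.
Proof.
rewrite toC_KlqrE; move: Rlqr_unit; move: (Rc) (Bc ^t*) (Pc) (Ac) => R0 B0 P0 A0 u.
by rewrite !mulmxA (mulmxV u) mul1mx.
Qed.

Lemma Klqr_Rlqr : Kc ^t* *m Rc = Ac ^t* *m Pc *m Bc.
Proof.
by rewrite -[in LHS]Rlqr_adj -adj_mul Rlqr_Klqr !adj_mul riccati_solution_adj adjK mulmxA.
Qed.

Lemma toC_AkE : Akc = Ac - Bc *m Kc.
Proof. by rewrite -toCM; exact: map_mxB. Qed.

Lemma riccati_complex : Pc = Cc ^t* *m Cc + Ac ^t* *m Pc *m Ac -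
    Ac ^t* *m Pc *m Bc *m invmx Rc *m Bc ^t* *m Pc *m Ac.
Proof.
have invE : toC (invmx (Rlqr Bu P)) = invmx Rc by exact: map_invmx.
have [_ PE _] := ric.
rewrite -invE !adj_toC -!toCM -[toC _ + _](map_mxD (real_complex R)).
rewrite -[_ - _](map_mxB (real_complex R)); exact: (congr1 toC PE).
Qed.

Lemma riccati_closed_loop : Pc - Akc ^t* *m Pc *m Ac = Cc ^t* *m Cc.
Proof.
have KE : Kc ^t* *m Bc ^t* *m Pc *m Ac =
    Ac ^t* *m Pc *m Bc *m invmx Rc *m Bc ^t* *m Pc *m Ac.
  rewrite -Klqr_Rlqr; move: Rlqr_unit; move: (Rc) (Kc ^t*) (Bc ^t*) (Pc) (Ac) => R0 K0 B0 P0 A0 u.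
  by rewrite -[K0 *m R0 *m _]mulmxA (mulmxV u) mulmx1.
have PE := riccati_complex; rewrite -KE in PE.
rewrite toC_AkE adjB adj_mul !mulmxBl.
by apply/eqP; rewrite subr_eq addrA; apply/eqP.
Qed.

Lemma riccati_open_loop :
  Pc - Ac ^t* *m Pc *m Ac = Cc ^t* *m Cc - Kc ^t* *m Rc *m Kc.
Proof.
have -> : Kc ^t* *m Rc *m Kc = Kc ^t* *m Bc ^t* *m Pc *m Ac.
  by rewrite -[LHS]mulmxA Rlqr_Klqr !mulmxA.
rewrite -riccati_closed_loop toC_AkE adjB adj_mul !mulmxBl.
by rewrite opprB addrCA [RHS]addrC addKr.
Qed.

(** The state feedback form of the canonical spectral factor of [I + F^* F]. *)
Definition spectral_factor : transfer R m m :=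
  fun z => S *m (1%:M + Kc *m resolvent Ac z *m Bc).

Definition spectral_factor_inv : transfer R m m :=
  fun z => (1%:M - Kc *m resolvent Akc z *m Bc) *m invmx S.

Lemma cschur_Ak : cschur Akc. Proof. by case: ric. Qed.

Lemma resolvent_mulV {q : nat} (M : 'M[C]_q) (w : R) : cschur M ->
  resolvent M (expj w) *m ((expj w)%:M - M) = 1%:M.
Proof. by move=> sM; apply: mulVmx; exact: resolvent_unit. Qed.

Lemma resolvent_mulmxV {q : nat} (M : 'M[C]_q) (w : R) : cschur M ->
  ((expj w)%:M - M) *m resolvent M (expj w) = 1%:M.
Proof. by move=> sM; apply: mulmxV; exact: resolvent_unit. Qed.

Lemma adj_resolvent_mulV {q : nat} (M : 'M[C]_q) (w : R) : cschur M ->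
  (resolvent M (expj w)) ^t* *m (((expj w)^*)%C%:M - M ^t*) = 1%:M.
Proof.
by move=> sM; rewrite -adj_scalar -adjB -adj_mul resolvent_mulmxV// adj1.
Qed.

Lemma conj_expj_mul (w : R) : ((expj w)^*)%C * expj w = 1.
Proof. by rewrite -expjV mulVf// expj_neq0. Qed.

Lemma feedback_resolvents (w : R) :
  resolvent Ac (expj w) *m Bc *m Kc *m resolvent Akc (expj w) =
  resolvent Ac (expj w) - resolvent Akc (expj w).
Proof.
exact: (feedback_resolvent toC_AkE (resolvent_mulV w sA) (resolvent_mulmxV w cschur_Ak)).
Qed.

Lemma spectral_factorK (w : R) :
  spectral_factor (expj w) *m spectral_factor_inv (expj w) = 1%:M.
Proof.
have := feedback_inverse (feedback_resolvents w); rewrite /spectral_factor /spectral_factor_inv.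
move: (1%:M + _) (1%:M - _) sqrt_Rlqr_unit => U V uS UV.
by rewrite mulmxA -[S *m U *m V]mulmxA UV mulmx1 (mulmxV uS).
Qed.

Lemma adj_spectral_factor (w : R) : (spectral_factor (expj w)) ^t* =
  (1%:M + Bc ^t* *m (resolvent Ac (expj w)) ^t* *m Kc ^t*) *m S.
Proof. by rewrite /spectral_factor adj_mul sqrt_Rlqr_adj adjD adj1 !adj_mul mulmxA. Qed.

Lemma spectral_factorP (w : R) :
  (spectral_factor (expj w)) ^t* *m spectral_factor (expj w) =
  IFF (ss_transfer Cs A Bu) (expj w).
Proof.
have := riccati_factorization (conj_expj_mul w) (adj_resolvent_mulV w sA)
  (resolvent_mulmxV w sA) riccati_open_loop Rlqr_Klqr Klqr_Rlqr toC_RlqrE.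
have FE : IFF (ss_transfer Cs A Bu) (expj w) =
    1%:M + Bc ^t* *m (resolvent Ac (expj w)) ^t* *m (Cc ^t* *m Cc) *m
    resolvent Ac (expj w) *m Bc.
  by rewrite /IFF ss_transferE; move: (resolvent _ _) => X; rewrite !adj_mul !mulmxA.
rewrite FE => <-; rewrite adj_spectral_factor /spectral_factor -mulmx_sqrt_RlqrK.
by rewrite !mulmxA.
Qed.

(** The anticausal factor cancels the poles of [F^*] down to the resolvent of
    [A_k^*], and the closed loop Riccati equation then splits the product. *)
Lemma anticausal_splitting (w : R) :
  - ((spectral_factor_inv (expj w)) ^t* *m (ss_transfer Cs A Bu (expj w)) ^t* *m
     ss_transfer Cs A Bw (expj w)) =
  T_formula A Bu Bw P (expj w) + Cbar Bu P *m Pc *m toC Bw +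
  Cbar Bu P *m Pc *m Ac *m resolvent Ac (expj w) *m toC Bw.
Proof.
have FD : ss_transfer Cs A Bu (expj w) *m spectral_factor_inv (expj w) =
    Cc *m resolvent Akc (expj w) *m Bc *m invmx S.
  rewrite ss_transferE /spectral_factor_inv; have := feedback_output (feedback_resolvents w).
  move: (resolvent Ac _) (resolvent Akc _) => X Xk.
  move: (1%:M - Kc *m Xk *m Bc) => V FO.
  by rewrite mulmxA -[Cc *m X *m Bc]mulmxA -[Cc *m _ *m V]mulmxA FO !mulmxA.
rewrite -adj_mul FD.
have PE := pencil_product Pc (conj_expj_mul w) (adj_resolvent_mulV w cschur_Ak)
  (resolvent_mulmxV w sA).
rewrite riccati_closed_loop in PE.
have -> : (Cc *m resolvent Akc (expj w) *m Bc *m invmx S) ^t* *m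
    ss_transfer Cs A Bw (expj w) =
    ((invmx S) ^t* *m Bc ^t*) *m ((resolvent Akc (expj w)) ^t* *m (Cc ^t* *m Cc) *m
      resolvent Ac (expj w)) *m toC Bw.
  by rewrite ss_transferE; move: (resolvent Ac _) => X; rewrite !adj_mul !mulmxA.
have CE : - ((invmx S) ^t* *m Bc ^t*) = Cbar Bu P by [].
rewrite PE -mulNmx -mulNmx CE /T_formula /Abar /Bbar -adj_resolvent.
move: (Cbar _ _) (resolvent _ _) (resolvent _ _ ^t*) (Akc ^t*) => C0 X Y A0.
rewrite !mulmxA; move: (toC P) (toC A) (toC Bw) => P0 A1 B0.
by rewrite mulmxDr mulmxDr mulmxDl mulmxDl !mulmxA [in LHS](addrC (C0 *m P0 *m B0)).
Qed.

End RiccatiAlgebra.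

(** * Canonical spectral factor and anticausal part *)

Section CanonicalFactor.
Context {R : realType} {n m p s : nat}.
Notation C := R[i].
Context (A : 'M[R]_n) (Bu : 'M[R]_(n, m)) (Bw : 'M[R]_(n, s)) (Cs : 'M[R]_(p, n)) (P : 'M[R]_n).
Context (ric : stabilizing_riccati A Bu Cs P).
Context (sA : cschur (toC A)).

Notation F := (ss_transfer Cs A Bu).
Notation G := (ss_transfer Cs A Bw).
Notation S := (sqrtmx (toC (Rlqr Bu P))).
Notation D0 := (spectral_factor A Bu P).
Notation D0inv := (spectral_factor_inv A Bu P).

Lemma mx_bounded_ss {a b : nat} (K : 'M[C]_(a, n)) (A0 : 'M[C]_n) (B : 'M[C]_(n, b)) :
  cschur A0 -> mx_bounded (fun z => K *m resolvent A0 z *m B).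
Proof.
move=> sA0; apply: mx_boundedM; last exact: mx_bounded_cst.
by apply: mx_boundedM; [exact: mx_bounded_cst|exact: mx_bounded_resolvent].
Qed.

Lemma block_ss {a b : nat} (K : 'M[C]_(a, n)) (A0 : 'M[C]_n) (B : 'M[C]_(n, b)) (k : int) :
  cschur A0 -> k <= 0 -> block (fun z => K *m resolvent A0 z *m B) k = 0.
Proof.
move=> sA0 k0; have iX := mx_bounded_integrable (mx_bounded_resolvent sA0).
rewrite block_mulr; last by apply: mx_integrable_mull => //; exact: mx_bounded_cst.
by rewrite block_mull// block_resolvent// mulmx0 mul0mx.
Qed.

Lemma spectral_factorE : D0 = fun z => S + (S *m toC (Klqr A Bu P)) *m resolvent (toC A) z *m toC Bu.
Proof. by apply/funext => z; rewrite /spectral_factor mulmxDr mulmx1 !mulmxA. Qed.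

Lemma mx_bounded_spectral_factor : mx_bounded D0.
Proof.
rewrite spectral_factorE; apply: mx_boundedD; first exact: mx_bounded_cst.
exact: mx_bounded_ss.
Qed.

Lemma block0_spectral_factor : block D0 0 = S.
Proof.
rewrite spectral_factorE blockD; first by rewrite block_cst eqxx block_ss ?addr0.
  exact: mx_integrable_cst.
exact/mx_bounded_integrable/mx_bounded_ss.
Qed.

Lemma mx_bounded_spectral_factor_inv : mx_bounded D0inv.
Proof.
apply: mx_boundedM; last exact: mx_bounded_cst.
have bX := mx_bounded_ss (- toC (Klqr A Bu P)) (toC Bu) (cschur_Ak ric).
apply: eq_mx_bounded (mx_boundedD (mx_bounded_cst 1%:M) bX) => w.
by rewrite !mulNmx.
Qed.

Lemma spectral_factor_unit (w : R) : D0 (expj w) \in unitmx.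
Proof. by have /mulmx1_unit[] := spectral_factorK ric sA w. Qed.

Lemma spectral_factor_invE (w : R) : D0inv (expj w) = invmx (D0 (expj w)).
Proof.
have u := spectral_factor_unit w.
by rewrite -[LHS](mulKmx u) (spectral_factorK ric sA) mulmx1.
Qed.

(** If [Delta] is another canonical factor, then [U = Delta D0^-1] is unitary on
    the circle, and both [U] and [U^* = D0 Delta^-1] are causal. Hence [U] is a
    constant, which the normalization of the constant block forces to be 1. *)
Lemma canonical_factor_unique (Delta : transfer R m m) :
  canonical_left_factor (IFF F) Delta -> teq Delta D0.
Proof.
move=> [DF [tD D0c] [tDi Dic] pD].
have iD := toeplitz_integrable tD; have iDi := toeplitz_integrable tDi.
pose U z := Delta z *m D0inv z; pose W z := D0 z *m inv_op Delta z.
have iU : mx_integrable U by exact: mx_integrable_mulr mx_bounded_spectral_factor_inv.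
have DD : ae_circle (fun z => (Delta z) ^t* *m Delta z = (D0 z) ^t* *m D0 z).
  by apply: ae_circleS DF => w; rewrite (spectral_factorP ric sA).
have uD : ae_circle (fun z => Delta z \in unitmx).
  apply: ae_circleS DD => w E.
  have : (Delta (expj w)) ^t* *m Delta (expj w) \in unitmx.
    rewrite E unitmx_mul spectral_factor_unit andbT.
    by rewrite map_unitmx unitmx_tr spectral_factor_unit.
  by rewrite unitmx_mul => /andP[].
have UU : ae_circle (fun z => (U z) ^t* *m U z = 1%:M).
  apply: ae_circleS DD => w E.
  have K := spectral_factorK ric sA w; rewrite /U adj_mul.
  move: (Delta _) (D0 _) (D0inv _) E K => De D Di E K.
  rewrite mulmxA -[Di ^t* *m _ *m De]mulmxA E mulmxA -adj_mul K adj1 mul1mx.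
  exact: K.
have WU : ae_circle (fun z => W z = (U z) ^t*).
  apply: ae_circleS2 uD UU => w u UUw.
  have WUw : W (expj w) *m U (expj w) = 1%:M.
    rewrite /W /U /inv_op; have := spectral_factorK ric sA w; move: u.
    move: (Delta _) (D0 _) (D0inv _) => De D Di u K.
    by rewrite mulmxA -[D *m _ *m De]mulmxA (mulVmx u) mulmx1.
  have uU : U (expj w) \in unitmx by have /mulmx1_unit[] := WUw.
  by rewrite -[LHS](mulmxK uU) WUw -UUw (mulmxK uU).
have U0 (k : int) : k < 0 -> block U k = 0.
  move=> k0; have iX := mx_integrable_mulr iD (mx_bounded_cst (toC (Klqr A Bu P))).
  have X0 := resolvent_mulr_causal (cschur_Ak ric) iX.
  pose Y z := Delta z *m toC (Klqr A Bu P) *m resolvent (toC (Ak A Bu P)) z.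
  have iY : mx_integrable Y := mx_integrable_mulr iX (mx_bounded_resolvent (cschur_Ak ric)).
  have Y0 : block Y k = 0.
    by apply: X0 (ltW k0) => j j0; rewrite block_mulr// D0c// mul0mx.
  transitivity (block (fun z => (Delta z - Y z *m toC Bu) *m invmx S) k).
    apply: eq_block => w; rewrite /U /spectral_factor_inv mulmxA mulmxBr mulmx1.
    by rewrite !mulmxA.
  have iYB : mx_integrable (fun z => Y z *m toC Bu).
    exact: mx_integrable_mulr iY (mx_bounded_cst _).
  rewrite block_mulr; last exact: mx_integrableD (mx_integrableN _).
  by rewrite blockB// block_mulr// Y0 D0c// mul0mx subrr mul0mx.
have W0 (k : int) : k < 0 -> block W k = 0.
  move=> k0; have iX := mx_integrable_mull (mx_bounded_cst (toC Bu)) iDi.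
  pose Y z := resolvent (toC A) z *m (toC Bu *m inv_op Delta z).
  have iY : mx_integrable Y := mx_integrable_mull (mx_bounded_resolvent sA) iX.
  have Y0 : block Y k = 0.
    by apply: (resolvent_mull_causal sA iX) (ltW k0) => j j0; rewrite block_mull// Dic// mulmx0.
  transitivity (block (fun z => S *m inv_op Delta z + (S *m toC (Klqr A Bu P)) *m Y z) k).
    by apply: eq_block => w; rewrite /W spectral_factorE mulmxDl /Y !mulmxA.
  rewrite blockD; first by rewrite !block_mull// Y0 Dic// !mulmx0 addr0.
    exact: mx_integrable_mull (mx_bounded_cst _) iDi.
  exact: mx_integrable_mull (mx_bounded_cst _) iY.
have Ucst : teq U (fun=> block U 0).
  apply: block_inj; [exact: iU|exact: mx_integrable_cst|].
  move=> k; rewrite block_cst; have [->|k0] := eqVneq k 0; first by [].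
  have [kn|kp] := ltP k 0; first exact: U0.
  have kn : - k < 0 by rewrite oppr_lt0 lt_def k0.
  have := W0 _ kn; rewrite (block_ae _ WU) -/(adj_op U) block_adj// opprK => E.
  by rewrite -[LHS]adjK E adj0.
pose V := block U 0.
have DV : ae_circle (fun z => Delta z = V *m D0 z).
  apply: ae_circleS Ucst => w E; rewrite /V -E /U spectral_factor_invE.
  by rewrite mulmxKV// spectral_factor_unit.
have VV : V ^t* *m V = 1%:M.
  have /ae_circle_ex[w [Uw E]] := ae_circle_and Ucst UU.
  by rewrite /V -Uw; exact: E.
have QV : block Delta 0 = V *m S.
  rewrite (block_ae 0 DV) block_mull ?block0_spectral_factor//.
  exact/mx_bounded_integrable/mx_bounded_spectral_factor.
have pQ := posdef_psd pD.
have QQ : block Delta 0 *m block Delta 0 = toC (Rlqr Bu P).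
  rewrite -{1}(psd_adj pQ) QV adj_mul (sqrt_Rlqr_adj ric) mulmxA -[S *m _ *m V]mulmxA VV mulmx1.
  exact: sqrt_Rlqr_sqr ric.
have V1 : V = 1%:M.
  have SQ := sqrtmx_unique pQ QQ; rewrite SQ in QV *.
  have uQ : block Delta 0 \in unitmx by exact: posdef_unit.
  by rewrite -[V](mulmxK uQ) -QV mulmxV.
by apply: ae_circleS DV => w ->; rewrite V1 mul1mx.
Qed.

Lemma T_formulaE (z : C) : T_formula A Bu Bw P z =
  Cbar Bu P *m invmx ((z^-1)%:M - Abar A Bu P) *m Bbar A Bu Bw P.
Proof. by []. Qed.

(** On the circle this is [(z^-1 - Abar)^-1], in a form that inherits the bounds
    and the blocks of the resolvent of [A_k]. *)
Definition anticausal_resolvent : transfer R n n :=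
  adj_op (resolvent (toC (Ak A Bu P))).

Lemma anticausal_resolventE (w : R) :
  invmx ((expj w)^-1%:M - Abar A Bu P) = anticausal_resolvent (expj w).
Proof. by rewrite /anticausal_resolvent /adj_op adj_resolvent. Qed.

Lemma mx_bounded_anticausal_resolvent : mx_bounded anticausal_resolvent.
Proof. exact/mx_bounded_adj/mx_bounded_resolvent/(cschur_Ak ric). Qed.

Lemma block_anticausal_resolvent (k : int) : 0 <= k -> block anticausal_resolvent k = 0.
Proof.
move=> k0; have sAk := cschur_Ak ric.
rewrite block_adj; last exact/mx_bounded_integrable/mx_bounded_resolvent.
have k0' : - k <= 0 by rewrite oppr_le0.
by rewrite (block_resolvent sAk k0') adj0.
Qed.

Lemma mx_integrable_T_formula : mx_integrable (T_formula A Bu Bw P).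
Proof.
apply: (@eq_mx_integrable _ _ _
  (fun z => Cbar Bu P *m anticausal_resolvent z *m Bbar A Bu Bw P)).
  by move=> w; rewrite T_formulaE anticausal_resolventE.
apply/mx_bounded_integrable/mx_boundedM; last exact: mx_bounded_cst.
by apply: mx_boundedM; [exact: mx_bounded_cst|exact: mx_bounded_anticausal_resolvent].
Qed.

(** The rest of the splitting is a constant plus a multiple of [(z - A)^-1], so it
    has no anticausal block, and the formula for [T] has no causal one. *)
Theorem anticausal_part_T (Delta : transfer R m m) (T : transfer R m s) :
  canonical_left_factor (IFF F) Delta ->
  anticausal_part (mul_op Delta (K_nc F G)) T -> teq T (T_formula A Bu Bw P).
Proof.
move=> cD [tT blockT]; have DE := canonical_factor_unique cD.
have iX := mx_bounded_integrable (mx_bounded_resolvent sA).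
pose rest z : 'M[C]_(m, s) := Cbar Bu P *m toC P *m toC Bw +
  (Cbar Bu P *m toC P *m toC A) *m resolvent (toC A) z *m toC Bw.
have irest : mx_integrable rest.
  apply: mx_integrableD; first exact: mx_integrable_cst.
  exact/mx_bounded_integrable/mx_bounded_ss.
have DK : teq (mul_op Delta (K_nc F G)) (fun z => T_formula A Bu Bw P z + rest z).
  apply: ae_circleS DE => w E; rewrite /mul_op E /K_nc.
  have := anticausal_splitting Bw ric sA w; rewrite -addrA => <-.
  rewrite -(spectral_factorP ric sA) spectral_factor_invE.
  move: (D0 _) (F _) (G _) (spectral_factor_unit w) => D F0 G0 u.
  have uD : D ^t* \in unitmx by rewrite map_unitmx unitmx_tr.
  have iE : invmx (D ^t* *m D) = invmx D *m invmx (D ^t*).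
    have uDD : D ^t* *m D \in unitmx by rewrite unitmx_mul uD.
    apply: (can_inj (mulKmx uDD)); rewrite (mulmxV uDD) mulmxA -[_ *m D *m _]mulmxA.
    by rewrite (mulmxV u) mulmx1 (mulmxV uD).
  by rewrite iE mulmxN !mulmxA (mulmxV u) mul1mx conjmx_inv.
apply: block_inj; [exact: toeplitz_integrable|exact: mx_integrable_T_formula|].
move=> k; rewrite blockT (block_ae _ DK); case: ifPn => [k0|].
  rewrite blockD//; last exact: mx_integrable_T_formula.
  rewrite /rest blockD; last first.
  - exact/mx_bounded_integrable/mx_bounded_ss.
  - exact: mx_integrable_cst.
  by rewrite block_cst lt_eqF// block_ss ?(ltW k0)// !addr0.
rewrite -leNgt => k0; apply/esym.
transitivity (block (fun z => Cbar Bu P *m anticausal_resolvent z *m Bbar A Bu Bw P) k).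
  by apply: eq_block => w; rewrite T_formulaE anticausal_resolventE.
have iY := mx_bounded_integrable mx_bounded_anticausal_resolvent.
rewrite block_mulr; last by apply: mx_integrable_mull => //; exact: mx_bounded_cst.
by rewrite block_mull// block_anticausal_resolvent// mulmx0 mul0mx.
Qed.

End CanonicalFactor.

(** * The finite-dimensional parameter *)

Section FiniteParameter.
Context {R : realType} {n m s p : nat}.
Notation C := R[i].
Context (A : 'M[R]_n) (Bu : 'M[R]_(n, m)) (Bw : 'M[R]_(n, s)) (Cs : 'M[R]_(p, n)) (P : 'M[R]_n).
Context (ric : stabilizing_riccati A Bu Cs P).

Notation Ab := (Abar A Bu P).
Notation Bb := (Bbar A Bu Bw P).
Notation Cb := (Cbar Bu P).
Notation X := (anticausal_resolvent A Bu P).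

Lemma block_reverse_pencil {q : nat} (E V : transfer R n q) (k : int) :
  mx_integrable E -> teq (fun z => ((z^-1)%:M - Ab) *m E z) V ->
  block E (k - 1) = Ab *m block E k + block V k.
Proof.
move=> iE EV; have iz := mx_integrable_expz (-1) iE.
have iAE := mx_integrable_mull (mx_bounded_cst Ab) iE.
have VE : block V k = block (fun z => z ^ (-1) *: E z - Ab *m E z) k.
  rewrite -(block_ae k EV); apply: eq_block => w.
  by rewrite mulmxBl mul_scalar_mx.
by rewrite VE blockB// block_expz block_mull// [RHS]addrC subrK.
Qed.

Lemma AbarE : Ab = toC (Ak A Bu P)^T.
Proof. by rewrite /Abar adj_toC. Qed.

Lemma cschur_Abar : cschur Ab.
Proof.
rewrite AbarE; have -> : toC (Ak A Bu P)^T = (toC (Ak A Bu P))^T by apply/matrixP => i j; rewrite !mxE.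
exact/cschur_tr/(cschur_Ak ric).
Qed.

Lemma BbarE : Bb = toC ((Ak A Bu P)^T *m P *m Bw).
Proof. by rewrite !toCM -adj_toC. Qed.

Definition mxconj {a b : nat} (M : 'M[C]_(a, b)) : 'M[C]_(a, b) := map_mx (@conjc R) M.

Lemma mxconj_toC {a b : nat} (M : 'M[R]_(a, b)) : mxconj (toC M) = toC M.
Proof. by apply/matrixP => i j; rewrite !mxE conjc_real. Qed.

Lemma mxconj_real {a b : nat} (M : 'M[C]_(a, b)) : M \is a realmx -> mxconj M = M.
Proof. exact: realmxC. Qed.

Lemma mxconj_fixed {a b : nat} (M : 'M[C]_(a, b)) : mxconj M = M ->
  toC (map_mx (@complex.Re R) M) = M.
Proof.
move=> /matrixP cM; apply/matrixP => i j; rewrite !mxE.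
have := cM i j; rewrite mxE; case: (M i j) => x y /= [/eqP].
by rewrite eq_sym -subr_eq0 opprK -mulr2n mulrn_eq0/= => /eqP ->.
Qed.

Context (T TLm : transfer R m s) (L : transfer R s s).
Context (TE : teq T (T_formula A Bu Bw P)) (cL : causal L).
Context (TLmE : anticausal_part (mul_op T L) TLm).

Let iL : mx_integrable L. Proof. by case: cL => /toeplitz_integrable. Qed.
Let iX : mx_integrable X.
Proof. exact/mx_bounded_integrable/(mx_bounded_anticausal_resolvent ric). Qed.
Let iBL : mx_integrable (fun z => Bb *m L z).
Proof. exact: mx_integrable_mull (mx_bounded_cst _) iL. Qed.

Definition filtered_factor : transfer R n s := fun z => X z *m (Bb *m L z).
Notation Y := filtered_factor.

Lemma mx_integrable_filtered_factor : mx_integrable Y.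
Proof. exact: mx_integrable_mull (mx_bounded_anticausal_resolvent ric) iBL. Qed.
Let iY := mx_integrable_filtered_factor.

Lemma pencil_anticausal_resolvent (w : R) :
  ((expj w)^-1%:M - Ab) *m X (expj w) = 1%:M.
Proof.
rewrite -anticausal_resolventE; apply: mulmxV; rewrite expjV.
apply: cschur_unitmx; first exact: cschur_Abar.
by rewrite -expjN norm_expj.
Qed.

Lemma block_filtered_factor (k : int) :
  block Y (k - 1) = Ab *m block Y k + Bb *m block L k.
Proof.
rewrite -(block_mull Bb k iL); apply: (block_reverse_pencil _ iY); apply: ae_circleW => w.
rewrite /Y; have := pencil_anticausal_resolvent w.
by move: (_%:M - Ab) (X _) (Bb *m _) => U X0 B0 UX; rewrite mulmxA UX mul1mx.
Qed.

Lemma reverse_pencil_inv (w : R) :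
  invmx (1%:M - expj w *: Ab) = expj w ^ (-1) *: X (expj w).
Proof.
have zw := expj_neq0 w.
have E : (1%:M - expj w *: Ab) *m (expj w ^ (-1) *: X (expj w)) = 1%:M.
  rewrite -[RHS](pencil_anticausal_resolvent w) -scalemxAr scalemxAl.
  congr (_ *m _); rewrite scalerBr scalerA -[expj w ^ (-1)]/((expj w)^-1).
  by rewrite mulVf// scale1r scalemx1.
have [u _] := mulmx1_unit E.
by apply: (can_inj (mulKmx u)); rewrite (mulmxV u) E.
Qed.

(** On the circle [(1 - z Abar)^-1 = z^-1 (z^-1 - Abar)^-1], which shifts the
    mean to the index -1. *)
Lemma Gamma_star_block : Gamma_star A Bu Bw P L = block Y (-1).
Proof.
rewrite -[-1]add0r -block_expz; transitivity
    (block (fun z => invmx (1%:M - z *: Ab) *m Bb *m L z) 0).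
  by apply/matrixP => i j; rewrite blockE mxE; apply: eq_circle_mean => w; rewrite mul1r.
apply: eq_block => w; rewrite reverse_pencil_inv /Y.
by move: (X _) (Bb) (L _) => X0 B0 L0; rewrite -!scalemxAl mulmxA.
Qed.

(** The recursion for the blocks has real data; so their differences with the
    complex conjugates form a bounded backward orbit of the Schur stable [Ab]. *)
Lemma Gamma_star_real : mxconj (Gamma_star A Bu Bw P L) = Gamma_star A Bu Bw P L.
Proof.
rewrite Gamma_star_block; pose Z (k : nat) := block Y (k%:Z - 1) - mxconj (block Y (k%:Z - 1)).
have conjZ (M N : 'M[C]_(n, s)) : mxconj (M + N) = mxconj M + mxconj N by exact: map_mxD.
have conjM (a b c : nat) (M : 'M[C]_(a, b)) (N : 'M[C]_(b, c)) :
  mxconj (M *m N) = mxconj M *m mxconj N by exact: map_mxM.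
have sub (a b c : 'M[C]_(n, s)) : (a + b) - (c + b) = a - c.
  by rewrite opprD addrACA subrr addr0.
have Z0 : forall k, Z k = 0.
  apply: (backward_orbit0 cschur_Abar).
    have [c cY] := block_bounded iY; exists (c + c) => k i j.
    rewrite /Z; have := cY (k%:Z - 1) i j; move: (block Y _) => B cB.
    have -> : (B - mxconj B) i j = B i j - ((B i j)^*)%C by rewrite !mxE.
    rewrite (le_trans (ler_normB _ _))// rmorphD/= lerD//.
    by move: cB; case: (B i j) => x y; rewrite !normcE /= sqrrN.
  move=> k; rewrite /Z -addn1 PoszD addrK block_filtered_factor conjZ.
  rewrite (conjM _ _ _ Ab) (conjM _ _ _ Bb).
  rewrite AbarE BbarE !mxconj_toC (mxconj_real (M := block L _)); last first.
    by case: cL => -[].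
  by rewrite sub -mulmxBr.
by apply/esym/subr0_eq; have := Z0 0%N; rewrite /Z sub0r.
Qed.

(** In negative degrees the blocks of [X L] with input matrix [Bbar], and those of
    [X Gamma], follow the same recursion [H_(k-1) = Abar H_k] from the same start,
    as the blocks of [L] vanish there. *)
Lemma anticausal_part_TL :
  teq TLm (fun z => Cb *m X z *m Gamma_star A Bu Bw P L).
Proof.
have [tTLm blockTLm] := TLmE; rewrite Gamma_star_block.
pose J z := X z *m block Y (-1).
have iJ : mx_integrable J by exact: mx_integrable_mulr iX (mx_bounded_cst _).
have J0 (k : int) : 0 <= k -> block J k = 0.
  by move=> k0; rewrite block_mulr// (block_anticausal_resolvent ric)// mul0mx.
have Jrec (k : int) : block J (k - 1) = Ab *m block J k + if k == 0 then block Y (-1) else 0.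
  rewrite -block_cst; apply: (block_reverse_pencil _ iJ); apply: ae_circleW => w.
  by rewrite /J mulmxA pencil_anticausal_resolvent mul1mx.
have JY (k : nat) : block J (- k.+1%:Z) = block Y (- k.+1%:Z).
  elim: k => [|k IHk]; first by have := Jrec 0; rewrite (J0 0 (lexx 0)) mulmx0 !add0r.
  have -> : - k.+2%:Z = - k.+1%:Z - 1 by rewrite -[k.+2]addn1 PoszD opprD.
  have kn : - k.+1%:Z < 0 by rewrite oppr_lt0.
  have [_ cL0] := cL; have L0 := cL0 _ kn; have k0 := lt_eqF kn.
  by rewrite Jrec block_filtered_factor IHk L0 k0 mulmx0.
have iCJ : mx_integrable (fun z => Cb *m J z) by exact: mx_integrable_mull (mx_bounded_cst _) iJ.
have TL : teq (mul_op T L) (fun z => Cb *m Y z).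
  apply: ae_circleS TE => w E; rewrite /mul_op E T_formulaE anticausal_resolventE /Y.
  by move: (X _) (Bb) (L _) => X0 B0 L0; rewrite !mulmxA.
have H : teq TLm (fun z => Cb *m J z).
  apply: block_inj; [exact: toeplitz_integrable|exact: iCJ|].
  move=> k; rewrite blockTLm (block_mull _ _ iJ); have [k0|k0] := ltP k 0.
    rewrite (block_ae k TL) (block_mull _ _ iY).
    have [q ->] : exists q : nat, k = - q.+1%:Z.
      by case: k k0 => // q _; exists q; rewrite NegzE.
    by rewrite JY.
  by rewrite (J0 k k0) mulmx0.
by apply: ae_circleS H => w ->; rewrite /J mulmxA.
Qed.

End FiniteParameter.

(** * Square roots as limits of polynomials *)

Section SquareRootTrace.
Context {R : realType} {n : nat}.
Notation C := R[i].
Notation mu := (@lebesgue_measure R).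
Notation Re := complex.Re.
Notation D := (`[0, 2 * pi]%classic : set R).

(** The iteration [y <- y + (x - y ^ 2) / 2] increases to the square root of
    [x] on the unit interval; applied to matrices, it exhibits the square root
    as a pointwise limit of polynomials. *)
Fixpoint sqrt_iter (x : R) (k : nat) : R :=
  if k is k'.+1 then sqrt_iter x k' + 2^-1 * (x - sqrt_iter x k' * sqrt_iter x k') else 0.

Fixpoint sqrtmx_iter (X : 'M[C]_n) (k : nat) : 'M[C]_n :=
  if k is k'.+1 then
    sqrtmx_iter X k' + (2^-1)%:C *: (X + (-1)%:C *: (sqrtmx_iter X k' *m sqrtmx_iter X k'))
  else 0.

Lemma sqrt_iter_bounds (x : R) (k : nat) : 0 <= x <= 1 ->
  0 <= sqrt_iter x k <= Num.sqrt x /\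
  Num.sqrt x - sqrt_iter x k <= (1 - Num.sqrt x / 2) ^+ k * Num.sqrt x.
Proof.
move=> /andP[x0 x1]; set t := Num.sqrt x.
have t0 : 0 <= t by exact: sqrtr_ge0.
have tt : t * t = x by rewrite -expr2 sqr_sqrtr.
have t1 : t <= 1 by rewrite -sqrtr1 ler_wsqrtr.
elim: k => [|k [/andP[y0 yt] yk]] /=; first by rewrite lexx t0 subr0 expr0 mul1r.
set y := sqrt_iter x k in y0 yt yk *.
have E : t - (y + 2^-1 * (x - y * y)) = (t - y) * (1 - (t + y) / 2) by rewrite -tt; field.
have f0 : 0 <= 1 - (t + y) / 2 by lra.
split.
  apply/andP; split; last by rewrite -subr_ge0 E mulr_ge0// subr_ge0.
  have yyx : y * y <= x by rewrite -tt ler_pM.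
  by lra.
rewrite E exprS -mulrA [leLHS]mulrC; apply: ler_pM => //; first by rewrite subr_ge0.
by lra.
Qed.

Lemma cvg_sqrt_iter (x : R) : 0 <= x <= 1 -> sqrt_iter x @ \oo --> Num.sqrt x.
Proof.
move=> x01; have /andP[x0 x1] := x01.
have [->|xn0] := eqVneq x 0.
  rewrite sqrtr0; have E k : sqrt_iter 0 k = 0 :> R.
    by elim: k => //= k ->; rewrite mulr0 subrr mulr0 addr0.
  by rewrite (_ : sqrt_iter 0 = fun=> 0); [exact: cvg_cst|exact/funext].
set t := Num.sqrt x.
have t0 : 0 < t by rewrite sqrtr_gt0 lt_def xn0.
have t1 : t <= 1 by rewrite -sqrtr1 ler_wsqrtr.
have lim : (fun k => t - (1 - t / 2) ^+ k * t) @ \oo --> (t - 0 * t : R).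
  apply: cvgB; first exact: cvg_cst.
  apply: cvgM; last exact: cvg_cst.
  by apply: cvg_expr; rewrite ger0_norm; lra.
rewrite mul0r subr0 in lim.
apply: (@squeeze_cvgr _ _ _ R (fun k => t - (1 - t / 2) ^+ k * t) (cst t) _ _ t lim (cvg_cst _)).
apply: nearW => k; have [/andP[_ yt] yk] := sqrt_iter_bounds k x01.
by rewrite yt andbT lerBlDr addrC -lerBlDr.
Qed.

Lemma sqrtmx_iter_conj_diag (P : 'M[C]_n) d k : P *m P ^t* = 1%:M ->
  sqrtmx_iter (conj_diag P d) k = conj_diag P (fun i => sqrt_iter (d i) k).
Proof.
move=> PP; elim: k => [|k IHk] /=.
  apply/esym; have := conj_diagZ P (fun=> 0) 0; rewrite scale0r => ->.
  by apply: eq_conj_diag => i; rewrite mul0r.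
rewrite IHk (conj_diagM _ _ PP) conj_diagZ conj_diagD conj_diagZ conj_diagD.
by apply: eq_conj_diag => i; rewrite mulN1r.
Qed.

Lemma sqrtmx_conj_diag (P : 'M[C]_n) d : P *m P ^t* = 1%:M -> (forall i, 0 <= d i) ->
  sqrtmx (conj_diag P d) = conj_diag P (fun i => Num.sqrt (d i)).
Proof.
move=> PP d0; apply: sqrtmx_unique.
  by apply: psd_conj_diag => i; exact: sqrtr_ge0.
by rewrite (conj_diagM _ _ PP); apply: eq_conj_diag => i; rewrite -expr2 sqr_sqrtr.
Qed.

(** Dividing by this number brings the eigenvalues of a positive semidefinite
    matrix into the unit interval. *)
Definition trace_scale (X : 'M[C]_n) : R := 1 + Re (\tr X).

Definition sqrt_trace_approx (X : 'M[C]_n) (k : nat) : R :=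
  Num.sqrt (trace_scale X) * Re (\tr (sqrtmx_iter ((trace_scale X)^-1%:C *: X) k)).

Lemma cvg_sqrt_trace (X : 'M[C]_n) : psdmx X ->
  sqrt_trace_approx X @ \oo --> Re (\tr (sqrtmx X)).
Proof.
move=> /psd_spectral[P [d [PP _ d0 ->]]].
set t := trace_scale (conj_diag P d).
have tE : t = 1 + \sum_i d i by rewrite /t /trace_scale (trace_conj_diag _ PP).
have s0 : 0 <= \sum_i d i by apply: sumr_ge0.
have t1 : 1 <= t by rewrite tE lerDl.
have t0 : 0 < t by exact: lt_le_trans t1.
have dt i : 0 <= t^-1 * d i <= 1.
  rewrite mulr_ge0 ?invr_ge0 ?(ltW t0)//= mulrC ler_pdivrMr// mul1r tE.
  by rewrite (bigD1 i)//= addrCA lerDl addr_ge0// sumr_ge0.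
rewrite (sqrtmx_conj_diag PP d0) (trace_conj_diag _ PP) /=.
have -> : sqrt_trace_approx (conj_diag P d) =
    fun k => Num.sqrt t * \sum_i sqrt_iter (t^-1 * d i) k.
  apply/funext => k; rewrite /sqrt_trace_approx -/t conj_diagZ.
  by rewrite (sqrtmx_iter_conj_diag _ _ PP) (trace_conj_diag _ PP).
have -> : \sum_i Num.sqrt (d i) = Num.sqrt t * \sum_i Num.sqrt (t^-1 * d i).
  rewrite mulr_sumr; apply: eq_bigr => i _.
  by rewrite -sqrtrM ?(ltW t0)// mulrA mulfV ?gt_eqF// mul1r.
apply: cvgM; first exact: cvg_cst.
elim: (index_enum _) => [|i r IHr].
  rewrite big_nil (_ : (fun k => _) = fun=> 0); first exact: cvg_cst.
  by apply/funext => k; rewrite big_nil.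
rewrite big_cons (_ : (fun k => _) = fun k => sqrt_iter (t^-1 * d i) k +
  \sum_(j <- r) sqrt_iter (t^-1 * d j) k); last by apply/funext => k; rewrite big_cons.
by apply: cvgD => //; exact: cvg_sqrt_iter.
Qed.

(** Apply [sqrt d <= (1 + d) / 2] to the eigenvalues. *)
Lemma sqrt_trace_bounds (X : 'M[C]_n) : psdmx X ->
  0 <= Re (\tr (sqrtmx X)) <= (n%:R + Re (\tr X)) / 2.
Proof.
move=> /psd_spectral[P [d [PP _ d0 ->]]].
rewrite (sqrtmx_conj_diag PP d0) !(trace_conj_diag _ PP) /=.
apply/andP; split; first by apply: sumr_ge0 => i _; exact: sqrtr_ge0.
have -> : n%:R = \sum_(i < n) 1 :> R by rewrite sumr_const card_ord.
rewrite -big_split/= mulr_suml; apply: ler_sum => i _.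
have dE : d i = Num.sqrt (d i) * Num.sqrt (d i) by rewrite -expr2 sqr_sqrtr.
rewrite {2}dE; move: (Num.sqrt (d i)) => x; have := sqr_ge0 (x - 1).
by rewrite expr2; lra.
Qed.

End SquareRootTrace.

(** * The Bures-Wasserstein distance to the identity *)

Section SquareRootTraceIntegrable.
Context {R : realType} {n : nat}.
Notation C := R[i].
Notation mu := (@lebesgue_measure R).
Notation Re := complex.Re.
Notation D := (`[0, 2 * pi]%classic : set R).

#[local] Existing Instance lebesgue_ae_filter.

Definition mx_measurable {p q : nat} (V : transfer R p q) :=
  forall i j, circ_measurable (fun z => V z i j).

Lemma circ_measurable_sum (I : finType) (F : I -> C -> C) :
  (forall i, circ_measurable (F i)) -> circ_measurable (fun z => \sum_i F i z).
Proof.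
move=> bF; elim: (index_enum I) => [|i s IHs].
  by apply: eq_circ_measurable (circ_measurable_cst 0) => w; rewrite big_nil.
by apply: eq_circ_measurable (circ_measurableD (bF i) IHs) => w; rewrite big_cons.
Qed.

Lemma mx_measurableD {p q : nat} (V W : transfer R p q) :
  mx_measurable V -> mx_measurable W -> mx_measurable (fun z => V z + W z).
Proof.
move=> mV mW i j; apply: eq_circ_measurable (circ_measurableD (mV i j) (mW i j)) => w.
by rewrite mxE.
Qed.

Lemma mx_measurableM {p q s : nat} (V : transfer R p q) (W : transfer R q s) :
  mx_measurable V -> mx_measurable W -> mx_measurable (fun z => V z *m W z).
Proof.
move=> mV mW i j; apply: eq_circ_measurable
  (circ_measurable_sum (fun k => circ_measurableM (mV i k) (mW k j))) => w.
by rewrite mxE.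
Qed.

Lemma mx_measurableZ {p q : nat} (f : C -> C) (V : transfer R p q) :
  circ_measurable f -> mx_measurable V -> mx_measurable (fun z => f z *: V z).
Proof.
move=> mf mV i j; apply: eq_circ_measurable (circ_measurableM mf (mV i j)) => w.
by rewrite mxE.
Qed.

Lemma circ_measurable_trace (V : transfer R n n) :
  mx_measurable V -> circ_measurable (fun z => \tr (V z)).
Proof. by move=> mV; exact: circ_measurable_sum (fun i => mV i i). Qed.

Lemma circ_integrable_trace (V : transfer R n n) :
  mx_integrable V -> circ_integrable (fun z => \tr (V z)).
Proof.
by move=> iV; have [] := @circle_mean_sum R 'I_n predT _ (fun i => iV i i).
Qed.

Lemma measurable_sqrt_trace_approx (M : transfer R n n) (k : nat) : mx_measurable M ->
  measurable_fun D (fun w => sqrt_trace_approx (M (expj w)) k).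
Proof.
move=> mM; have mt : measurable_fun D (fun w => trace_scale (M (expj w))).
  apply: measurable_funD; first exact: measurable_cst.
  by have [] := circ_measurable_trace mM.
have mtC : circ_measurable (fun z => ((trace_scale (M z))^-1)%:C).
  have mtC : circ_measurable (fun z => (trace_scale (M z))%:C).
    by split; [exact: mt|exact: measurable_cst].
  by apply: eq_circ_measurable (circ_measurableV mtC) => w; rewrite fmorphV.
have miter : mx_measurable (fun z => sqrtmx_iter ((trace_scale (M z))^-1%:C *: M z) k).
  elim: k => [|k IHk] /=; first by move=> i j; exact: circ_measurable_cst.
  apply: (mx_measurableD IHk); apply: mx_measurableZ; first exact: circ_measurable_cst.
  apply: mx_measurableD; first exact: mx_measurableZ.
  apply: mx_measurableZ; first exact: circ_measurable_cst.
  exact: (mx_measurableM IHk IHk).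
apply: measurable_funM; last by have [] := circ_measurable_trace miter.
apply: (@measurableT_comp _ _ _ _ _ _ (@Num.sqrt R)) => //.
by apply: continuous_measurable_fun; exact: sqrt_continuous.
Qed.

(** The square root is measurable only where its argument is positive
    semidefinite; the exceptional null set is cut out. *)
Lemma sqrt_trace_integrable (M : transfer R n n) :
  mx_integrable M -> ae_circle (fun z => psdmx (M z)) ->
  exists u : R -> R, mu.-integrable D (EFin \o u) /\
    {ae mu, forall w, D w -> Re (\tr (sqrtmx (M (expj w)))) = u w}.
Proof.
move=> iM aM; pose s w := Re (\tr (sqrtmx (M (expj w)))).
have : {ae mu, forall w, D w -> psdmx (M (expj w))} by exact: ae_circle_ae aM.
move=> [N [mN N0 MN]].
have pM w : D w -> ~ N w -> psdmx (M (expj w)).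
  by move=> Dw; apply: contra_notP => h; apply: MN => /= /(_ Dw).
have mM : mx_measurable M by move=> i j; exact/circ_integrable_measurable/iM.
have mDN : measurable (D `\` N) by exact: measurableD.
have ms : measurable_fun (D `\` N) s.
  apply: (@measurable_fun_cvg _ _ _ _ (fun k w => sqrt_trace_approx (M (expj w)) k)).
    move=> k; apply: (@measurable_funS _ _ _ _ D); [by []|exact: subDsetl|].
    exact: measurable_sqrt_trace_approx.
  by move=> w [Dw Nw]; apply: cvg_sqrt_trace; exact: pM.
exists (s \_ (D `\` N)); split; last first.
  exists N; split=> // w /= h; apply: contrapT => Nw; apply: h => Dw.
  by rewrite patchE mem_set.
have mtr : mu.-integrable D (EFin \o (fun w => 2^-1 * (n%:R + Re (\tr (M (expj w)))))).
  apply: integrableZ; apply: integrable_add.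
    by have [] := @circ_integrable_cst R (n%:R%:C).
  by have [] := circ_integrable_trace iM.
apply: (le_integrable _ _ _ mtr) => //.
  apply/measurable_EFinP/measurable_restrict => //.
  by apply: measurable_funS ms => //; exact: subIsetr.
move=> w Dw; rewrite /= lee_fin patchE; case: ifPn => [/set_mem[_ Nw]|_]; last by rewrite normr0.
have /andP[s0 sb] := sqrt_trace_bounds (pM w Dw Nw).
by rewrite ger0_norm// (le_trans sb)// mulrC ler_norm.
Qed.

End SquareRootTraceIntegrable.

Section BuresWasserstein.
Context {R : realType} {n : nat}.
Notation C := R[i].
Notation mu := (@lebesgue_measure R).
Notation Re := complex.Re.
Notation D := (`[0, 2 * pi]%classic : set R).

#[local] Existing Instance lebesgue_ae_filter.

Lemma BW_ae (M1 M2 : transfer R n n) : teq M1 M2 -> BW M1 id_op = BW M2 id_op.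
Proof.
move=> E; rewrite /BW /tr_op; apply: (congr1 (fun x : C => Num.sqrt (Re x))); apply: circle_mean_ae.
by apply: ae_circleS E => w ->.
Qed.

(** A dilation of [M] by [c ^ 2] multiplies its square root by [c]. *)
Lemma BW_ray (M : transfer R n n) : mx_integrable M -> ae_circle (fun z => psdmx (M z)) ->
  exists a b : R, forall c, 0 < c ->
    BW (fun z => (c ^+ 2)%:C *: M z) id_op = Num.sqrt (c ^+ 2 * a + n%:R - 2 * c * b).
Proof.
move=> iM pM; have [u [iu uE]] := sqrt_trace_integrable iM pM.
have [itr _] := circ_integrable_trace iM.
exists (arc_mean (fun w => Re (\tr (M (expj w))))), (arc_mean u) => c c0.
rewrite /BW /tr_op circle_meanE; apply: (congr1 (@Num.sqrt R)).
have i1 := integrableZ (c ^+ 2) itr; have i2 := integrableZ (- (2 * c)) iu.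
have i3 : mu.-integrable D (EFin \o (fun=> n%:R : R)).
  by have [] := @circ_integrable_cst R (n%:R%:C).
rewrite -arc_meanZ// -[X in _ + X - _](@arc_mean_cst R) -mulNr -[- (2 * c) * _]arc_meanZ//.
rewrite -arc_meanD// -arc_meanD//; last exact: integrable_add.
apply: arc_mean_ae; move: uE; apply: filterS => w uE Dw; rewrite -uE//.
rewrite /id_op sqrtmx1 mul1mx mulmx1 sqrtmxZ// scalerA.
have -> : 2 * c%:C = (2 * c)%:C :> C by rewrite rmorphM/= rmorph_nat.
rewrite -scaleNr !mxtraceD !mxtraceZ mxtrace1 !ReD -rmorphN.
have ReZ (a : R) (x : C) : Re (a%:C * x) = a * Re x by rewrite ReM /= mul0r subr0.
by rewrite !ReZ -[n%:R in LHS](rmorph_nat (real_complex R)).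
Qed.

Lemma quadratic_slack (a b d r : R) : 0 < r -> Num.sqrt (1 ^+ 2 * a + d - 2 * 1 * b) < r ->
  exists2 c : R, 1 < c & Num.sqrt (c ^+ 2 * a + d - 2 * c * b) <= r.
Proof.
move=> r0; set q := _ - _ => qr.
have qr2 : q < r ^+ 2.
  rewrite -[r]ger0_norm ?ltW// -sqrtr_sqr in qr.
  by move: qr; rewrite ltr_sqrt// exprn_gt0.
pose K := 2 * `|a - b| + `|a| + 1.
have K0 : 0 < K by rewrite /K ltr_wpDl// addr_ge0// mulr_ge0.
pose e := Num.min 1 ((r ^+ 2 - q) / K).
have e0 : 0 < e by rewrite lt_min ltr01 divr_gt0// subr_gt0.
have e1 : e <= 1 by rewrite ge_min lexx.
have eK : e * K <= r ^+ 2 - q by rewrite -ler_pdivlMr// ge_min lexx orbT.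
exists (1 + e); first by rewrite ltrDl.
have rE : r = Num.sqrt (r ^+ 2) by rewrite sqrtr_sqr gtr0_norm.
clearbody e; rewrite [leRHS]rE; apply: ler_wsqrtr.
have -> : (1 + e) ^+ 2 * a + d - 2 * (1 + e) * b = q + (2 * e * (a - b) + e * (e * a)).
  by rewrite /q; ring.
have h1 : 2 * e * (a - b) <= e * (2 * `|a - b|).
  rewrite -mulrA mulrCA ler_wpM2l ?(ltW e0)// ler_wpM2l//; exact: ler_norm.
have h2 : e * (e * a) <= e * `|a|.
  rewrite ler_wpM2l ?(ltW e0)//; apply: le_trans (ler_norm _) _.
  by rewrite normrM ger0_norm ?(ltW e0)// ler_piMl.
have : e * K = e * (2 * `|a - b|) + e * `|a| + e by rewrite /K; ring.
by lra.
Qed.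

End BuresWasserstein.

(** * Activity of the constraint *)

Section ActiveConstraint.
Context {R : realType} {n m s p : nat}.
Notation C := R[i].
Notation Re := complex.Re.
Context (A : 'M[R]_n) (Bu : 'M[R]_(n, m)) (Bw : 'M[R]_(n, s)) (Cs : 'M[R]_(p, n)) (P : 'M[R]_n).
Context (ric : stabilizing_riccati A Bu Cs P).
Context (sA : cschur (toC A)).

Notation F := (ss_transfer Cs A Bu).
Notation G := (ss_transfer Cs A Bw).

Lemma mx_bounded_op {a b : nat} (V : transfer R a b) :
  bounded_op V -> toeplitz V -> mx_bounded V.
Proof.
move=> [c cV] /toeplitz_integrable iV i j; split.
  exact/circ_integrable_measurable/iV.
by exists c; apply: ae_circleS cV => w /(_ i j).
Qed.

Lemma mx_bounded_F : mx_bounded F. Proof. exact: mx_bounded_ss. Qed.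
Lemma mx_bounded_G : mx_bounded G. Proof. exact: mx_bounded_ss. Qed.

Lemma mx_bounded_IFF : mx_bounded (IFF F).
Proof.
apply: mx_boundedD; first exact: mx_bounded_cst.
exact: mx_boundedM (mx_bounded_adj mx_bounded_F) mx_bounded_F.
Qed.

Lemma mx_bounded_K_nc : mx_bounded (K_nc F G).
Proof.
pose Di := spectral_factor_inv A Bu P.
have bDi : mx_bounded Di by exact: mx_bounded_spectral_factor_inv ric.
have bV := mx_boundedM (mx_boundedM (mx_boundedM bDi (mx_bounded_adj bDi))
  (mx_bounded_adj mx_bounded_F)) mx_bounded_G.
apply: eq_mx_bounded (mx_boundedM (mx_bounded_cst (- 1%:M)) bV) => w.
rewrite mulNmx mul1mx /K_nc -(spectral_factorP ric sA) /adj_op /Di.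
rewrite (spectral_factor_invE ric sA); have := spectral_factor_unit ric sA w.
move: (spectral_factor _ _ _ _) (F _) (G _) => D F0 G0 u.
have uD : D ^t* \in unitmx by rewrite map_unitmx unitmx_tr.
have uDD : D ^t* *m D \in unitmx by rewrite unitmx_mul uD.
have -> : invmx (D ^t* *m D) = invmx D *m (invmx D) ^t*.
  apply: (can_inj (mulKmx uDD)); rewrite (mulmxV uDD) mulmxA -[_ *m D *m _]mulmxA.
  by rewrite (mulmxV u) mulmx1 conjmx_inv (mulmxV uD).
by [].
Qed.

Lemma circ_integrable_cost (K : transfer R m s) (M : transfer R s s) :
  mx_bounded K -> mx_integrable M ->
  circ_integrable (fun z => \tr (mul_op (regret_op F G K) M z)).
Proof.
move=> bK iM; apply: circ_integrable_trace; apply: mx_integrable_mull => //.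
have bE : mx_bounded (fun z => K z - K_nc F G z).
  apply: (mx_boundedD bK).
  apply: eq_mx_bounded (mx_boundedM (mx_bounded_cst (- 1%:M)) mx_bounded_K_nc) => w.
  by rewrite mulNmx mul1mx.
exact: mx_boundedM (mx_boundedM (mx_bounded_adj bE) mx_bounded_IFF) bE.
Qed.

Lemma costZ (K : transfer R m s) (M : transfer R s s) (c : R) :
  mx_bounded K -> mx_integrable M ->
  cost F G K (fun z => c%:C *: M z) = c * cost F G K M.
Proof.
move=> bK iM; rewrite /cost /tr_op.
rewrite (eq_circle_mean (g := fun z => c%:C * \tr (mul_op (regret_op F G K) M z))).
  by rewrite (circle_meanZ _ (circ_integrable_cost bK iM)) ReM /= mul0r subr0.
by move=> w; rewrite /mul_op -scalemxAr mxtraceZ.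
Qed.

Lemma cost_ge0 (K : transfer R m s) (M L : transfer R s s) :
  teq M (mul_op L (adj_op L)) -> 0 <= cost F G K M.
Proof.
move=> ML; apply: circle_mean_Re_ge0; apply: ae_circleS ML => w E.
rewrite /mul_op E /mul_op /adj_op /regret_op /IFF.
move: (K _ - _) (F _) (L _) => E0 F0 L0.
have -> : \tr (E0 ^t* *m (1%:M + F0 ^t* *m F0) *m E0 *m (L0 *m L0 ^t*)) =
    \tr ((E0 *m L0) ^t* *m ((E0 *m L0) ^t*) ^t*) +
    \tr ((F0 *m E0 *m L0) ^t* *m ((F0 *m E0 *m L0) ^t*) ^t*).
  rewrite mulmxA mxtrace_mulC -mxtraceD !adjK !adj_mul.
  move: (E0 ^t*) (F0 ^t*) (L0 ^t*) => E1 F1 L1; apply: (congr1 mxtrace).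
  by rewrite !mulmxA mulmxDr mulmx1 mulmxDl mulmxDl !mulmxA.
have := addr_ge0 (trace_mul_adj_ge0 ((E0 *m L0) ^t*)) (trace_mul_adj_ge0 ((F0 *m E0 *m L0) ^t*)).
by move: (\tr _ + \tr _) => x; rewrite lecE /= => /andP[].
Qed.

Lemma toeplitzZ (M : transfer R s s) (c : R) :
  toeplitz M -> toeplitz (fun z => c%:C *: M z).
Proof.
move=> tM; have iM := toeplitz_integrable tM; have [_ rM] := tM.
have iE w : (c%:C)%:M *m M (expj w) = c%:C *: M (expj w) by rewrite mul_scalar_mx.
have iN : mx_integrable (fun z => c%:C *: M z).
  apply: (@eq_mx_integrable _ _ _ (fun z => (c%:C)%:M *m M z)); first exact: iE.
  exact: mx_integrable_mull (mx_bounded_cst _) iM.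
split; first exact: iN.
move=> k; have -> : block (fun z => c%:C *: M z) k = c%:C *: block M k.
  by rewrite -mul_scalar_mx -(block_mull _ _ iM); apply: eq_block => w; rewrite iE.
apply/mxOverP => i j; rewrite mxE realM//; first by rewrite complex_real.
by have /mxOverP := rM k; exact.
Qed.

(** If the constraint were slack, then a dilation [c ^ 2 M] with [1 < c] would
    be feasible. As the cost is homogeneous in [M], the optimality of [M] makes
    the optimal cost vanish, and then [(K, c ^ 2 M)] is another saddle point. *)
Theorem saddle_point_active (K : transfer R m s) (M L : transfer R s s) (r : R) :
  (0 < s)%N -> 0 < r -> unique_saddle_point F G r K M ->
  canonical_right_factor M L -> BW M id_op = r.
Proof.
move=> s0 r0 [[aK fM optK optM] uniq] [ML _ _].
have [bwK [tK _]] := aK; have bK := mx_bounded_op bwK tK.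
have [tM pM BWr] := fM; have iM := toeplitz_integrable tM.
have psM : ae_circle (fun z => psdmx (M z)) by apply: ae_circleS pM => w; exact: posdef_psd.
apply/eqP; rewrite eq_le BWr leNgt /=; apply/negP => BWlt.
have [a [b BWE]] := BW_ray iM psM.
have [c c1 cr] : exists2 c : R, 1 < c & Num.sqrt (c ^+ 2 * a + s%:R - 2 * c * b) <= r.
  apply: (quadratic_slack r0); rewrite -(BWE 1 ltr01) (@BW_ae _ _ _ M); first exact: BWlt.
  by apply: ae_circleW => w; rewrite expr1n scale1r.
have c0 : 0 < c by exact: lt_trans c1.
pose M' z := (c ^+ 2)%:C *: M z.
have fM' : feasible_M r M'.
  split; first exact: toeplitzZ.
    by apply: ae_circleS pM => w; apply: posdefZ; rewrite exprn_gt0.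
  by rewrite (BWE c c0).
have c21 : 1 < c ^+ 2 by rewrite exprn_egt1.
have cost0 : cost F G K M = 0.
  have := optM M' fM'; rewrite (costZ _ bK iM) => h.
  have g0 := cost_ge0 K ML.
  have : (c ^+ 2 - 1) * cost F G K M <= 0 by rewrite mulrBl mul1r subr_le0.
  rewrite pmulr_rle0 ?subr_gt0// => l0.
  by apply/eqP; rewrite eq_le l0.
have sad : saddle_point F G r K M'.
  split; [exact: aK|exact: fM'| |].
    move=> K' aK'; have [bwK' [tK' _]] := aK'; have bK' := mx_bounded_op bwK' tK'.
    rewrite (costZ _ bK iM) (costZ _ bK' iM); apply: ler_wpM2l; first exact: sqr_ge0.
    exact: optK.
  by move=> M'' fM''; rewrite (costZ _ bK iM) cost0 mulr0 -cost0; exact: optM.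
have [_ MM'] := uniq _ _ sad.
have /ae_circle_ex[w [Mw pMw]] := ae_circle_and MM' pM.
have M0 : M (expj w) = 0.
  have : ((c ^+ 2)%:C - 1) *: M (expj w) = 0 by rewrite scalerBl scale1r -{2}Mw subrr.
  move/eqP; rewrite scaler_eq0 => /orP[|/eqP//].
  rewrite -[1]/(1%:C) -rmorphB => /eqP/complexI/eqP.
  by rewrite gt_eqF// subr_gt0.
pose u : 'rV[C]_s := const_mx 1.
have u0 : u != 0.
  by apply/eqP => /rowP/(_ (Ordinal s0)); rewrite !mxE => /eqP; rewrite oner_eq0.
by have := pMw.2 u u0; rewrite M0 mulmx0 mul0mx mxE ltxx.
Qed.

End ActiveConstraint.

(** * Main result *)

Theorem theorem4p2 (R : realType) (dx du dw ds : nat)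
  (A : 'M[R]_dx) (Bu : 'M[R]_(dx, du)) (Bw : 'M[R]_(dx, dw)) (C : 'M[R]_(ds, dx))
  (P : 'M[R]_dx) (r gamma : R)
  (Delta : transfer R du du) (T TLm K : transfer R du dw) (M L : transfer R dw dw)
  (F := ss_transfer C A Bu) (G := ss_transfer C A Bw) :
  (0 < dw)%N ->
  stabilizable A Bu -> controllable A Bw -> observable A C ->
  strictly_causal F -> strictly_causal G ->
  stabilizing_riccati A Bu C P ->
  canonical_left_factor (IFF F) Delta ->
  anticausal_part (mul_op Delta (K_nc F G)) T ->
  0 < r ->
  unique_saddle_point F G r K M ->
  canonical_right_factor M L ->
  0 < gamma ->
  anticausal_part (mul_op T L) TLm ->
  optimality_conditions F G gamma K M L TLm ->
  [/\ teq T (T_formula A Bu Bw P),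
      exists2 Gamma : 'M[R]_(dx, dw),
        toC Gamma = Gamma_star A Bu Bw P L &
        teq (mul_op (adj_op L) L) (f_map A Bu P gamma Gamma)
    & BW (mul_op L (adj_op L)) id_op = r].
Proof.
move=> dw0 _ cAB oAC _ cG ric cD aT r0 sad cML _ aTL [_ optL].
have sA : cschur (toC A) := minimal_strictly_causal_schur cAB oAC cG.
have TE : teq T (T_formula A Bu Bw P) := anticausal_part_T ric sA cD aT.
have [ML cL _] := cML.
have GR := mxconj_fixed (Gamma_star_real Bw ric cL).
split; first exact: TE.
  exists (map_mx (@complex.Re R) (Gamma_star A Bu Bw P L)).
    exact: GR.
  rewrite /teq; have TLmE := anticausal_part_TL ric TE cL aTL.
  apply: ae_circleS2 optL TLmE => w -> TLw.
  rewrite /f_map GR anticausal_resolventE /= TLw.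
  by rewrite !adj_mul !mulmxA.
by rewrite -(BW_ae ML); exact: (saddle_point_active ric sA dw0 r0 sad cML).
Qed.
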